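(* Let $\psi\in L^2(\mathbb{R}^2)$ and for $u\in\mathbb{R}$, $s>0$ put $$\psi_{u,s}(x_1,x_2)=s^{-1/2}\psi\left(\frac{x_1-u}{s},x_2\right).$$ The system $\{\psi_{u,s}\}_{u\in\mathbb{R},s>0}$, with parameter measure $\frac{du\,ds}{s^2}$ on $\mathbb{R}\times(0,\infty)$, is reproducing in $L^2(\mathbb{R}^2)$ if and only if each of the two maps (one for the sign $+$, one for the sign $-$) $$f\mapsto \int_{\mathbb{R}} \overline{\psi\left(\widehat{\pm s},y\right)}\, f(y)\,dy ,$$ from $L^2(\mathbb{R})$ into $L^2\left(\mathbb{R}_+,\frac{ds}{s}\right)$, preserves inner products.
   Context: The Fourier transform is $\hat f(\xi)=\int f(x)e^{-2\pi i x\xi}\,dx$ (extended to $L^2$ by Plancherel). For a function $\psi(x_1,x_2)$, the notation $\psi(\hat{s},y)$ denotes the Fourier transform of $\psi$ in the first variable only, evaluated at frequency $s$, with the second variable equal to $y$; thus $\psi(\widehat{\pm s},y)$ is this partial Fourier transform evaluated at $\pm s$, $s>0$. A system $\{\psi_{u,s}\}$ with parameter measure $\frac{du\,ds}{s^2}$ is called reproducing in $L^2(\mathbb{R}^2)$ if $f=\int_{\mathbb{R}\times(0,\infty)}\langle f,\psi_{u,s}\rangle\psi_{u,s}\,\frac{du\,ds}{s^2}$ for all $f\in L^2(\mathbb{R}^2)$ with the integral converging weakly, i.e. $\int_{\mathbb{R}\times(0,\infty)}\langle f,\psi_{u,s}\rangle\langle\psi_{u,s},g\rangle\frac{du\,ds}{s^2}=\langle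 f,g\rangle$ for all $f,g\in L^2(\mathbb{R}^2)$. *)

(* Defs.v *)
From mathcomp Require Import all_boot all_order all_algebra.
From mathcomp Require Import all_classical all_reals all_analysis.
From mathcomp.real_closed Require Export complex.
Export Order.TTheory GRing.Theory Num.Theory.

Set Implicit Arguments.
Unset Strict Implicit.
Unset Printing Implicit Defensive.

Local Open Scope classical_set_scope.
Local Open Scope ring_scope.

Section Defs.
Context {R : realType}.

Definition leb1 := (@lebesgue_measure R).
Definition leb2 := (leb1 \x leb1)%E.

Definition csq (z : R[i]) : R := complex.Re z ^+ 2 + complex.Im z ^+ 2.

Definition expi (t : R) : R[i] := Complex (cos t) (sin t).

Definition cR (a : R) : R[i] := Complex a 0.

Context {d : measure_display} {T : measurableType d}.

Definition cmeasurable (D : set T) (f : T -> R[i]) :=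
  measurable_fun D (fun x => complex.Re (f x)) /\ measurable_fun D (fun x => complex.Im (f x)).

Definition cintegrable (m : {measure set T -> \bar R}) (D : set T)
  (f : T -> R[i]) :=
  m.-integrable D (fun x => (complex.Re (f x))%:E) /\
  m.-integrable D (fun x => (complex.Im (f x))%:E).

Definition cint (m : {measure set T -> \bar R}) (D : set T) (f : T -> R[i])
  : R[i] :=
  Complex (Rintegral m D (fun x => complex.Re (f x))) (Rintegral m D (fun x => complex.Im (f x))).

Definition isL2 (m : {measure set T -> \bar R}) (f : T -> R[i]) :=
  cmeasurable setT f /\ m.-integrable setT (fun x => (csq (f x))%:E).

Definition cip (m : {measure set T -> \bar R}) (f g : T -> R[i]) : R[i] :=
  cint m setT (fun x => f x * conjc (g x)).

End Defs.

Section Wavelet.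
Context {R : realType}.

Definition psi_us (psi : R * R -> R[i]) (u s : R) : R * R -> R[i] :=
  fun x => cR (Num.sqrt s)^-1 * psi ((x.1 - u) / s, x.2).

Definition Rpos : set R := `]0, +oo[%classic.
Definition param_set : set (R * R) := setT `*` Rpos.

(** The system {psi_{u,s}} is reproducing in L^2(R^2) w.r.t. du ds / s^2:
    for all f, g in L^2(R^2),
    (u,s) |-> <f,psi_{u,s}> <psi_{u,s},g> is integrable for du ds/s^2 on
    R x (0,oo) (expressed through the density s^{-2} w.r.t. Lebesgue measure)
    and its integral equals <f,g>. *)
Definition reproducing (psi : R * R -> R[i]) :=
  forall f g : R * R -> R[i], isL2 leb2 f -> isL2 leb2 g ->
  let F := fun p : R * R =>
    cip leb2 f (psi_us psi p.1 p.2) * cip leb2 (psi_us psi p.1 p.2) g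
    * cR (p.2 ^+ 2)^-1 in
  cintegrable leb2 param_set F /\ cint leb2 param_set F = cip leb2 f g.

Definition pft_trunc (psi : R * R -> R[i]) (N : R) : R * R -> R[i] :=
  fun z => cint leb1 `[- N, N]%classic
             (fun x => psi (x, z.2) * expi (- (2 * pi * x * z.1))).

(** Psihat is the (Plancherel, L^2) partial Fourier transform of psi in the
    first variable: it is in L^2(R^2) and is the L^2(R^2)-limit of the
    truncated transforms. Psihat (s, y) is the notation psi(\hat s, y). *)
Definition is_partial_FT (psi Psihat : R * R -> R[i]) :=
  isL2 leb2 Psihat /\
  ((fun N : nat =>
      (\int[leb2]_z (csq (Psihat z - pft_trunc psi N%:R z))%:E)%E)
     @ \oo --> 0%E).

Definition Tmap (Psihat : R * R -> R[i]) (sgn : R) (f : R -> R[i]) : R -> R[i] :=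
  fun s => cint leb1 setT (fun y => conjc (Psihat (sgn * s, y)) * f y).

Definition preserves_ip (Psihat : R * R -> R[i]) (sgn : R) :=
  forall f g : R -> R[i], isL2 leb1 f -> isL2 leb1 g ->
    (cmeasurable Rpos (Tmap Psihat sgn f) /\
     leb1.-integrable Rpos (fun s => (csq (Tmap Psihat sgn f s) / s)%:E)) /\
    cint leb1 Rpos
      (fun s => Tmap Psihat sgn f s * conjc (Tmap Psihat sgn g s) * cR s^-1)
    = cip leb1 f g.

End Wavelet.

(* Main.v *)
(** Write ift for the inverse Fourier transform and, for h in L^2(R), let
    (Tf h)(x) be the integral of conj(psi(x^, y)) h(y) dy.  For f = ift G (x) h
    with G in L^2 of bounded support, the wavelet coefficient <f, psi_{u,s}> is
    the value at u of ift applied to x |-> sqrt(s) G(x) (Tf h)(s x).  Plancherel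
    in u, Tonelli and the scale invariance of ds/s on each half-line turn the
    integral of |<f, psi_{u,s}>|^2 du ds/s^2 into the integral over x of |G(x)|^2
    times the squared norm, in L^2(ds/s), of s |-> (Tf h)(sgn(x) s).  Taking for
    G the indicator of ]0, 1] or of ]-1, 0] gives one implication.  Conversely
    the functions f as above span a dense subspace, on which the wavelet
    transform preserves inner products; the identity extends to all of L^2(R^2)
    by Fatou's lemma.

    Plancherel's identity for ift is needed only up to a positive constant
    kappa, which cancels.  Translation and dilation give it for indicators of
    intervals, polarization gives the real part of the inner products, and the
    imaginary part vanishes by the symmetry u |-> -u. *)
From HB Require Import structures.
Require Import Defs.
From mathcomp Require Import all_boot all_order all_algebra.
From mathcomp Require Import all_classical all_reals all_analysis.
From mathcomp Require Import measurable_realfun.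
From mathcomp.real_closed Require Import complex.
From mathcomp Require Import ring lra.
Import Order.TTheory GRing.Theory Num.Theory.
Import numFieldNormedType.Exports.
Set Implicit Arguments.
Unset Strict Implicit.
Unset Printing Implicit Defensive.
Local Open Scope classical_set_scope.
Local Open Scope ring_scope.

Local Notation Re := complex.Re.
Local Notation Im := complex.Im.

(** * Complex-valued functions, their integrals and L^2 *)

(** Square integrability of a wavelet transform, or of the image of h under the map of the theorem,
    is part of what each implication claims and cannot be presupposed. The norm identities are
    therefore proved in [\bar R] by Tonelli and read as finiteness; the inner product identities
    follow by Fubini.

    The partial transform of psi is only an L^2 limit of truncated integrals, whereas the formula
    for <f, psi_{u,s}> is wanted at every u and every s > 0. It is proved for truncated psi and
    passes to the limit because, for G bounded with bounded support, both of its sides depend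
    continuously on the L^2 data.

    The wavelet transform of an arbitrary f is already a function, given by inner products, so
    extending the isometry means controlling this function, not constructing a limit. The bound from
    Fatou's lemma is lossy and serves only as continuity; the exact identity is then forced by its
    validity on generators. Plancherel for [ift] on a bounded interval is extended by the same
    argument. Density of the functions ift G (x) h rests on the density of the range of [ift], which
    comes from its adjoint. *)

Section ComplexAlgebra.
Context {R : realType}.
Implicit Types z w : R[i].

Lemma ReD z w : Re (z + w) = Re z + Re w. Proof. by case: z; case: w. Qed.
Lemma ImD z w : Im (z + w) = Im z + Im w. Proof. by case: z; case: w. Qed.
Lemma ReN z : Re (- z) = - Re z. Proof. by case: z. Qed.
Lemma ImN z : Im (- z) = - Im z. Proof. by case: z. Qed.
Lemma ReM z w : Re (z * w) = Re z * Re w - Im z * Im w.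
Proof. by case: z; case: w. Qed.
Lemma ImM z w : Im (z * w) = Re z * Im w + Im z * Re w.
Proof. by case: z; case: w. Qed.
Lemma Re_conj z : Re (conjc z) = Re z. Proof. by case: z. Qed.
Lemma Im_conj z : Im (conjc z) = - Im z. Proof. by case: z. Qed.
Lemma Re_cR (a : R) : Re (cR a) = a. Proof. by []. Qed.
Lemma Im_cR (a : R) : Im (cR a) = 0. Proof. by []. Qed.
Lemma Re_expi (t : R) : Re (expi t) = cos t. Proof. by []. Qed.
Lemma Im_expi (t : R) : Im (expi t) = sin t. Proof. by []. Qed.
Lemma Re0 : Re (0 : R[i]) = 0. Proof. by []. Qed.
Lemma Im0 : Im (0 : R[i]) = 0. Proof. by []. Qed.
Lemma Re1 : Re (1 : R[i]) = 1. Proof. by []. Qed.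
Lemma Im1 : Im (1 : R[i]) = 0. Proof. by []. Qed.

Definition cI : R[i] := Complex 0 1.
Lemma Re_cI : Re cI = 0. Proof. by []. Qed.
Lemma Im_cI : Im cI = 1. Proof. by []. Qed.

Definition ReImE := (Re_cI, Im_cI, ReD, ImD, ReN, ImN, ReM, ImM, Re_conj, Im_conj, Re_cR,
  Im_cR, Re_expi, Im_expi, Re0, Im0, Re1, Im1).

Lemma ceq z w : Re z = Re w -> Im z = Im w -> z = w.
Proof. by case: z => a b; case: w => c d /= -> ->. Qed.

Lemma csq_ge0 z : 0 <= csq z.
Proof. by rewrite addr_ge0// sqr_ge0. Qed.

Lemma csqM z w : csq (z * w) = csq z * csq w.
Proof. rewrite /csq !ReImE; ring. Qed.

Lemma csqN z : csq (- z) = csq z.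
Proof. rewrite /csq !ReImE; ring. Qed.

Lemma csq_conj z : csq (conjc z) = csq z.
Proof. rewrite /csq !ReImE; ring. Qed.

Lemma csq_cR (a : R) : csq (cR a) = a ^+ 2.
Proof. rewrite /csq !ReImE; ring. Qed.

Lemma csq_expi (t : R) : csq (expi t) = 1.
Proof. by rewrite /csq !ReImE cos2Dsin2. Qed.

Lemma csq0 : csq (0 : R[i]) = 0.
Proof. rewrite /csq !ReImE; ring. Qed.

Lemma csq1 : csq (1 : R[i]) = 1.
Proof. rewrite /csq !ReImE; ring. Qed.

Lemma csq_eq0 z : csq z = 0 -> z = 0.
Proof.
rewrite /csq => /eqP; rewrite paddr_eq0 ?sqr_ge0// !sqrf_eq0 => /andP[/eqP a /eqP b].
exact: ceq.
Qed.

(** The defect is [csq (z - w)], by the parallelogram identity. Estimates are kept in squared form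
    throughout, so this factor 2 replaces the triangle inequality. *)
Lemma csqD_le z w : csq (z + w) <= 2 * csq z + 2 * csq w.
Proof.
rewrite -subr_ge0 /csq !ReImE.
have -> : 2 * (Re z ^+ 2 + Im z ^+ 2) + 2 * (Re w ^+ 2 + Im w ^+ 2) -
  ((Re z + Re w) ^+ 2 + (Im z + Im w) ^+ 2) =
  (Re z - Re w) ^+ 2 + (Im z - Im w) ^+ 2 by ring.
by rewrite addr_ge0// sqr_ge0.
Qed.

Lemma csqB_le z w : csq (z - w) <= 2 * csq z + 2 * csq w.
Proof. by rewrite (le_trans (csqD_le _ _))// csqN. Qed.

Lemma mulC_conj z : z * conjc z = cR (csq z).
Proof. apply: ceq; rewrite /csq !ReImE; ring. Qed.

Lemma conjcM z w : conjc (z * w) = conjc z * conjc w.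
Proof. apply: ceq; rewrite !ReImE; ring. Qed.

Lemma conjcD z w : conjc (z + w) = conjc z + conjc w.
Proof. apply: ceq; rewrite !ReImE; ring. Qed.

Lemma conjcB z w : conjc (z - w) = conjc z - conjc w.
Proof. apply: ceq; rewrite !ReImE; ring. Qed.

Lemma conjc_cR (a : R) : conjc (cR a) = cR a.
Proof. apply: ceq; rewrite !ReImE; ring. Qed.

Lemma conjc_expi (t : R) : conjc (expi t) = expi (- t).
Proof. by apply: ceq; rewrite !ReImE ?cosN ?sinN. Qed.

Lemma expiD (s t : R) : expi (s + t) = expi s * expi t.
Proof. by apply: ceq; rewrite !ReImE ?cosD ?sinD//; ring. Qed.

Lemma cRM (a b : R) : cR (a * b) = cR a * cR b.
Proof. apply: ceq; rewrite !ReImE; ring. Qed.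

Lemma cRD (a b : R) : cR (a + b) = cR a + cR b.
Proof. apply: ceq; rewrite !ReImE; ring. Qed.

Lemma cRN (a : R) : cR (- a) = - cR a.
Proof. apply: ceq; rewrite !ReImE; ring. Qed.

Lemma cR1 : cR (1 : R) = 1. Proof. by []. Qed.
Lemma cR0 : cR (0 : R) = 0. Proof. by []. Qed.

Lemma cR_inj : injective (@cR R).
Proof. by move=> a b []. Qed.

Lemma csq_Re z : `|Re z| ^+ 2 <= csq z.
Proof. by rewrite real_normK ?num_real// lerDl sqr_ge0. Qed.

Lemma csq_Im z : `|Im z| ^+ 2 <= csq z.
Proof. by rewrite real_normK ?num_real// lerDr sqr_ge0. Qed.

End ComplexAlgebra.

Section ComplexMeasurable.
Context {R : realType} {d : measure_display} {T : measurableType d}.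
Implicit Types f g : T -> R[i].

Definition cmeas f := cmeasurable setT f.

Lemma cmeas_ReIm f (a b : T -> R) : measurable_fun setT a ->
  measurable_fun setT b -> (forall x, Re (f x) = a x) ->
  (forall x, Im (f x) = b x) -> cmeas f.
Proof. by move=> ma mb fa fb; split; [move/funext : fa => ->|move/funext : fb => ->]. Qed.

Lemma cmeas_cst (c : R[i]) : cmeas (fun=> c).
Proof. by split; apply: measurable_cst. Qed.

Lemma cmeasD f g : cmeas f -> cmeas g -> cmeas (fun x => f x + g x).
Proof.
move=> [fr fi] [gr gi].
by apply: (cmeas_ReIm (measurable_funD fr gr) (measurable_funD fi gi)) => x /=;
  rewrite ReImE.
Qed.

Lemma cmeasM f g : cmeas f -> cmeas g -> cmeas (fun x => f x * g x).
Proof.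
move=> [fr fi] [gr gi].
by apply: (cmeas_ReIm
  (measurable_funB (measurable_funM fr gr) (measurable_funM fi gi))
  (measurable_funD (measurable_funM fr gi) (measurable_funM fi gr))) => x /=;
  rewrite ReImE.
Qed.

Lemma cmeasN f : cmeas f -> cmeas (fun x => - f x).
Proof.
move=> mf; have := cmeasM (cmeas_cst (-1)) mf.
by congr cmeas; apply/funext => x; rewrite mulN1r.
Qed.

Lemma cmeasB f g : cmeas f -> cmeas g -> cmeas (fun x => f x - g x).
Proof. by move=> mf mg; apply: cmeasD => //; exact: cmeasN. Qed.

Lemma cmeas_conj f : cmeas f -> cmeas (fun x => conjc (f x)).
Proof.
move=> [fr fi].
by apply: (cmeas_ReIm fr (measurable_funN fi)) => x /=; rewrite ReImE.
Qed.

Lemma cmeas_cR (a : T -> R) : measurable_fun setT a -> cmeas (fun x => cR (a x)).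
Proof.
move=> ma; apply: (cmeas_ReIm (a := a) (b := cst 0)) => //.
Qed.

Lemma measurable_csq f : cmeas f -> measurable_fun setT (fun x => csq (f x)).
Proof.
by move=> [fr fi]; apply: measurable_funD; exact: measurable_funX.
Qed.

Lemma cmeas_indic (A : set T) : measurable A -> cmeas (fun x => cR (\1_A x)).
Proof. by move=> mA; apply: cmeas_cR; exact: measurable_indic. Qed.

Lemma cmeas_expi (a : T -> R) : measurable_fun setT a -> cmeas (fun x => expi (a x)).
Proof.
move=> ma; apply: (cmeas_ReIm (a := cos \o a) (b := sin \o a)) => //.
- apply: measurableT_comp ma; apply: continuous_measurable_fun.
  exact: continuous_cos.
- apply: measurableT_comp ma; apply: continuous_measurable_fun.
  exact: continuous_sin.
Qed.

End ComplexMeasurable.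

Lemma cmeas_comp {R : realType} {d d'} {T : measurableType d} {T' : measurableType d'}
  (f : T' -> R[i]) (phi : T -> T') : cmeas f -> measurable_fun setT phi ->
  cmeas (fun x => f (phi x)).
Proof. by move=> [fr fi] mphi; split; [exact: (measurableT_comp fr mphi)|exact: (measurableT_comp fi mphi)]. Qed.

Section ComplexIntegral.
Context {R : realType} {d : measure_display} {T : measurableType d}.
Variable m : {measure set T -> \bar R}.
Implicit Types f g : T -> R[i].

Definition cinteg f := cintegrable m setT f.

Lemma cinteg_meas f : cinteg f -> cmeas f.
Proof.
by move=> [/measurable_int fr /measurable_int fi]; split; apply/measurable_EFinP.
Qed.

Lemma cinteg_le f (g : T -> R) : cmeas f -> m.-integrable setT (EFin \o g) ->
  (forall x, 0 <= g x) -> (forall x, csq (f x) <= g x ^+ 2) -> cinteg f.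
Proof.
move=> [fr fi] ig g0 fg; split; apply: (le_integrable measurableT) ig.
- exact/measurable_EFinP.
- move=> x _; rewrite /= lee_fin (ger0_norm (g0 x)).
  by rewrite -(@ler_pXn2r _ 2)// ?nnegrE// (le_trans (csq_Re _)).
- exact/measurable_EFinP.
- move=> x _; rewrite /= lee_fin (ger0_norm (g0 x)).
  by rewrite -(@ler_pXn2r _ 2)// ?nnegrE// (le_trans (csq_Im _)).
Qed.

Lemma cinteg_ReIm f (a b : T -> R) : m.-integrable setT (EFin \o a) ->
  m.-integrable setT (EFin \o b) -> (forall x, Re (f x) = a x) ->
  (forall x, Im (f x) = b x) -> cinteg f.
Proof.
move=> ma mb fa fb; split.
  by rewrite [X in m.-integrable _ X](_ : _ = EFin \o a)//; apply/funext => x /=; rewrite fa.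
by rewrite [X in m.-integrable _ X](_ : _ = EFin \o b)//; apply/funext => x /=; rewrite fb.
Qed.

Lemma cintegD f g : cinteg f -> cinteg g -> cinteg (fun x => f x + g x).
Proof.
move=> [fr fi] [gr gi].
apply: (cinteg_ReIm (a := fun x => Re (f x) + Re (g x))
  (b := fun x => Im (f x) + Im (g x))) => [||x|x]; rewrite ?ReImE//.
- exact: (integrableD measurableT fr gr).
- exact: (integrableD measurableT fi gi).
Qed.

Lemma cintegZ (c : R[i]) f : cinteg f -> cinteg (fun x => c * f x).
Proof.
move=> [fr fi].
apply: (cinteg_ReIm (a := fun x => Re c * Re (f x) - Im c * Im (f x))
  (b := fun x => Re c * Im (f x) + Im c * Re (f x))) => [||x|x]; rewrite ?ReImE//.
- exact: (integrableB measurableT (integrableZl measurableT (Re c) fr)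
    (integrableZl measurableT (Im c) fi)).
- exact: (integrableD measurableT (integrableZl measurableT (Re c) fi)
    (integrableZl measurableT (Im c) fr)).
Qed.

Lemma cinteg_conj f : cinteg f -> cinteg (fun x => conjc (f x)).
Proof.
move=> [fr fi].
apply: (cinteg_ReIm fr (b := fun x => - Im (f x))) => [|x|x]; rewrite ?ReImE//.
exact: (integrableN fi).
Qed.

Lemma cintegB f g : cinteg f -> cinteg g -> cinteg (fun x => f x - g x).
Proof.
move=> mf mg; have := cintegD mf (cintegZ (-1) mg).
by congr cinteg; apply/funext => x; rewrite mulN1r.
Qed.

Lemma cint_ReIm f (a b : T -> R) : (forall x, Re (f x) = a x) ->
  (forall x, Im (f x) = b x) ->
  cint m setT f = Complex (Rintegral m setT a) (Rintegral m setT b).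
Proof. by move=> /funext <- /funext <-. Qed.

Lemma cintD f g : cinteg f -> cinteg g ->
  cint m setT (fun x => f x + g x) = cint m setT f + cint m setT g.
Proof.
move=> [fr fi] [gr gi].
rewrite (cint_ReIm (a := fun x => Re (f x) + Re (g x))
  (b := fun x => Im (f x) + Im (g x))) => [|x|x]; rewrite ?ReImE//.
by rewrite !RintegralD.
Qed.

Lemma cintZ (c : R[i]) f : cinteg f ->
  cint m setT (fun x => c * f x) = c * cint m setT f.
Proof.
move=> [fr fi].
rewrite (cint_ReIm (a := fun x => Re c * Re (f x) - Im c * Im (f x))
  (b := fun x => Re c * Im (f x) + Im c * Re (f x))) => [|x|x]; rewrite ?ReImE//.
have h (r : R) (h : T -> R) : m.-integrable setT (EFin \o h) ->
    m.-integrable setT (EFin \o (fun x => r * h x)).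
  by move=> ih; exact: (integrableZl measurableT r ih).
rewrite RintegralB ?RintegralD//; do ?exact: h.
by rewrite !RintegralZl//; apply: ceq; rewrite !ReImE.
Qed.

Lemma cintZr (c : R[i]) f : cinteg f ->
  cint m setT (fun x => f x * c) = cint m setT f * c.
Proof.
move=> cf; rewrite mulrC -cintZ//; congr cint.
by apply/funext => x; rewrite mulrC.
Qed.

Lemma cintB f g : cinteg f -> cinteg g ->
  cint m setT (fun x => f x - g x) = cint m setT f - cint m setT g.
Proof.
move=> mf mg; rewrite -mulN1r -cintZ// -cintD//; last exact: cintegZ.
by congr cint; apply/funext => x; rewrite mulN1r.
Qed.

Lemma cint_conj f : cinteg f ->
  cint m setT (fun x => conjc (f x)) = conjc (cint m setT f).
Proof.
move=> [fr fi].
rewrite (cint_ReIm (a := fun x => Re (f x)) (b := fun x => -1 * Im (f x))) => [|x|x];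
  rewrite ?ReImE ?mulN1r//.
by rewrite RintegralZl// mulN1r.
Qed.

Lemma cint0 : cint m setT (fun=> 0) = 0 :> R[i].
Proof. by rewrite /cint /Rintegral /= integral0. Qed.

Lemma cint_cR (a : T -> R) :
  cint m setT (fun x => cR (a x)) = cR (Rintegral m setT a).
Proof. by rewrite /cint /Rintegral /= integral0. Qed.

Lemma cint_mkcond (D : set T) f :
  cint m D f = cint m setT (fun x => cR (\1_D x) * f x).
Proof.
apply: ceq; rewrite /cint /= Rintegral_mkcond; apply: eq_Rintegral => x _;
 by rewrite patchE indicE !ReImE; case: (x \in D); rewrite ?mul1r ?mul0r ?subr0 ?addr0.
Qed.

Lemma cintegrable_mkcond (D : set T) f : measurable D ->
  cintegrable m D f <-> cinteg (fun x => cR (\1_D x) * f x).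
Proof.
move=> mD; rewrite /cinteg /cintegrable.
suff H (p : R[i] -> R) : (forall x, p (cR (\1_D x) * f x) = \1_D x * p (f x)) ->
   m.-integrable D (fun x => (p (f x))%:E) <->
   m.-integrable setT (fun x => (p (cR (\1_D x) * f x))%:E).
  by split=> -[] /H h1 /H h2; split; (apply: h1 || apply: h2) => x;
    rewrite !ReImE; ring.
move=> pE; rewrite (integrable_mkcond _ mD).
suff -> : (fun x => (p (f x))%:E) \_ D = (fun x => (p (cR (\1_D x) * f x))%:E) by [].
apply/funext => x; rewrite patchE pE indicE.
by case: (x \in D); rewrite ?mul1r ?mul0r.
Qed.

Lemma cintegM_bdd f g (C : R) : cinteg f -> cmeas g -> (forall x, csq (g x) <= C) ->
  cinteg (fun x => g x * f x).
Proof.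
move=> cf mg gC.
have C0 : 0 <= C := le_trans (csq_ge0 (g point)) (gC point).
have [if1 if2] := cf.
(* The sum of [|Re f|] and [|Im f|] dominates the modulus of f and is visibly integrable. *)
apply: (@cinteg_le _ (fun x => Num.sqrt C * (`|Re (f x)| + `|Im (f x)|))).
- by apply: cmeasM => //; exact: cinteg_meas cf.
- exact: (integrableZl measurableT (Num.sqrt C)
    (integrableD measurableT (integrable_abse if1) (integrable_abse if2))).
- by move=> x; rewrite mulr_ge0// ?sqrtr_ge0// addr_ge0.
- move=> x; rewrite csqM exprMn sqr_sqrtr// ler_pM ?csq_ge0//.
  rewrite /csq sqrrD -!(@real_normK _ (Re _)) ?num_real//.
  rewrite -(@real_normK _ (Im _)) ?num_real//.
  rewrite addrAC lerDl mulrn_wge0// mulr_ge0//.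
Qed.

End ComplexIntegral.

(** * Squared norm, inner product and Cauchy-Schwarz inequality in L^2 *)

Section L2.
Context {R : realType} {d : measure_display} {T : measurableType d}.
Variable m : {measure set T -> \bar R}.
Implicit Types f g h : T -> R[i].

(* [N2] is the squared norm in [\bar R]; [n2] is [0], not [+oo], off L^2. *)
Definition N2 f : \bar R := (\int[m]_x (csq (f x))%:E)%E.
Definition n2 f : R := fine (N2 f).

Lemma N2_ge0 f : (0 <= N2 f)%E.
Proof. by apply: integral_ge0 => x _; rewrite lee_fin csq_ge0. Qed.

Lemma n2_ge0 f : 0 <= n2 f.
Proof. exact/fine_ge0/N2_ge0. Qed.

Lemma isL2P f : isL2 m f <-> cmeas f /\ (N2 f < +oo)%E.
Proof.
split=> [[mf /integrableP[_ fi]]|[mf fi]]; split => //.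
  apply: le_lt_trans fi; apply: ge0_le_integral => //.
  - by move=> x _; rewrite lee_fin csq_ge0.
  - by apply/measurable_EFinP; exact: measurable_csq.
  - by apply/measurable_EFinP; apply: measurableT_comp => //; exact: measurable_csq.
  - by move=> x _; rewrite lee_fin ler_norm.
apply/integrableP; split; first by apply/measurable_EFinP; exact: measurable_csq.
rewrite (eq_integral (fun x => (csq (f x))%:E))// => x _.
by rewrite gee0_abs// lee_fin csq_ge0.
Qed.

Lemma isL2_meas f : isL2 m f -> cmeas f. Proof. by case. Qed.

Lemma n2E f : isL2 m f -> (n2 f)%:E = N2 f.
Proof.
by move=> /isL2P[_ foo]; rewrite fineK// ge0_fin_numE// N2_ge0.
Qed.

Lemma le_N2 f g (C : R) : cmeas f -> cmeas g -> 0 <= C ->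
  (forall x, csq (f x) <= C * csq (g x)) -> (N2 f <= C%:E * N2 g)%E.
Proof.
move=> mf mg C0 fg; rewrite -ge0_integralZl//; first last.
- by move=> x _; rewrite lee_fin csq_ge0.
- by apply/measurable_EFinP; exact: measurable_csq.
apply: ge0_le_integral => //.
- by move=> x _; rewrite lee_fin csq_ge0.
- by apply/measurable_EFinP; exact: measurable_csq.
- apply: measurable_funeM; by apply/measurable_EFinP; exact: measurable_csq.
- by move=> x _; rewrite -EFinM lee_fin.
Qed.

Lemma isL2_le f g (C : R) : cmeas f -> isL2 m g -> 0 <= C ->
  (forall x, csq (f x) <= C * csq (g x)) -> isL2 m f.
Proof.
move=> mf mg C0 fg; apply/isL2P; split => //.
apply: (le_lt_trans (le_N2 mf (isL2_meas mg) C0 fg)).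
by rewrite -n2E// -EFinM ltry.
Qed.

Lemma le_n2 f g (C : R) : isL2 m f -> isL2 m g -> 0 <= C ->
  (forall x, csq (f x) <= C * csq (g x)) -> n2 f <= C * n2 g.
Proof.
move=> mf mg C0 fg; rewrite -lee_fin EFinM !n2E//.
by apply: le_N2 => //; [exact: isL2_meas mf|exact: isL2_meas mg].
Qed.

Lemma isL2Mbdd f g (C : R) : cmeas g -> isL2 m f -> (forall x, csq (g x) <= C) ->
  isL2 m (fun x => g x * f x).
Proof.
move=> mg mf gC; apply: (@isL2_le _ f C) => //.
- by apply: cmeasM => //; exact: isL2_meas.
- exact: le_trans (csq_ge0 (g point)) (gC point).
- by move=> x; rewrite csqM ler_wpM2r ?csq_ge0.
Qed.

Lemma isL2Z (c : R[i]) f : isL2 m f -> isL2 m (fun x => c * f x).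
Proof. by move=> ?; apply: (@isL2Mbdd _ _ (csq c)) => //; exact: cmeas_cst. Qed.

Lemma isL2_conj f : isL2 m f -> isL2 m (fun x => conjc (f x)).
Proof.
move=> mf; apply: (@isL2_le _ f 1) => // [|x]; last by rewrite csq_conj mul1r.
by apply: cmeas_conj; exact: isL2_meas.
Qed.

Lemma isL2D f g : isL2 m f -> isL2 m g -> isL2 m (fun x => f x + g x).
Proof.
move=> mf mg; split; first by apply: cmeasD; exact: isL2_meas.
have [_ fi] := mf; have [_ gi] := mg.
apply: (le_integrable measurableT _ _
  (integrableD measurableT (integrableZl measurableT 2 fi) (integrableZl measurableT 2 gi))).
- apply/measurable_EFinP; apply: measurable_csq; apply: cmeasD; exact: isL2_meas.
- move=> x _; rewrite /= lee_fin !ger0_norm ?csq_ge0//.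
    exact: csqD_le.
  by rewrite addr_ge0// mulr_ge0// csq_ge0.
Qed.

Lemma isL2B f g : isL2 m f -> isL2 m g -> isL2 m (fun x => f x - g x).
Proof.
move=> mf mg; have := isL2D mf (isL2Z (-1) mg).
by congr isL2; apply/funext => x; rewrite mulN1r.
Qed.

Lemma isL2_0 : isL2 m (fun=> 0 : R[i]).
Proof.
apply/isL2P; split; first exact: cmeas_cst.
by rewrite /N2 csq0 integral0.
Qed.

Lemma isL2_indic (A : set T) : measurable A -> (m A < +oo)%E ->
  isL2 m (fun x => cR (\1_A x)).
Proof.
move=> mA Aoo; apply/isL2P; split; first exact: cmeas_indic.
rewrite /N2 (eq_integral (fun x => (\1_A x)%:E)) ?integral_indic ?setIT//.
by move=> x _; rewrite csq_cR indicE; case: (x \in A); rewrite ?expr1n ?expr0n.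
Qed.

Lemma n2_indic (A : set T) : measurable A -> n2 (fun x => cR (\1_A x)) = fine (m A).
Proof.
move=> mA; rewrite /n2 /N2 (eq_integral (fun x => (\1_A x)%:E)) ?integral_indic ?setIT//.
by move=> x _; rewrite csq_cR indicE; case: (x \in A); rewrite ?expr1n ?expr0n.
Qed.

Lemma cinteg_mul f g : isL2 m f -> isL2 m g -> cinteg m (fun x => f x * g x).
Proof.
move=> mf mg; have [_ fi] := mf; have [_ gi] := mg.
(* The domination is |f g| <= |f|^2 + |g|^2, in squared form. *)
apply: (@cinteg_le _ _ _ m _ (fun x => csq (f x) + csq (g x))).
- by apply: cmeasM; exact: isL2_meas.
- exact: (integrableD measurableT fi gi).
- by move=> x; rewrite addr_ge0// csq_ge0.
- move=> x; rewrite csqM sqrrD -addrA.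
  have := csq_ge0 (f x); have := csq_ge0 (g x); set a := csq _; set b := csq _.
  by move=> a0 b0; nra.
Qed.

Lemma cinteg_cip f g : isL2 m f -> isL2 m g -> cinteg m (fun x => f x * conjc (g x)).
Proof. by move=> mf mg; apply: cinteg_mul => //; exact: isL2_conj. Qed.

Lemma cipDl f g h : isL2 m f -> isL2 m g -> isL2 m h ->
  cip m (fun x => f x + g x) h = cip m f h + cip m g h.
Proof.
move=> mf mg mh; rewrite /cip -cintD; do ?exact: cinteg_cip.
by congr cint; apply/funext => x; rewrite mulrDl.
Qed.

Lemma cipBl f g h : isL2 m f -> isL2 m g -> isL2 m h ->
  cip m (fun x => f x - g x) h = cip m f h - cip m g h.
Proof.
move=> mf mg mh; rewrite /cip -cintB; do ?exact: cinteg_cip.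
by congr cint; apply/funext => x; rewrite mulrBl.
Qed.

Lemma cipZl (c : R[i]) f h : isL2 m f -> isL2 m h ->
  cip m (fun x => c * f x) h = c * cip m f h.
Proof.
move=> mf mh; rewrite /cip -cintZ; last exact: cinteg_cip.
by congr cint; apply/funext => x; rewrite mulrA.
Qed.

Lemma cipC f g : isL2 m f -> isL2 m g -> cip m g f = conjc (cip m f g).
Proof.
move=> mf mg; rewrite /cip -cint_conj; last exact: cinteg_cip.
by congr cint; apply/funext => x; rewrite conjcM conjcK mulrC.
Qed.

Lemma cipBr f g h : isL2 m f -> isL2 m g -> isL2 m h ->
  cip m h (fun x => f x - g x) = cip m h f - cip m h g.
Proof.
move=> mf mg mh; rewrite (cipC (isL2B mf mg) mh) cipBl// conjcB.
by rewrite -!cipC.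
Qed.

Lemma cipDr f g h : isL2 m f -> isL2 m g -> isL2 m h ->
  cip m h (fun x => f x + g x) = cip m h f + cip m h g.
Proof.
move=> mf mg mh; rewrite (cipC (isL2D mf mg) mh) cipDl// conjcD.
by rewrite -!cipC.
Qed.

Lemma cipZr (c : R[i]) f h : isL2 m f -> isL2 m h ->
  cip m h (fun x => c * f x) = conjc c * cip m h f.
Proof. by move=> mf mh; rewrite (cipC (isL2Z c mf) mh) cipZl// conjcM -cipC. Qed.

(** Both sides are [fine] of the same integral, so they share the default value outside L^2. *)
Lemma cipff f : cip m f f = cR (n2 f).
Proof.
by rewrite /cip /n2 /N2 -cint_cR; congr cint; apply/funext => x; rewrite mulC_conj.
Qed.

Lemma n2Z (c : R[i]) f : isL2 m f -> n2 (fun x => c * f x) = csq c * n2 f.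
Proof.
move=> mf; apply: cR_inj; rewrite -cipff cipZl//; last exact: isL2Z.
by rewrite cipZr// mulrA mulC_conj cipff cRM.
Qed.

Lemma n2B f g : isL2 m f -> isL2 m g ->
  n2 (fun x => f x - g x) = n2 f - 2 * Re (cip m f g) + n2 g.
Proof.
move=> mf mg.
have /(congr1 (@complex.Re R)) := cipff (fun x => f x - g x).
have mfg := isL2B mf mg.
rewrite cipBl// !cipBr// !cipff (cipC mf mg) !ReImE => <-; ring.
Qed.

Lemma n2D_le f g : isL2 m f -> isL2 m g ->
  n2 (fun x => f x + g x) <= 2 * n2 f + 2 * n2 g.
Proof.
move=> mf mg; have mfg := isL2D mf mg.
rewrite -lee_fin EFinD !EFinM !n2E//.
have mm h : isL2 m h -> measurable_fun setT (fun x => (csq (h x))%:E).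
  by move=> mh; apply/measurable_EFinP/measurable_csq; exact: isL2_meas.
rewrite /N2 -!ge0_integralZl//; do ?[by move=> x _; rewrite lee_fin csq_ge0|exact: mm].
rewrite -ge0_integralD//; do ?[by apply: measurable_funeM; exact: mm|
  by move=> x _; rewrite -?EFinM lee_fin ?mulr_ge0 ?csq_ge0].
apply: ge0_le_integral => //; do ?[exact: mm|by move=> x _; rewrite lee_fin csq_ge0].
- by apply: emeasurable_funD; apply: measurable_funeM; exact: mm.
- by move=> x _; rewrite -!EFinM -EFinD lee_fin csqD_le.
Qed.

Lemma n2B_le f g h : isL2 m f -> isL2 m g -> isL2 m h ->
  n2 (fun x => f x - h x) <= 2 * n2 (fun x => f x - g x) + 2 * n2 (fun x => g x - h x).
Proof.
move=> mf mg mh; apply: le_trans (n2D_le (isL2B mf mg) (isL2B mg mh)).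
by rewrite (_ : (fun x => _) = fun x => f x - h x)//; apply/funext => x; rewrite addrA subrK.
Qed.

(** For c = <f, g> and t real, the squared norm of [f - t c g] is a quadratic polynomial in t with
    real coefficients: the factor c absorbs the phase. Its nonnegativity at a well-chosen t is the
    inequality. *)
Lemma cip_CauchySchwarz f g : isL2 m f -> isL2 m g ->
  csq (cip m f g) <= n2 f * n2 g.
Proof.
move=> mf mg; set c := cip m f g.
have key (t : R) : 0 <= n2 f - 2 * t * csq c + t ^+ 2 * csq c * n2 g.
  have := n2_ge0 (fun x => f x - (cR t * c) * g x).
  rewrite n2B//; last exact: isL2Z.
  rewrite cipZr// n2Z// csqM csq_cR -/c.
  have -> : Re (conjc (cR t * c) * c) = t * csq c by rewrite /csq !ReImE; ring.
  by rewrite mulrA.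
have [g0|g0] := eqVneq (n2 g) 0.
  rewrite g0 mulr0 leNgt; apply/negP => c0.
  (* When [n2 g = 0] the polynomial is affine, and at this t it equals -1. *)
  have := key ((n2 f + 1) / (2 * csq c)).
  rewrite g0 mulr0 addr0 leNgt => /negP; apply.
  rewrite (_ : 2 * _ * _ = n2 f + 1); last by field; rewrite gt_eqF.
  by rewrite opprD addrA subrr sub0r ltrN10.
have gp : 0 < n2 g by rewrite lt_neqAle eq_sym g0 n2_ge0.
have := key (n2 g)^-1.
rewrite (_ : _ + _ = n2 f - csq c / n2 g); last by field.
by rewrite subr_ge0 ler_pdivrMr.
Qed.

End L2.

(** * Closed subspaces and extension of isometries *)

Section ClosedSubspace.
Context {R : realType} {d : measure_display} {T : measurableType d}.
Variable m : {measure set T -> \bar R}.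
Implicit Types f g h : T -> R[i].

Lemma n2_dominated (f_ : nat -> T -> R[i]) g : isL2 m g ->
  (forall n, cmeas (f_ n)) -> (forall n x, csq (f_ n x) <= csq (g x)) ->
  (forall x, csq (f_ n x) @[n --> \oo] --> (0 : R)) ->
  (n2 m (f_ n)) @[n --> \oo] --> (0 : R).
Proof.
move=> mg mf fg f0.
have [_ gi] := mg.
have mcsq n : measurable_fun setT (fun x => (csq (f_ n x))%:E).
  by apply/measurable_EFinP; exact: measurable_csq.
have h1 : {ae m, forall x, [set: T] x -> (csq (f_ n x))%:E @[n --> \oo] --> 0%E}.
  by apply: aeW => x _; apply/fine_cvgP; split; [exact: nearW|exact: f0].
have h2 : {ae m, forall x n, [set: T] x -> (`|(csq (f_ n x))%:E| <= (csq (g x))%:E)%E}.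
  by apply: aeW => x n _; rewrite /= ger0_norm ?csq_ge0// lee_fin.
have [_ _] := dominated_convergence measurableT mcsq (measurable_cst _) h1 gi h2.
by rewrite integral0 => /fine_cvgP[_].
Qed.

Lemma small_n2_dominated (f_ : nat -> T -> R[i]) g (e : R) : isL2 m g ->
  (forall n, cmeas (f_ n)) -> (forall n x, csq (f_ n x) <= csq (g x)) ->
  (forall x, csq (f_ n x) @[n --> \oo] --> (0 : R)) -> 0 < e ->
  exists n, n2 m (f_ n) < e.
Proof.
move=> mg mf fg f0 e0; have /cvgrPdist_lt/(_ e e0)[n _ /(_ n (leqnn n))] :=
  n2_dominated mg mf fg f0.
by rewrite /= sub0r normrN ger0_norm ?n2_ge0// => ?; exists n.
Qed.

(** Subspaces are predicates on functions, not on classes modulo null sets. Stability under almost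
    everywhere equality is contained in [subspace_closed], which allows an approximation at distance
    0. *)
Record closed_subspace (V : (T -> R[i]) -> Prop) : Prop := ClosedSubspace {
  subspace_isL2 : forall f, V f -> isL2 m f ;
  subspace0 : V (fun=> 0) ;
  subspace_lin : forall (c : R[i]) f g, V f -> V g -> V (fun x => f x + c * g x) ;
  subspace_closed : forall f, isL2 m f ->
    (forall e : R, 0 < e -> exists2 g, V g & n2 m (fun x => f x - g x) < e) -> V f }.

Section Induction.
Variable V : (T -> R[i]) -> Prop.
Hypothesis cV : closed_subspace V.

Let VB f g : V f -> V g -> V (fun x => f x - g x).
Proof.
by move=> Vf Vg; have := subspace_lin cV (-1) Vf Vg; congr V; apply/funext => x;
  rewrite mulN1r.
Qed.

Lemma subspace_dominated (f_ : nat -> T -> R[i]) f g : isL2 m f -> isL2 m g ->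
  (forall n, V (f_ n)) -> (forall n x, csq (f x - f_ n x) <= csq (g x)) ->
  (forall x, csq (f x - f_ n x) @[n --> \oo] --> (0 : R)) -> V f.
Proof.
move=> mf mg Vf fg f0; apply: (subspace_closed cV) => // e e0.
have [n fne] := @small_n2_dominated (fun n x => f x - f_ n x) g e mg
  (fun n => cmeasB (isL2_meas mf) (isL2_meas (subspace_isL2 cV (Vf n)))) fg f0 e0.
by exists (f_ n).
Qed.

Variables (G : set (set T)) (A : nat -> set T).
Hypothesis sG : @measurable _ T = <<s G>>.
Hypothesis GI : setI_closed G.
Hypothesis mA : forall n, measurable (A n).
Hypothesis Afin : forall n, (m (A n) < +oo)%E.
Hypothesis Asub : forall n x, A n x -> A n.+1 x.
Hypothesis Acover : forall x, exists n, A n x.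
Hypothesis VA : forall n, V (fun x => cR (\1_(A n) x)).
Hypothesis VG : forall B n, G B -> V (fun x => cR (\1_(B `&` A n) x)).

(** Dynkin's theorem: the B for which the indicator of [B ∩ A n] lies in V form a lambda-system
    containing the pi-system G. The intersection with [A n], of finite measure, keeps all indicators
    in L^2. *)
Lemma subspace_indic B n : measurable B -> V (fun x => cR (\1_(B `&` A n) x)).
Proof.
rewrite sG => mB; pose H := [set E | measurable E /\ V (fun x => cR (\1_(E `&` A n) x))].
suff : H B by case.
apply: (@lambda_system_subset _ G GI setT H _ _ _ B) => //.
- split => //=.
  + by rewrite /H /=; split => //; rewrite setTI.
  + move=> E F FE [mE VE] [mF VF]; split; first exact: measurableD.
    have := VB VE VF; congr V; apply/funext => x.
    rewrite -cRN -cRD; congr cR; rewrite !indicE (in_setI x (E `\` F) (A n)) (in_setI x E) (in_setI x F) in_setD.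
    have [Fx|nFx] := pselect (F x).
      by rewrite (mem_set Fx) (mem_set (FE _ Fx)) subrr.
    by rewrite (memNset nFx) /= andbT subr0.
  + move=> F ndF HF; have mU : measurable (\bigcup_i F i).
      by apply: bigcup_measurable => i _; case: (HF i).
    split => //.
    have mI E : measurable E -> isL2 m (fun x => cR (\1_(E `&` A n) x)).
      move=> mE; apply: isL2_indic; first exact: measurableI.
      apply: le_lt_trans (Afin n); apply: le_measure; rewrite ?inE//; exact: measurableI.
    (* The error is an indicator inside [A n], and at each point it vanishes from some index on. *)
    apply: (@subspace_dominated (fun k x => cR (\1_(F k `&` A n) x)) _ (fun x => cR (\1_(A n) x))).
    * exact: mI.
    * by apply: isL2_indic.
    * by move=> k; case: (HF k).
    * move=> k x; rewrite -cRN -cRD !csq_cR !indicE !in_setI.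
      case: (x \in A n); rewrite ?andbF ?andbT ?subrr ?expr0n//=.
      by case: (x \in \bigcup_i _); case: (x \in F k); rewrite ?subrr ?subr0 ?sub0r ?sqrrN ?expr0n ?expr1n//=.
    * move=> x; apply: cvg_near_cst.
      have [[k _ Fkx]|nFx] := pselect ((\bigcup_i F i) x); last first.
        apply: nearW => k; rewrite -cRN -cRD csq_cR !indicE !in_setI.
        rewrite (memNset nFx) (@memNset _ (F k)) ?subrr ?expr0n//.
        by apply: contra_not nFx => ?; exists k.
      exists k => // l /= kl; rewrite -cRN -cRD csq_cR !indicE !in_setI.
      rewrite (@mem_set _ (\bigcup_i F i)); last by exists k.
      rewrite (@mem_set _ (F l)) ?subrr ?expr0n//.
      by have /subsetPset := ndF _ _ kl; apply.
- by move=> E GE; split; [rewrite sG; exact: sub_sigma_algebra|exact: VG].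
Qed.

Import HBNNSimple.

Lemma subspace_nnsfun (h : {nnsfun T >-> R}) n :
  V (fun x => cR (h x * \1_(A n) x)).
Proof.
have -> : (fun x => cR (h x * \1_(A n) x)) = (fun x =>
   \sum_(y <- finmap.enum_fset (fset_set (range h))) cR y * cR (\1_(h @^-1` [set y] `&` A n) x)).
  apply/funext => x; rewrite fimfunE fsbig_finite//= mulr_suml.
  apply: ceq.
    rewrite (big_morph (@complex.Re R) (@ReD R) (Re0 (R:=R))); apply: eq_bigr => y _.
    by rewrite !ReImE indicI /= mulr0 subr0 mulrA.
  rewrite (big_morph (@complex.Im R) (@ImD R) (Im0 (R:=R))) [RHS]big1// => y _.
  by rewrite !ReImE mulr0 mul0r addr0.
elim: (finmap.enum_fset _) => [|y s IH].
  by under eq_fun do rewrite big_nil; exact: subspace0.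
under eq_fun do rewrite big_cons addrC.
apply: subspace_lin => //; apply: subspace_indic.
exact: measurable_funPTI.
Qed.

(** Simple functions increasing to f, cut to [A n] so as to lie in V; the error is dominated by f
    itself. *)
Lemma subspace_real (f : T -> R) : (forall x, 0 <= f x) ->
  isL2 m (fun x => cR (f x)) -> V (fun x => cR (f x)).
Proof.
move=> f0 mf; have mf1 : measurable_fun setT (EFin \o f).
  by apply/measurable_EFinP; have [[]] := mf.
pose h := nnsfun_approx measurableT mf1.
have h_le n x : h n x <= f x.
  by rewrite -lee_fin /h nnsfun_approxE; apply: le_approx => // y _; rewrite lee_fin.
have h_ge n x : 0 <= h n x by [].
apply: (@subspace_dominated (fun n x => cR (h n x * \1_(A n) x)) _ (fun x => cR (f x))) => //.
- by move=> n; exact: subspace_nnsfun.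
- move=> n x; rewrite -cRN -cRD !csq_cR indicE.
  have := h_le n x; have := h_ge n x.
  by case: (x \in A n); rewrite ?mulr1 ?mulr0 ?subr0// => h1 h2; rewrite ler_pXn2r ?nnegrE ?subr_ge0// gerBl.
- move=> x.
  have hcvg : (h n x) @[n --> \oo] --> f x.
    by have /fine_cvgP[] := cvg_nnsfun_approx measurableT mf1 (fun y _ => f0 y) (x := x) I.
  have [k Akx] := Acover x.
  have Alx l : (k <= l)%N -> A l x.
    by elim: l => [|l IH]; rewrite leq_eqVlt => /predU1P[<-//|]; rewrite ?ltn0// ltnS => /IH /Asub.
  have hd : (f x - h n x) @[n --> \oo] --> f x - f x.
    by apply: cvgB => //; exact: cvg_cst.
  have : (f x - h n x) ^+ 2 @[n --> \oo] --> (f x - f x) ^+ 2 := cvgM hd hd.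
  rewrite subrr expr0n /= => /(_ _) h2; apply: (cvg_trans _ h2); apply: near_eq_cvg.
  exists k => // l /= kl.
  by rewrite -cRN -cRD csq_cR indicE mem_set ?mulr1//; exact: Alx.
Qed.

(** The density principle behind every density statement below, with intervals on the line and
    rectangles in the plane as generating sets. Real, imaginary, positive and negative parts reduce
    it to nonnegative functions. *)
Lemma subspace_full f : isL2 m f -> V f.
Proof.
move=> mf; have [[fr fi] _] := mf.
have P (p : T -> R) : measurable_fun setT p -> (forall x, p x ^+ 2 <= csq (f x)) ->
    V (fun x => cR (p x)).
  move=> mp pf.
  have Q (q : T -> R) : measurable_fun setT q -> (forall x, 0 <= q x) ->
     (forall x, q x ^+ 2 <= p x ^+ 2) -> V (fun x => cR (q x)).
    move=> mq q0 qp; apply: subspace_real => //.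
    apply: (isL2_le (cmeas_cR mq) mf ler01) => x.
    by rewrite mul1r csq_cR (le_trans (qp x)).
  have -> : (fun x => cR (p x)) = (fun x => cR (Num.max (p x) 0) - cR (Num.max (- p x) 0)).
    apply/funext => x; rewrite -cRN -cRD; congr cR.
    by rewrite /Num.max; case: ltP => ?; case: ltP => ?; lra.
  apply: VB; apply: Q.
  - exact: (measurable_maxr mp).
  - by move=> x; rewrite le_max lexx orbT.
  - by move=> x; rewrite /Num.max; case: ltP => ?; nra.
  - by apply: measurable_maxr => //; exact: (measurable_funN mp).
  - by move=> x; rewrite le_max lexx orbT.
  - by move=> x; rewrite /Num.max; case: ltP => ?; nra.
have := subspace_lin cV cI (P _ fr (fun x => _)) (P _ fi (fun x => _)).
have -> : (fun x => cR (Re (f x)) + cI * cR (Im (f x))) = f.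
  by apply/funext => x; apply: ceq; rewrite !ReImE; ring.
by apply => x; rewrite /csq ?lerDl ?lerDr sqr_ge0.
Qed.

End Induction.

End ClosedSubspace.

(** * Closed linear spans and functionals on them *)

Section ClosedSpan.
Context {R : realType} {d : measure_display} {T : measurableType d}.
Variable m : {measure set T -> \bar R}.
Variables (I : Type) (phi : I -> T -> R[i]).
Hypothesis phi2 : forall i, isL2 m (phi i).
Implicit Types f g h : T -> R[i].

Definition lincomb (s : seq (R[i] * I)) : T -> R[i] :=
  fun x => \sum_(p <- s) p.1 * phi p.2 x.

Definition clspan f := isL2 m f /\
  forall e : R, 0 < e -> exists s, n2 m (fun x => f x - lincomb s x) < e.

Lemma lincomb_cons c i s : lincomb ((c, i) :: s) = fun x => lincomb s x + c * phi i x.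
Proof. by apply/funext => x; rewrite /lincomb big_cons addrC. Qed.

Lemma lincomb_nil : lincomb [::] = fun=> 0.
Proof. by apply/funext => x; rewrite /lincomb big_nil. Qed.

Lemma isL2_lincomb s : isL2 m (lincomb s).
Proof.
elim: s => [|[c i] s IH]; first by rewrite lincomb_nil; exact: isL2_0.
by rewrite lincomb_cons; apply: isL2D => //; exact: isL2Z.
Qed.

Lemma n2_0 : n2 m (fun=> 0 : R[i]) = 0.
Proof. by rewrite /n2 /N2 csq0 integral0. Qed.

Lemma clspan_gen i : clspan (phi i).
Proof.
split => // e e0; exists [:: (1, i)].
rewrite (_ : (fun x => _) = fun=> 0) ?n2_0//.
by apply/funext => x; rewrite lincomb_cons lincomb_nil mul1r add0r subrr.
Qed.

Lemma lincomb_lin c s1 s2 x :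
  lincomb (s1 ++ map (fun p => (c * p.1, p.2)) s2) x = lincomb s1 x + c * lincomb s2 x.
Proof.
rewrite /lincomb big_cat big_map/=; congr (_ + _).
by rewrite mulr_sumr; apply: eq_bigr => p _; rewrite mulrA.
Qed.

Lemma clspan_subspace : closed_subspace m clspan.
Proof.
split.
- by move=> f [].
- split; first exact: isL2_0.
  move=> e e0; exists [::]; rewrite lincomb_nil (_ : (fun x => _) = fun=> 0) ?n2_0//.
  by apply/funext => x; rewrite subrr.
- move=> c f g [mf sf] [mg sg]; split; first by apply: isL2D => //; exact: isL2Z.
  move=> e e0.
  have [s1 h1] := sf (e / 4) (ltac:(by rewrite divr_gt0)).
  have p0 : 0 < 4 * (csq c + 1) by rewrite mulr_gt0// ltr_wpDl// csq_ge0.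
  have [s2 h2] := sg (e / (4 * (csq c + 1))) (ltac:(by rewrite divr_gt0)).
  exists (s1 ++ map (fun p => (c * p.1, p.2)) s2).
  have -> : (fun x => f x + c * g x - lincomb (s1 ++ map (fun p => (c * p.1, p.2)) s2) x) =
    (fun x => (f x - lincomb s1 x) + c * (g x - lincomb s2 x)).
    by apply/funext => x; rewrite lincomb_lin; ring.
  have m1 := isL2B mf (isL2_lincomb s1); have m2 := isL2B mg (isL2_lincomb s2).
  apply: (le_lt_trans (n2D_le m1 (isL2Z c m2))).
  rewrite n2Z//.
  move: h1 h2; rewrite ltr_pdivlMr// ltr_pdivlMr//.
  have := n2_ge0 m (fun x => g x - lincomb s2 x); have := csq_ge0 c.
  by set a := n2 _ _; set b := n2 _ _ => c0 b0 h1 h2; nra.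
- move=> f mf sf; split => // e e0.
  have [g [mg sg] fg] := sf (e / 4) (ltac:(by rewrite divr_gt0)).
  have [s gs] := sg (e / 4) (ltac:(by rewrite divr_gt0)).
  exists s; apply: (le_lt_trans (n2B_le mf mg (isL2_lincomb s))).
  by move: fg gs; set a := n2 _ _; set b := n2 _ _; lra.
Qed.

Lemma cip_lincomb s t : cip m (lincomb s) (lincomb t) =
  \sum_(p <- s) \sum_(q <- t) p.1 * conjc q.1 * cip m (phi p.2) (phi q.2).
Proof.
elim: s => [|[c i] s IH].
  rewrite lincomb_nil big_nil /cip -[RHS](cint0 m); congr cint.
  by apply/funext => x; rewrite mul0r.
rewrite big_cons lincomb_cons cipDl ?cipZl//; do ?exact: isL2_lincomb; last first.
  by apply: isL2Z.
rewrite IH addrC; congr (_ + _) => /=; elim: t {IH} => [|[e j] t IH].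
  rewrite lincomb_nil big_nil /cip [X in c * X](_ : _ = 0) ?mulr0//.
  rewrite -[RHS](cint0 m); congr cint; apply/funext => x; apply: ceq; rewrite !ReImE; ring.
rewrite big_cons lincomb_cons cipDr//; [|exact: isL2_lincomb|exact: isL2Z].
by rewrite mulrDr IH cipZr//= addrC; congr (_ + _); rewrite mulrA.
Qed.

Lemma subspace_lincomb V s : closed_subspace m V -> (forall i, V (phi i)) -> V (lincomb s).
Proof.
move=> cV Vphi; elim: s => [|[c i] s IH].
  by rewrite lincomb_nil; exact: (subspace0 cV).
by rewrite lincomb_cons; exact: (subspace_lin cV).
Qed.

Lemma clspan_min V f : closed_subspace m V -> (forall i, V (phi i)) -> clspan f -> V f.
Proof.
move=> cV Vphi [mf sf]; apply: (subspace_closed cV) => // e e0.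
by have [s fs] := sf e e0; exists (lincomb s) => //; exact: subspace_lincomb.
Qed.

(** The kernel of l in the closed span is a closed subspace containing the generators. Linearity and
    boundedness are asked on the closed span alone, since the functionals built from [L] below are
    controlled only there. *)
Lemma functional_vanish (l : (T -> R[i]) -> R[i]) (C : R) f :
  (forall c f g, clspan f -> clspan g -> l (fun x => f x + c * g x) = l f + c * l g) ->
  (forall f, clspan f -> csq (l f) <= C * n2 m f) ->
  (forall i, l (phi i) = 0) -> clspan f -> l f = 0.
Proof.
move=> llin lbd lphi sf; have cs := clspan_subspace.
suff cV : closed_subspace m (fun f => clspan f /\ l f = 0).
  by have [] : clspan f /\ l f = 0
    by apply: (clspan_min cV) => // i; split => //; exact: clspan_gen.
split.
- by move=> g [[]].
- split; first exact: subspace0 cs.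
  apply: csq_eq0; apply/eqP; rewrite eq_le csq_ge0 andbT.
  by apply: le_trans (lbd _ (subspace0 cs)) _; rewrite n2_0 mulr0.
- move=> c g h [sg lg] [sh lh]; split; first exact: (subspace_lin cs).
  by rewrite llin// lg lh mulr0 addr0.
- move=> g mg H.
  have sg : clspan g.
    by apply: (subspace_closed cs) => // e /H[h []]; exists h.
  split => //; apply: csq_eq0; apply/eqP; rewrite eq_le csq_ge0 andbT leNgt; apply/negP => lg.
  have C0 : 0 < C.
    rewrite ltNge; apply/negP => C0; move: lg; apply/negP; rewrite -leNgt.
    by apply: le_trans (lbd _ sg) _; rewrite mulr_le0_ge0// n2_ge0.
  (* At this distance the bound gives [csq (l (g - h)) < csq (l g)], although [l h = 0]. *)
  have [h [sh lh] gh] := H (csq (l g) / C) (divr_gt0 lg C0).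
  have := lbd _ (subspace_lin cs (-1) sg sh).
  rewrite llin// lh mulr0 addr0 leNgt => /negP; apply.
  rewrite mulrC -ltr_pdivlMr//.
  by move: gh; congr (n2 m _ < _); apply/funext => x; rewrite mulN1r.
Qed.

End ClosedSpan.

(** Expanding both norms gives the same sum over pairs of generators, with Gram matrices
    proportional by the factor k. *)
Lemma n2_lincomb_isometry {R : realType} {d d' : measure_display} {T : measurableType d}
    {T' : measurableType d'} (m : {measure set T -> \bar R}) (m' : {measure set T' -> \bar R})
    (I : Type) (phi : I -> T -> R[i]) (phi' : I -> T' -> R[i]) (k : R) s :
  (forall i, isL2 m (phi i)) -> (forall i, isL2 m' (phi' i)) ->
  (forall i j, cip m' (phi' i) (phi' j) = cR k * cip m (phi i) (phi j)) ->
  n2 m' (lincomb phi' s) = k * n2 m (lincomb phi s).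
Proof.
move=> h h' iso; apply: cR_inj; rewrite cRM -!cipff !cip_lincomb// mulr_sumr.
apply: eq_bigr => p _; rewrite mulr_sumr; apply: eq_bigr => q _.
by rewrite iso; ring.
Qed.

Lemma cvg_csq {R : realType} (z_ : nat -> R[i]) (z : R[i]) :
  csq (z - z_ n) @[n --> \oo] --> (0 : R) -> csq (z_ n) @[n --> \oo] --> csq z.
Proof.
move=> h.
have key (p : R[i] -> R) : (forall a b, `|p a - p b| ^+ 2 <= csq (a - b)) ->
    p (z_ n) @[n --> \oo] --> p z.
  move=> pab; apply/cvgrPdist_lt => e e0.
  have /cvgrPdist_lt/(_ (e ^+ 2) (exprn_gt0 2 e0)) := h; apply: filterS => n.
  rewrite sub0r normrN ger0_norm ?csq_ge0// => /(le_lt_trans (pab _ _)).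
  by rewrite ltr_pXn2r// nnegrE ltW.
have hr : Re (z_ n) @[n --> \oo] --> Re z.
  by apply: (key (@complex.Re R)) => a b; rewrite -ReN -ReD csq_Re.
have hi : Im (z_ n) @[n --> \oo] --> Im z.
  by apply: (key (@complex.Im R)) => a b; rewrite -ImN -ImD csq_Im.
exact: (cvgD (cvgM hr hr) (cvgM hi hi)).
Qed.

Lemma limn_einf_le {R : realType} (u : nat -> \bar R) (c : \bar R) :
  (forall n, (u n <= c)%E) -> (limn_einf u <= c)%E.
Proof.
move=> uc; rewrite limn_einf_lim; apply: lime_le; first exact: is_cvg_einfs.
apply: nearW => n; apply: le_trans (uc n); rewrite /einfs; apply: ereal_inf_lbound.
by exists n => /=.
Qed.

(** * Extension of an isometry from generators to their closed span *)

Section IsometryExtension.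
Context {R : realType} {d : measure_display} {T : measurableType d}.
Context {d' : measure_display} {T' : measurableType d'}.
Variables (m : {measure set T -> \bar R}) (m' : {measure set T' -> \bar R}).
Variables (I : Type) (phi : I -> T -> R[i]) (L : (T -> R[i]) -> T' -> R[i]) (k : R).
Hypothesis phi2 : forall i, isL2 m (phi i).
Hypothesis k0 : 0 <= k.
Hypothesis Llin : forall c f g p, isL2 m f -> isL2 m g ->
  L (fun x => f x + c * g x) p = L f p + c * L g p.
(** Continuity of each evaluation at p, with a constant that may depend on p. Boundedness of [L]
    into L^2 is a conclusion of the section. *)
Hypothesis Lcont : forall p, exists C, forall f, isL2 m f -> csq (L f p) <= C * n2 m f.
Hypothesis Lmeas : forall f, isL2 m f -> cmeas (L f).
Hypothesis Lphi2 : forall i, isL2 m' (L (phi i)).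
Hypothesis Liso : forall i j, cip m' (L (phi i)) (L (phi j)) = cR k * cip m (phi i) (phi j).

Let lc := lincomb phi.

Let lc2 s : isL2 m (lc s). Proof. exact: isL2_lincomb. Qed.

Let L0 : L (fun=> 0) = fun=> 0.
Proof.
apply/funext => p; have [C /(_ _ (isL2_0 m))] := Lcont p.
rewrite n2_0 mulr0 => h; apply: csq_eq0; apply/eqP.
by rewrite eq_le h csq_ge0.
Qed.

Let Lcons c i s : L (lc ((c, i) :: s)) = fun p => L (lc s) p + c * L (phi i) p.
Proof. by rewrite /lc lincomb_cons; apply/funext => p; rewrite Llin//; exact: lc2. Qed.

Let Llc2 s : isL2 m' (L (lc s)).
Proof.
elim: s => [|[c i] s IH]; first by rewrite /lc lincomb_nil L0; exact: isL2_0.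
by rewrite Lcons; apply: isL2D => //; exact: isL2Z.
Qed.

Let LlcE s : L (lc s) = lincomb (fun i => L (phi i)) s.
Proof.
elim: s => [|[c i] s IH]; first by rewrite /lc !lincomb_nil L0.
by rewrite Lcons IH lincomb_cons.
Qed.

Let n2_lc s : n2 m' (L (lc s)) = k * n2 m (lc s).
Proof. by rewrite LlcE; exact: n2_lincomb_isometry. Qed.

(* Along approximations of f by linear combinations, L converges pointwise, so
   Fatou's lemma bounds the norm of L f. *)
Lemma extension_bound f (e : R) : clspan m phi f -> 0 < e ->
  (N2 m' (L f) <= (2 * k * n2 m f + e)%:E)%E.
Proof.
move=> [mf sf] e0.
(* The tolerance tends to 0, which gives pointwise convergence, and satisfies [2 * k * dl n <= e]
   for every n, which bounds the norms; the summand 1 covers k = 0. *)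
pose dl n := e / (2 * k + 1) / n.+1%:R.
have k1 : 0 < 2 * k + 1 by rewrite ltr_wpDl// mulr_ge0.
have dl0 n : 0 < dl n by rewrite !divr_gt0.
have [s_ sP] := choice (fun n => sf (dl n) (dl0 n)).
have cvg0 p : csq (L f p - L (lc (s_ n)) p) @[n --> \oo] --> (0 : R).
  have [C CP] := Lcont p.
  have C0 n : csq (L f p - L (lc (s_ n)) p) <= `|C| * dl n.
    have -> : L f p - L (lc (s_ n)) p = L (fun x => f x + (-1) * lc (s_ n) x) p.
      by rewrite Llin//; ring.
    apply: le_trans (CP _ _) _; first by apply: isL2D => //; exact: isL2Z.
    rewrite (_ : (fun x => _) = fun x => f x - lc (s_ n) x); last first.
      by apply/funext => x; rewrite mulN1r.
    apply: (@le_trans _ _ (`|C| * n2 m (fun x => f x - lc (s_ n) x))).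
      by rewrite ler_wpM2r ?n2_ge0 ?ler_norm.
    by rewrite ler_wpM2l// ltW.
  apply: (squeeze_cvgr (f := fun=> 0) (h := fun n => `|C| * dl n)).
  - by apply: nearW => n; rewrite csq_ge0 C0.
  - exact: cvg_cst.
  - rewrite -[X in _ --> X](mulr0 `|C|); apply: cvgM; first exact: cvg_cst.
    rewrite -[X in _ --> X](mulr0 (e / (2 * k + 1))); apply: cvgM; first exact: cvg_cst.
    exact: cvg_harmonic.
have -> : N2 m' (L f) = (\int[m']_p limn_einf (fun n => (csq (L (lc (s_ n)) p))%:E))%E.
  apply: eq_integral => p _; apply/esym.
  have h : (csq (L (lc (s_ n)) p))%:E @[n --> \oo] --> (csq (L f p))%:E.
    by apply/fine_cvgP; split; [exact: nearW|exact: cvg_csq].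
  by rewrite is_cvg_limn_einfE; [exact: cvg_lim|apply/cvg_ex; eexists; exact: h].
apply: le_trans (fatou _ _ _ _) _ => //.
- by move=> n; apply/measurable_EFinP; apply: measurable_csq; exact: Lmeas.
- by move=> n p _; rewrite lee_fin csq_ge0.
apply: limn_einf_le => n; rewrite -/(N2 m' (L (lc (s_ n)))) -n2E// lee_fin n2_lc.
have : n2 m (lc (s_ n)) <= 2 * n2 m f + 2 * n2 m (fun x => f x - lc (s_ n) x).
  have := n2D_le mf (isL2Z (-1) (isL2B mf (lc2 (s_ n)))).
  rewrite n2Z; last exact: isL2B.
  rewrite csqN csq1 mul1r; apply: le_trans.
  by rewrite (_ : (fun x => f x + _) = lc (s_ n))//; apply/funext => x; ring.
have : dl n <= e / (2 * k + 1).
  by rewrite /dl ler_pdivrMr// ler_peMr ?ler1n// divr_ge0// ltW.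
rewrite ler_pdivlMr//; have := sP n; have := dl0 n.
set a := n2 _ _; set b := n2 _ _; set c := n2 _ _; move=> h1 h2 h3 h4.
have h5 := ler_wpM2l k0 h4; have h6 := ler_wpM2l k0 (ltW h2).
move: h1 h2 h3 h4 h5 h6.
lra.
Qed.

Lemma extension_isL2 f : clspan m phi f -> isL2 m' (L f).
Proof.
move=> sf; apply/isL2P; split; first by apply: Lmeas; case: sf.
by apply: le_lt_trans (extension_bound sf ltr01) _; rewrite ltry.
Qed.

(** The constant 2 comes from [n2D_le]. The estimate serves as continuity for [extension_isometry],
    which then yields the sharp constant k. *)
Lemma extension_n2_le f : clspan m phi f -> n2 m' (L f) <= 2 * k * n2 m f.
Proof.
move=> sf; apply/ler_addgt0Pr => e e0; rewrite -lee_fin n2E; last exact: extension_isL2.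
exact: extension_bound.
Qed.

Let ext_lin (g : T -> R[i]) c f1 f2 : isL2 m g -> isL2 m' (L g) ->
  clspan m phi f1 -> clspan m phi f2 ->
  let l f := cip m' (L f) (L g) - cR k * cip m f g in
  l (fun x => f1 x + c * f2 x) = l f1 + c * l f2.
Proof.
move=> mg mLg s1 s2 /=; have [[m1 _] [m2 _]] := (s1, s2).
have -> : L (fun x => f1 x + c * f2 x) = fun p => L f1 p + c * L f2 p.
  by apply/funext => p; rewrite Llin.
have [e1 e2] := (extension_isL2 s1, extension_isL2 s2).
rewrite !cipDl ?cipZl//; do ?exact: isL2Z.
by ring.
Qed.

Let ext_bd (g : T -> R[i]) f : isL2 m g -> isL2 m' (L g) -> clspan m phi f ->
  csq (cip m' (L f) (L g) - cR k * cip m f g) <=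
  (4 * k * n2 m' (L g) + 2 * k ^+ 2 * n2 m g) * n2 m f.
Proof.
move=> mg mLg sf; have [mf _] := sf.
apply: le_trans (csqB_le _ _) _.
have h1 := cip_CauchySchwarz (extension_isL2 sf) mLg.
have h2 := cip_CauchySchwarz mf mg.
have h3 := extension_n2_le sf.
have h4 := n2_ge0 m' (L g).
rewrite csqM csq_cR.
move: h1 h2 h3 h4; set a := csq _; set b := csq _; set x := n2 _ _; set y := n2 _ _.
set z := n2 _ _; set w := n2 _ _ => h1 h2 h3 h4.
have h5 : a <= 2 * k * z * y by apply: le_trans h1 _; exact: ler_wpM2r.
have h6 : k ^+ 2 * b <= k ^+ 2 * (z * w) by apply: ler_wpM2l => //; exact: sqr_ge0.
by rewrite mulrDl; lra.
Qed.

(** The functional [f |-> <L f, L g> - k <f, g>] is bounded and linear on the closed span. It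
    vanishes on generators first when g is a generator, then, by conjugate symmetry and the first
    case, for every g. *)
Lemma extension_isometry f g : clspan m phi f -> clspan m phi g ->
  cip m' (L f) (L g) = cR k * cip m f g.
Proof.
move=> sf sg; apply/eqP; rewrite -subr_eq0; apply/eqP.
have step1 j h : clspan m phi h -> cip m' (L h) (L (phi j)) = cR k * cip m h (phi j).
  move=> sh; apply/eqP; rewrite -subr_eq0; apply/eqP.
  apply: (functional_vanish phi2 (l := fun f => cip m' (L f) (L (phi j)) - cR k * cip m f (phi j))
    (f := h) _ (fun f => @ext_bd (phi j) f (phi2 j) (Lphi2 j))) => //.
  - by move=> c f1 f2 s1 s2; exact: ext_lin.
  - by move=> i; rewrite Liso subrr.
have mLg := extension_isL2 sg; have [mg _] := sg.
apply: (functional_vanish phi2 (l := fun f => cip m' (L f) (L g) - cR k * cip m f g)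
    (f := f) _ (fun f => @ext_bd g f mg mLg)) => //.
- by move=> c f1 f2 s1 s2; exact: ext_lin.
- move=> i; rewrite (cipC mLg (Lphi2 i)) (cipC mg (phi2 i)) step1// conjcM conjc_cR.
  by rewrite subrr.
Qed.

End IsometryExtension.

(** * Product measures and affine changes of variable *)

Section ComplexFubini.
Context {R : realType} {d1 d2 : measure_display}.
Context {T1 : measurableType d1} {T2 : measurableType d2}.
Variables (m1 : {sigma_finite_measure set T1 -> \bar R}).
Variables (m2 : {sigma_finite_measure set T2 -> \bar R}).
Implicit Types F : T1 * T2 -> R[i].

(** An integrable function is finite almost everywhere, so [fine] alters it on a null set only. This
    matters for iterated integrals, whose inner integral can be infinite on a null set. *)
Lemma Rintegral_fine (d : measure_display) (T : measurableType d)
    (m : {measure set T -> \bar R}) (g : T -> \bar R) : m.-integrable setT g ->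
  m.-integrable setT (EFin \o (fine \o g)) /\ Rintegral m setT (fine \o g) = fine (\int[m]_x g x)%E.
Proof.
move=> ig; have gf := integrable_ae measurableT ig.
have mg := measurable_int _ ig.
have mfg : measurable_fun setT (EFin \o (fine \o g)).
  by apply/measurable_EFinP; exact: measurableT_comp.
split.
  apply: (le_integrable measurableT mfg _ ig) => x _ /=.
  by case: (g x) => [r||] /=; rewrite ?lexx ?leey.
rewrite /Rintegral; congr fine; apply: ae_eq_integral => //.
by apply: filterS gf => x /= gx _; rewrite fineK// gx.
Qed.

Lemma Rfubini12 (f : T1 * T2 -> R) : (m1 \x m2)%E.-integrable setT (EFin \o f) ->
  m1.-integrable setT (EFin \o (fun x => Rintegral m2 setT (fun y => f (x, y)))) /\
  Rintegral m1 setT (fun x => Rintegral m2 setT (fun y => f (x, y))) =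
  Rintegral (m1 \x m2)%E setT f.
Proof.
move=> If; have [h1 h2] := Rintegral_fine (integrable_fubini_F If).
by split; [exact: h1|rewrite /Rintegral -integral12_prod_meas1].
Qed.

Lemma measurable_section1 (d : measure_display) (T : measurableType d) (g : T1 * T2 -> T) x :
  measurable_fun setT g -> measurable_fun setT (fun y => g (x, y)).
Proof. by move=> mg; exact: (measurableT_comp mg (measurable_fun_pair (measurable_cst x) (measurable_id (D := setT)))). Qed.

Lemma measurable_section2 (d : measure_display) (T : measurableType d) (g : T1 * T2 -> T) y :
  measurable_fun setT g -> measurable_fun setT (fun x => g (x, y)).
Proof. by move=> mg; exact: (measurableT_comp mg (measurable_fun_pair (measurable_id (D := setT)) (measurable_cst y))). Qed.

Lemma integrable_fubini_G (f : T1 * T2 -> \bar R) : (m1 \x m2)%E.-integrable setT f ->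
  m2.-integrable setT (fubini_G m1 f).
Proof.
move=> If; have mf := measurable_int _ If.
apply/integrableP; split; first exact: (measurable_fubini_G If).
apply: le_lt_trans ((integrable21ltyP _ _ mf).1 If).
apply: ge0_le_integral => //.
- by apply: measurableT_comp => //; exact: (measurable_fubini_G If).
- by apply: (measurable_fun_fubini_tonelli_G (abse \o f)) => //=; exact: (measurableT_comp _ mf).
- move=> y _; apply: le_abse_integral => //; exact: (measurable_section2 _ mf).
Qed.

Lemma Rfubini21 (f : T1 * T2 -> R) : (m1 \x m2)%E.-integrable setT (EFin \o f) ->
  m2.-integrable setT (EFin \o (fun y => Rintegral m1 setT (fun x => f (x, y)))) /\
  Rintegral m2 setT (fun y => Rintegral m1 setT (fun x => f (x, y))) =
  Rintegral (m1 \x m2)%E setT f.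
Proof.
move=> If; have [h1 h2] := Rintegral_fine (integrable_fubini_G If).
by split; [exact: h1|rewrite /Rintegral -integral21_prod_meas1].
Qed.

Lemma cint12 F : cinteg (m1 \x m2)%E F ->
  cint (m1 \x m2)%E setT F = cint m1 setT (fun x => cint m2 setT (fun y => F (x, y))).
Proof.
move=> [fr fi]; apply: ceq => /=.
  by have [_ ->] := Rfubini12 fr.
by have [_ ->] := Rfubini12 fi.
Qed.

Lemma cint21 F : cinteg (m1 \x m2)%E F ->
  cint (m1 \x m2)%E setT F = cint m2 setT (fun y => cint m1 setT (fun x => F (x, y))).
Proof.
move=> [fr fi]; apply: ceq => /=.
  by have [_ ->] := Rfubini21 fr.
by have [_ ->] := Rfubini21 fi.
Qed.

Lemma cinteg12 F : cinteg (m1 \x m2)%E F ->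
  cinteg m1 (fun x => cint m2 setT (fun y => F (x, y))).
Proof.
by move=> [fr fi]; split; [have [] := Rfubini12 fr|have [] := Rfubini12 fi].
Qed.

Lemma cinteg21 F : cinteg (m1 \x m2)%E F ->
  cinteg m2 (fun y => cint m1 setT (fun x => F (x, y))).
Proof.
by move=> [fr fi]; split; [have [] := Rfubini21 fr|have [] := Rfubini21 fi].
Qed.

Lemma cmeas_section1 F x : cmeas F -> cmeas (fun y => F (x, y)).
Proof. by move=> [fr fi]; split; [exact: (measurable_section1 _ fr)|exact: (measurable_section1 _ fi)]. Qed.

Lemma cmeas_section2 F y : cmeas F -> cmeas (fun x => F (x, y)).
Proof. by move=> [fr fi]; split; [exact: (measurable_section2 _ fr)|exact: (measurable_section2 _ fi)]. Qed.

(** The inner integral is a difference of two Tonelli integrals, each measurable with values in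
    [\bar R]; [fine] then assigns a default value where the difference is infinite. *)
Lemma measurable_Rintegral12 (f : T1 * T2 -> R) : measurable_fun setT f ->
  measurable_fun setT (fun x => Rintegral m2 setT (fun y => f (x, y))).
Proof.
move=> mf; apply: (measurableT_comp (fine_measurable measurableT)).
have mEf : measurable_fun setT (EFin \o f) by exact/measurable_EFinP.
rewrite (_ : (fun x => _) = (fun x => \int[m2]_y (EFin \o f)^\+ (x, y) -
    \int[m2]_y (EFin \o f)^\- (x, y))%E); last first.
  by apply/funext => x; rewrite [LHS]integralE; congr (_ - _)%E; apply: eq_integral => y _; rewrite ?funeposE ?funenegE.
apply: emeasurable_funB.
- apply: (measurable_fun_fubini_tonelli_F (EFin \o f)^\+%E) => //.
  exact: (measurable_funepos mEf).
- apply: (measurable_fun_fubini_tonelli_F (EFin \o f)^\-%E) => //.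
  exact: (measurable_funeneg mEf).
Qed.

Lemma cmeas_cint12 F : cmeas F -> cmeas (fun x => cint m2 setT (fun y => F (x, y))).
Proof. by move=> [fr fi]; split; [exact: (measurable_Rintegral12 fr)|exact: (measurable_Rintegral12 fi)]. Qed.

Lemma measurable_csq_EFin F : cmeas F -> measurable_fun setT (fun z => (csq (F z))%:E).
Proof. by move=> mF; apply/measurable_EFinP; exact: measurable_csq. Qed.

Lemma N2_12 F : cmeas F -> N2 (m1 \x m2)%E F = (\int[m1]_x N2 m2 (fun y => F (x, y)))%E.
Proof.
move=> mF; rewrite /N2 -(fubini_tonelli1 (fun z => (csq (F z))%:E))//; first exact: measurable_csq_EFin.
by move=> z; rewrite lee_fin csq_ge0.
Qed.

Lemma N2_21 F : cmeas F -> N2 (m1 \x m2)%E F = (\int[m2]_y N2 m1 (fun x => F (x, y)))%E.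
Proof.
move=> mF; rewrite /N2 -(fubini_tonelli2 (fun z => (csq (F z))%:E))//; first exact: measurable_csq_EFin.
by move=> z; rewrite lee_fin csq_ge0.
Qed.

Lemma measurable_N2_12 F : cmeas F -> measurable_fun setT (fun x => N2 m2 (fun y => F (x, y))).
Proof.
move=> mF; apply: (measurable_fun_fubini_tonelli_F (fun z => (csq (F z))%:E)).
  exact: measurable_csq_EFin.
by move=> z; rewrite lee_fin csq_ge0.
Qed.

Lemma measurable_N2_21 F : cmeas F -> measurable_fun setT (fun y => N2 m1 (fun x => F (x, y))).
Proof.
move=> mF; apply: (measurable_fun_fubini_tonelli_G (fun z => (csq (F z))%:E)).
  exact: measurable_csq_EFin.
by move=> z; rewrite lee_fin csq_ge0.
Qed.

Lemma ae_isL2_section1 F : isL2 (m1 \x m2)%E F ->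
  {ae m1, forall x, isL2 m2 (fun y => F (x, y))}.
Proof.
move=> [mF iF]; apply: filterS (ae_integrable1 iF) => x ix; split => //.
exact: cmeas_section1.
Qed.

Definition tens (f : T1 -> R[i]) (h : T2 -> R[i]) : T1 * T2 -> R[i] :=
  fun z => f z.1 * h z.2.

Lemma cmeas_tens f h : cmeas f -> cmeas h -> cmeas (tens f h).
Proof.
by move=> mf mh; apply: cmeasM; [exact: (cmeas_comp mf)|exact: (cmeas_comp mh)].
Qed.

Lemma N2_tens f h : cmeas f -> cmeas h -> N2 (m1 \x m2)%E (tens f h) = (N2 m1 f * N2 m2 h)%E.
Proof.
move=> mf mh; rewrite N2_12; last exact: cmeas_tens.
rewrite /N2 -ge0_integralZr//.
- apply: eq_integral => x _; rewrite -ge0_integralZl//.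
  + by apply: eq_integral => y _; rewrite /tens csqM.
  + by apply/measurable_EFinP; exact: measurable_csq.
  + by move=> y _; rewrite lee_fin csq_ge0.
  + by rewrite lee_fin csq_ge0.
- by apply/measurable_EFinP; exact: measurable_csq.
- by move=> y _; rewrite lee_fin csq_ge0.
- by apply: integral_ge0 => y _; rewrite lee_fin csq_ge0.
Qed.

Lemma isL2_tens f h : isL2 m1 f -> isL2 m2 h -> isL2 (m1 \x m2)%E (tens f h).
Proof.
move=> mf mh; have [mf' _] := mf; have [mh' _] := mh.
apply/isL2P; split; first exact: cmeas_tens.
by rewrite N2_tens// -!n2E// -EFinM ltry.
Qed.

Lemma n2_tens f h : isL2 m1 f -> isL2 m2 h ->
  n2 (m1 \x m2)%E (tens f h) = n2 m1 f * n2 m2 h.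
Proof.
move=> mf mh; have [mf' _] := mf; have [mh' _] := mh.
by rewrite {1}/n2 N2_tens// -!n2E.
Qed.

Lemma cip_tens f1 h1 f2 h2 : isL2 m1 f1 -> isL2 m2 h1 -> isL2 m1 f2 -> isL2 m2 h2 ->
  cip (m1 \x m2)%E (tens f1 h1) (tens f2 h2) = cip m1 f1 f2 * cip m2 h1 h2.
Proof.
move=> mf1 mh1 mf2 mh2; rewrite /cip cint12; last first.
  by apply: cinteg_cip; exact: isL2_tens.
rewrite -cintZr; last exact: cinteg_cip.
congr cint; apply/funext => x; rewrite -cintZ; last exact: cinteg_cip.
by congr cint; apply/funext => y; rewrite /tens /= conjcM; ring.
Qed.

Lemma cinteg_tens f h : cinteg m1 f -> cinteg m2 h -> cinteg (m1 \x m2)%E (tens f h).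
Proof.
move=> cf ch; have [fr fi] := cf; have [hr hi] := ch.
pose p x := `|Re (f x)| + `|Im (f x)|.
pose q x := `|Re (h x)| + `|Im (h x)|.
have ip : m1.-integrable setT (EFin \o p).
  exact: (integrableD measurableT (integrable_abse fr) (integrable_abse fi)).
have iq : m2.-integrable setT (EFin \o q).
  exact: (integrableD measurableT (integrable_abse hr) (integrable_abse hi)).
have p0 x : 0 <= p x by rewrite addr_ge0.
have q0 x : 0 <= q x by rewrite addr_ge0.
have mp := measurable_int _ ip; have mq := measurable_int _ iq.
have bd (z : R[i]) : csq z <= (`|Re z| + `|Im z|) ^+ 2.
  rewrite /csq -!(@real_normK _ (Re _)) ?num_real// -!(@real_normK _ (Im _)) ?num_real//.
  by rewrite sqrrD addrAC lerDl mulrn_wge0// mulr_ge0.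
apply: (@cinteg_le _ _ _ _ _ (fun z => p z.1 * q z.2)).
- exact: (cmeas_tens (cinteg_meas cf) (cinteg_meas ch)).
- have mpq : measurable_fun setT (EFin \o (fun z : T1 * T2 => p z.1 * q z.2)).
    apply/measurable_EFinP; apply: measurable_funM.
      by apply: (measurableT_comp (f := p)) => //; exact/measurable_EFinP.
    by apply: (measurableT_comp (f := q)) => //; exact/measurable_EFinP.
  apply/(integrable12ltyP _ _ mpq).
  have Q0 : (0 <= \int[m2]_y (q y)%:E)%E by apply: integral_ge0 => y _; rewrite lee_fin.
  have -> : (\int[m1]_x \int[m2]_y `|(EFin \o (fun z : T1 * T2 => p z.1 * q z.2)%R) (x, y)| =
      (\int[m1]_x (p x)%:E) * \int[m2]_y (q y)%:E)%E.
    rewrite -ge0_integralZr//; last by move=> x _; rewrite lee_fin.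
    apply: eq_integral => x _; rewrite -ge0_integralZl//; [|by move=> y _; rewrite lee_fin|by rewrite lee_fin].
    by apply: eq_integral => y _; rewrite /= ger0_norm// mulr_ge0.
  have := integrable_fin_num measurableT ip; have := integrable_fin_num measurableT iq.
  by move=> /fineK <- /fineK <-; rewrite -EFinM ltry.
- by move=> z; rewrite mulr_ge0.
- by move=> z; rewrite csqM exprMn ler_pM ?csq_ge0.
Qed.

End ComplexFubini.

Section AffineChange.
Context {R : realType}.
Notation leb := (@leb1 R).

Lemma measurable_aff (a b : R) : measurable_fun setT (fun x : R => a * x + b).
Proof. by apply: measurable_funD => //; apply: measurable_funM. Qed.

Lemma lebesgue_preimage_aff (a b c e : R) : a != 0 ->
  ((`|a|%R)%:E * leb ((fun x => (a * x + b)%R) @^-1` `]c, e]%classic) = leb `]c, e]%classic)%E.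
Proof.
move=> a0.
have [ap|an] : 0 < a \/ a < 0 by move: a0; rewrite neq_lt => /orP[]; [right|left].
- have -> : (fun x => a * x + b) @^-1` `]c, e] = `](c - b) / a, (e - b) / a]%classic.
    apply/seteqP; split => x /=; rewrite !in_itv /= ltr_pdivrMr// ler_pdivlMr//;
      by rewrite ltrBlDr lerBrDr mulrC.
  rewrite /leb1 !lebesgue_measure_itv /= !lte_fin ltr_pM2r ?invr_gt0// ltrD2r.
  case: ifP => _; last by rewrite mule0.
  rewrite -!EFinB -EFinM; congr EFin.
  by rewrite gtr0_norm//; field.
(* A negative slope exchanges the ends, so the preimage is closed on the left; its length is
   unaffected. *)
- have -> : (fun x => a * x + b) @^-1` `]c, e] = `[(e - b) / a, (c - b) / a[%classic.
    apply/seteqP; split => x /=; rewrite !in_itv /= ltr_ndivlMr// ler_ndivrMr//;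
      by rewrite ltrBlDr lerBrDr mulrC andbC.
  rewrite /leb1 !lebesgue_measure_itv /= !lte_fin ltr_nM2r ?invr_lt0// ltrD2r.
  case: ifP => _; last by rewrite mule0.
  rewrite -!EFinB -EFinM; congr EFin.
  by rewrite ltr0_norm//; field.
Qed.

(** By uniqueness of Lebesgue measure: [|a|] times its image under [x |-> a x + b] gives the right
    mass to half-open intervals. *)
Lemma ge0_integral_aff (a b : R) (f : R -> \bar R) : a != 0 ->
  measurable_fun setT f -> (forall x, 0 <= f x)%E ->
  (\int[leb]_x f x = (`|a|%R)%:E * \int[leb]_x f (a * x + b)%R)%E.
Proof.
move=> a0 mf f0.
have maff : measurable_fun (setT : set (measurableTypeR R))
  ((fun x => a * x + b) : measurableTypeR R -> measurableTypeR R) := measurable_aff a b.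
have na0 : 0 <= `|a| by [].
pose pm := measure_function_pushforward__canonical__measure_function_Measure leb maff.
pose mu : {measure set (measurableTypeR R) -> \bar R} := mscale (NngNum na0) pm.
have muE (A : set (measurableTypeR R)) : measurable A -> leb A = mu A.
  move=> mA; apply: lebesgue_measure_unique => // X [[c e] _ <-].
  exact: (esym (lebesgue_preimage_aff b c e a0)).
rewrite (eq_measure_integral mu); last by move=> A mA _; exact: muE.
rewrite ge0_integral_mscale//=; congr (_ * _)%E.
by rewrite (ge0_integral_pushforward maff).
Qed.

End AffineChange.

(* Fix the measurable structure on R to the one that carries [leb1]: unification
   may otherwise pick another display for the same sigma-algebra. *)
Notation cmeas1 := (cmeas (T := measurableTypeR _)).
Notation cmeas2 := (cmeas (T := (measurableTypeR _ * measurableTypeR _)%type)).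

Section AffineComplex.
Context {R : realType}.
Implicit Types f g : R -> R[i].

Lemma cmeas_aff (a b : R) f : cmeas1 f -> cmeas1 (fun x => f (a * x + b)).
Proof. by move=> mf; exact: (cmeas_comp mf (measurable_aff a b)). Qed.

Lemma N2_aff (a b : R) f : a != 0 -> cmeas1 f ->
  (N2 leb1 f = (`|a|%R)%:E * N2 leb1 (fun x => f (a * x + b)%R))%E.
Proof.
move=> a0 mf; rewrite /N2 (ge0_integral_aff b a0 (f := fun x => (csq (f x))%:E))//.
- by apply/measurable_EFinP; exact: measurable_csq.
- by move=> x; rewrite lee_fin csq_ge0.
Qed.

Lemma isL2_aff (a b : R) f : a != 0 -> isL2 leb1 f -> isL2 leb1 (fun x => f (a * x + b)).
Proof.
move=> a0 /isL2P[mf foo]; apply/isL2P; split; first exact: cmeas_aff.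
move: foo; rewrite (N2_aff b a0 mf); have := N2_ge0 leb1 (fun x => f (a * x + b)).
case: (N2 _ _) => [r||]//; rewrite ?ltry// gt0_muley// lte_fin normr_gt0//.
Qed.

Lemma n2_aff (a b : R) f : a != 0 -> isL2 leb1 f ->
  n2 leb1 f = `|a| * n2 leb1 (fun x => f (a * x + b)).
Proof.
move=> a0 mf; apply: EFin_inj; rewrite EFinM n2E// n2E; last exact: isL2_aff.
by apply: N2_aff => //; exact: isL2_meas mf.
Qed.

Lemma Rintegral_aff (a b : R) (f : R -> R) : a != 0 -> leb1.-integrable setT (EFin \o f) ->
  leb1.-integrable setT (EFin \o (fun x => f (a * x + b))) /\
  Rintegral leb1 setT f = `|a| * Rintegral leb1 setT (fun x => f (a * x + b)).
Proof.
move=> a0 If; have mf := measurable_int _ If.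
have mfa : measurable_fun setT (EFin \o (fun x => f (a * x + b))).
  exact: (measurableT_comp mf (measurable_aff a b)).
have na0 : (0 < (`|a|%R)%:E)%E by rewrite lte_fin normr_gt0.
have Ifa : leb1.-integrable setT (EFin \o (fun x => f (a * x + b))).
  apply/integrableP; split => //.
  have /integrableP[_] := If.
  rewrite (ge0_integral_aff b a0 (f := fun x => `|(f x)%:E|%E))//; last exact: measurableT_comp.
  rewrite /=; have := @integral_ge0 _ _ _ leb1 setT (fun x : R => `|(f (a * x + b)%R)%:E|%E)
    (fun x _ => abse_ge0 _).
  by case: (\int[_]_(_ in _) _)%E => [r||]//; rewrite ?ltry// gt0_muley.
split => //; rewrite /Rintegral.
rewrite [in LHS]integralE [in RHS]integralE.
rewrite (ge0_integral_aff b a0 (f := (fun x => (f x)%:E)^\+%E))//; last exact: measurable_funepos.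
rewrite (ge0_integral_aff b a0 (f := (fun x => (f x)%:E)^\-%E))//; last exact: measurable_funeneg.
have fp := integrable_fin_num measurableT (integrable_funepos measurableT Ifa).
have fn := integrable_fin_num measurableT (integrable_funeneg measurableT Ifa).
have -> : (\int[leb1]_x (fun x => (f x)%:E)^\+ (a * x + b)%R =
    \int[leb1]_x (EFin \o (fun x => f (a * x + b)%R))^\+ x)%E.
  by apply: eq_integral => x _; rewrite !funeposE.
have -> : (\int[leb1]_x (fun x => (f x)%:E)^\- (a * x + b)%R =
    \int[leb1]_x (EFin \o (fun x => f (a * x + b)%R))^\- x)%E.
  by apply: eq_integral => x _; rewrite !funenegE.
move: fp fn; rewrite /=; move: (\int[_]_x _)%E (\int[_]_x _)%E => [p||]// [q||]//= _ _.
by rewrite mulrBr.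
Qed.

Lemma cinteg_aff (a b : R) f : a != 0 -> cinteg leb1 f -> cinteg leb1 (fun x => f (a * x + b)).
Proof.
by move=> a0 [fr fi]; split; [have [] := Rintegral_aff b a0 fr|have [] := Rintegral_aff b a0 fi].
Qed.

Lemma cint_aff (a b : R) f : a != 0 -> cinteg leb1 f ->
  cint leb1 setT f = cR `|a| * cint leb1 setT (fun x => f (a * x + b)).
Proof.
move=> a0 [fr fi]; have [_ hr] := Rintegral_aff b a0 fr; have [_ hi] := Rintegral_aff b a0 fi.
apply: ceq; rewrite !ReImE ?mul0r ?subr0 ?addr0.
  exact: hr.
exact: hi.
Qed.

End AffineComplex.

(** * Plancherel for the inverse Fourier transform *)

Section FTCtrig.
Context {R : realType}.
Implicit Types w x : R.

Let scaleRE (a b : R) : a *: b = a * b. Proof. by []. Qed.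

Let is_derive_scale w x : is_derive x 1 (fun x : R => w * x) w.
Proof. by have := @is_deriveZ _ _ _ id w x 1 1 (is_derive_id x 1); rewrite /GRing.scale /= mulr1. Qed.

Let is_derive_sinZ w x : w != 0 ->
  is_derive x 1 (w^-1 *: (sin \o (fun x => w * x)) : R -> R) (cos (w * x)).
Proof.
move=> w0; have hs := is_derive_scale w x.
apply: (is_derive_eq (is_deriveZ w^-1 (is_derive1_comp (is_derive_sin (w * x)) hs))).
by rewrite /GRing.scale /= mulrCA mulVf ?mulr1.
Qed.

Let is_derive_cosZ w x : w != 0 ->
  is_derive x 1 (- w^-1 *: (cos \o (fun x => w * x)) : R -> R) (sin (w * x)).
Proof.
move=> w0; have hs := is_derive_scale w x.
apply: (is_derive_eq (is_deriveZ (- w^-1) (is_derive1_comp (is_derive_cos (w * x)) hs))).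
by rewrite /GRing.scale /=; field.
Qed.

Let FTC (f F : R -> R) : (forall x, is_derive x 1 F (f x)) -> continuous f ->
  (\int[leb1]_(x in `[0%R, 1%R]) (f x)%:E = (F 1 - F 0)%:E)%E.
Proof.
move=> dF cf.
have cF x : {for x, continuous F}.
  by apply: differentiable_continuous; apply/derivable1_diffP; case: (dF x).
rewrite /leb1 (@continuous_FTC2 _ f F)//.
- exact: continuous_subspaceT.
- split; first by move=> x _; case: (dF x).
  + by apply: cvg_at_right_filter; exact: cF.
  + by apply: cvg_at_left_filter; exact: cF.
- by move=> x _; rewrite derive1E; exact: derive_val.
Qed.

Lemma integral_cosZ w : w != 0 ->
  Rintegral leb1 `[0%R, 1%R] (fun x => cos (w * x)) = sin w / w.
Proof.
move=> w0; rewrite /Rintegral (FTC (fun x => is_derive_sinZ x w0)).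
  by rewrite /GRing.scale /= !scaleRE mulr1 mulr0 sin0 mulr0 subr0 mulrC.
by move=> x; apply: continuous_comp; [exact: mulrl_continuous|exact: continuous_cos].
Qed.

Lemma integral_sinZ w : w != 0 ->
  Rintegral leb1 `[0%R, 1%R] (fun x => sin (w * x)) = (1 - cos w) / w.
Proof.
move=> w0; rewrite /Rintegral (FTC (fun x => is_derive_cosZ x w0)).
  by rewrite /GRing.scale /= !scaleRE mulr1 mulr0 cos0; field.
by move=> x; apply: continuous_comp; [exact: mulrl_continuous|exact: continuous_sin].
Qed.

End FTCtrig.

Section InverseFourier.
Context {R : realType}.
Implicit Types (f G H : R -> R[i]) (a b s t u x : R).

(** An integral in the ordinary sense, hence the inverse transform for integrable G only. For G in
    L^2 integrability comes from bounded support. *)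
Definition ift G u : R[i] := cint leb1 setT (fun x => G x * expi (2 * pi * u * x)).

Definition ivl a b x : R[i] := cR (\1_`]a, b]%classic x).

Lemma ivlE a b x : ivl a b x = cR ((a < x <= b)%R%:R).
Proof. by rewrite /ivl indicE mem_setE. Qed.

Lemma leb1_ivl a b : (leb1 (`]a, b]%classic : set R) < +oo)%E.
Proof. by rewrite /leb1 lebesgue_measure_itv /=; case: ifP => _; rewrite ?ltry. Qed.

Lemma isL2_ivl a b : isL2 leb1 (ivl a b).
Proof. by apply: isL2_indic; [exact: measurable_itv|exact: leb1_ivl]. Qed.

Lemma n2_ivl a b : a <= b -> n2 leb1 (ivl a b) = b - a.
Proof.
move=> ab.
have E : (leb1 (`]a, b]%classic : set R) = (b - a)%:E)%E.
  rewrite /leb1 lebesgue_measure_itv /= lte_fin; case: ltgtP ab => // -> _.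
  by rewrite subrr.
by rewrite n2_indic; [exact: (congr1 fine E)|exact: measurable_itv].
Qed.

Lemma csq_ivl a b x : csq (ivl a b x) <= 1.
Proof. by rewrite ivlE csq_cR; case: (_ < _ <= _); rewrite ?expr1n ?expr0n. Qed.

Lemma ivlM a b x : ivl a b x * ivl a b x = ivl a b x.
Proof. by rewrite ivlE -cRM; case: (_ < _ <= _); rewrite ?mulr1 ?mulr0. Qed.

Lemma conj_ivl a b x : conjc (ivl a b x) = ivl a b x.
Proof. by rewrite /ivl conjc_cR. Qed.

Lemma cinteg_ivl a b : cinteg leb1 (ivl a b).
Proof.
have := cinteg_mul (isL2_ivl a b) (isL2_ivl a b).
by congr cinteg; apply/funext => x; rewrite ivlM.
Qed.

Lemma cmeas_char u : cmeas1 (fun x => expi (2 * pi * u * x)).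
Proof. by apply: cmeas_expi; exact: measurable_funM. Qed.

Lemma cinteg_ift G u : cinteg leb1 G -> cinteg leb1 (fun x => G x * expi (2 * pi * u * x)).
Proof.
move=> mG; have := @cintegM_bdd _ _ _ leb1 G (fun x => expi (2 * pi * u * x)) 1 mG (cmeas_char u).
under eq_fun do rewrite mulrC; apply => x.
by rewrite csq_expi.
Qed.

Lemma iftD (c : R[i]) G H u : cinteg leb1 G -> cinteg leb1 H ->
  ift (fun x => G x + c * H x) u = ift G u + c * ift H u.
Proof.
move=> mG mH; have h1 := cinteg_ift u mG; have h2 := cinteg_ift u mH.
rewrite /ift -cintZ// -cintD//; last exact: cintegZ.
by congr cint; apply/funext => x; rewrite mulrDl mulrA.
Qed.

Lemma cmeas_ift G : cmeas1 G -> cmeas1 (ift G).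
Proof.
move=> mG.
apply: (cmeas_cint12 leb1 (F := fun z : R * R => G z.2 * expi (2 * pi * z.1 * z.2))).
apply: cmeasM; first exact: (cmeas_comp mG measurable_snd).
apply: cmeas_expi; apply: measurable_funM => //; exact: measurable_funM.
Qed.

Lemma ift_unitE u : u != 0 ->
  ift (ivl 0 1) u = Complex (sin (2 * pi * u) / (2 * pi * u))
                            ((1 - cos (2 * pi * u)) / (2 * pi * u)).
Proof.
move=> u0; have w0 : 2 * pi * u != 0 by rewrite !mulf_neq0// gt_eqF// pi_gt0.
have [ir ii] := (cintegrable_mkcond leb1 (fun x => expi (2 * pi * u * x)) (measurable_itv `]0, 1])).2
  (cinteg_ift u (cinteg_ivl 0 1)).
rewrite /ift -(cint_mkcond leb1 `]0, 1]%classic (fun x => expi (2 * pi * u * x))) /cint.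
congr Complex.
  by rewrite -(integral_cosZ w0); apply: Rintegral_itv_obnd_cbnd.
by rewrite -(integral_sinZ w0); apply: Rintegral_itv_obnd_cbnd.
Qed.

Lemma csq_ift_unit u : u != 0 ->
  csq (ift (ivl 0 1) u) = (2 - 2 * cos (2 * pi * u)) / (2 * pi * u) ^+ 2.
Proof.
move=> u0; have w0 : 2 * pi * u != 0 by rewrite !mulf_neq0// gt_eqF// pi_gt0.
rewrite ift_unitE// /csq /= !expr_div_n -mulrDl; congr (_ / _).
have := cos2Dsin2 (2 * pi * u); set c := cos _; set z := sin _ => h.
by rewrite sqrrB expr1n mul1r; lra.
Qed.

(** Cauchy-Schwarz against a character gives the bound 1 near the origin; the explicit formula and
    [cos >= -1] give decay like [u^-2]. Together they give a multiple of [1 / (1 + u^2)], whose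
    integral is finite. *)
Lemma csq_ift_unit_le u : csq (ift (ivl 0 1) u) <= 2 * (oneDsqr u)^-1.
Proof.
have b1 : csq (ift (ivl 0 1) u) <= 1.
  have me : isL2 leb1 (fun x => ivl 0 1 x * expi (- (2 * pi * u * x))).
    have := isL2Mbdd (cmeas_char (- u)) (isL2_ivl 0 1) (C := 1) (fun x => eq_ind_r (fun c => is_true (c <= 1)) (lexx 1) (csq_expi _)).
    by congr isL2; apply/funext => x; rewrite mulrC; congr (_ * expi _); ring.
  have := cip_CauchySchwarz (isL2_ivl 0 1) me.
  have -> : cip leb1 (ivl 0 1) (fun x => ivl 0 1 x * expi (- (2 * pi * u * x))) = ift (ivl 0 1) u.
    by congr cint; apply/funext => x; rewrite conjcM conj_ivl conjc_expi opprK mulrA ivlM.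
  move=> /le_trans; apply.
  rewrite n2_ivl// subr0 mul1r.
  have := le_n2 me (isL2_ivl 0 1) ler01.
  rewrite n2_ivl// subr0 mul1r; apply => x.
  by rewrite csqM csq_expi mulr1 mul1r.
case: (eqVneq u 0) b1 => [->|u0] b1.
  by rewrite /oneDsqr expr0n /= addr0 invr1 mulr1 (le_trans b1)// ler1n.
have w0 : 2 * pi * u != 0 by rewrite !mulf_neq0// gt_eqF// pi_gt0.
(* The constant 16 is [(2 * 2) ^+ 2], from [pi >= 2]. *)
have w2 : 16 * u ^+ 2 <= (2 * pi * u) ^+ 2.
  rewrite !exprMn ler_wpM2r ?sqr_ge0//.
  by have := pi_ge2 R; move: (pi : R) => p p2; nra.
have h : csq (ift (ivl 0 1) u) * (2 * pi * u) ^+ 2 = 2 - 2 * cos (2 * pi * u).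
  by rewrite csq_ift_unit// divfK// expf_neq0.
have := cos_geN1 (2 * pi * u); move: h b1 w2 (csq_ge0 (ift (ivl 0 1) u)).
rewrite /oneDsqr ler_pdivlMr ?ltr_pwDl ?sqr_ge0//.
set c := cos _; set w := _ ^+ 2; set z := csq _; set v := u ^+ 2 => h b1 w2 z0 c1.
have := ler_wpM2l z0 w2; rewrite h.
by nra.
Qed.

(* The value (it is 1) is never needed, only positivity. *)
Definition kappa : R := n2 leb1 (ift (ivl 0 1)).

Lemma isL2_ift_unit : isL2 leb1 (ift (ivl 0 1)).
Proof.
apply/isL2P; split; first by apply: cmeas_ift; exact: isL2_meas (isL2_ivl 0 1).
have mo : measurable_fun (setT : set (measurableTypeR R)) (fun x : R => ((oneDsqr x)^-1)%:E).
  apply/measurable_EFinP; apply: continuous_measurable_fun; exact: continuous_oneDsqrV.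
apply: (@le_lt_trans _ _ (2%:E * \int[leb1]_x ((oneDsqr x)^-1)%:E)%E).
  rewrite -ge0_integralZl//.
  apply: ge0_le_integral => //.
  - by move=> x _; rewrite lee_fin csq_ge0.
  - by apply/measurable_EFinP; apply: measurable_csq; apply: cmeas_ift; exact: isL2_meas (isL2_ivl 0 1).
  - exact: measurable_funeM.
  - by move=> x _; rewrite -EFinM lee_fin csq_ift_unit_le.
rewrite /leb1 ge0_symfun_integralT//.
- rewrite -set_itvcy integral0y_oneDsqr -!EFinM ltry//.
- exact: continuous_oneDsqrV.
- by move=> x; rewrite /= /oneDsqr sqrrN.
Qed.

(** For u in ]1/4, 1/2] the angle [2 pi u] lies in ]pi/2, pi], where cos is nonpositive; the
    explicit formula is then at least [2 / pi^2] on an interval of positive length. *)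
Lemma kappa_gt0 : 0 < kappa.
Proof.
pose q : R := 4^-1; pose h : R := 2^-1.
have pi2 := pi_ge2 R.
have low u : q < u <= h -> 2 / (pi ^+ 2) <= csq (ift (ivl 0 1) u).
  move=> /andP[qu uh]; have u0 : 0 < u by apply: lt_trans qu; rewrite invr_gt0.
  rewrite csq_ift_unit ?gt_eqF//.
  have pp : 0 < pi :> R by exact: pi_gt0.
  rewrite ler_pdivrMr ?exprn_gt0// mulrAC ler_pdivlMr ?exprn_gt0 ?mulr_gt0//.
  have c0 : cos (2 * pi * u) <= 0.
    have -> : 2 * pi * u = (2 * pi * u - pi / 2) + pi / 2 by rewrite subrK.
    rewrite cosDpihalf oppr_le0; apply: sin_ge0_pi.
    by move: qu uh; rewrite /q /h => qu uh; apply/andP; split; nra.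
  have h1 : 2 * pi * u <= pi by move: uh; rewrite /h; nra.
  have h2 : (2 * pi * u) ^+ 2 <= pi ^+ 2.
    by rewrite ler_pXn2r ?nnegrE// ?mulr_ge0// ltW.
  have h3 : 0 < pi ^+ 2 :> R by rewrite exprn_gt0.
  by nra.
have c2 : 0 < pi ^+ 2 / 2 :> R by rewrite divr_gt0// exprn_gt0// pi_gt0.
have := le_n2 (isL2_ivl q h) isL2_ift_unit (ltW c2).
rewrite n2_ivl; last by rewrite /q /h; lra.
rewrite -/kappa => H; rewrite -(pmulr_rgt0 _ c2); apply: lt_le_trans (H _).
  by rewrite /q /h; lra.
move=> x; rewrite ivlE csq_cR.
case: (boolP (q < x <= h)) => [/low|_]; last first.
  by rewrite expr0n /= mulr_ge0 ?csq_ge0// ltW.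
rewrite expr1n ler_pdivrMr ?exprn_gt0 ?pi_gt0// => L.
by rewrite mulrAC ler_pdivlMr// mul1r mulrC.
Qed.

Lemma ift_ivl_scale t l u : 0 < l ->
  ift (ivl t (t + l)) u = cR l * expi (2 * pi * u * t) * ift (ivl 0 1) (l * u).
Proof.
move=> l0; rewrite /ift (@cint_aff _ l t)//; [|by rewrite gt_eqF|exact: cinteg_ift (cinteg_ivl _ _)].
rewrite gtr0_norm// -[RHS]mulrA; congr (_ * _).
rewrite -cintZ; last exact: cinteg_ift (cinteg_ivl _ _).
congr cint; apply/funext => x; rewrite !ivlE.
have -> : (t < l * x + t <= t + l) = (0 < x <= 1).
  by rewrite ltrDr pmulr_rgt0// addrC lerD2l ger_pMr.
rewrite mulrCA -expiD; congr (_ * expi _); ring.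
Qed.

Lemma ift0 G u : (forall x, G x = 0) -> ift G u = 0.
Proof.
move=> G0; rewrite /ift -[RHS](cint0 leb1); congr cint.
by apply/funext => x; rewrite G0 mul0r.
Qed.

Lemma ivl_gt a b x : b <= a -> ivl a b x = 0.
Proof.
move=> ba; rewrite ivlE; case: (boolP (_ < _ <= _)) => //= /andP[h1 h2].
by have := lt_le_trans h1 (le_trans h2 ba); rewrite ltxx.
Qed.

Lemma isL2_ift_ivl a b : isL2 leb1 (ift (ivl a b)).
Proof.
have [ba|ab] := leP b a.
  have -> : ift (ivl a b) = fun=> 0.
    by apply/funext => u; apply: ift0 => x; exact: ivl_gt.
  exact: isL2_0.
have l0 : 0 < b - a by rewrite subr_gt0.
have h := isL2_aff 0 (lt0r_neq0 l0) isL2_ift_unit.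
have := isL2Mbdd (cmeas_char a) h (C := 1) (fun x => eq_ind_r (fun c => is_true (c <= 1)) (lexx 1) (csq_expi _)).
move=> /(isL2Z (cR (b - a))); congr isL2; apply/funext => u.
rewrite -[in RHS](subrKC a b) ift_ivl_scale// addr0 mulrA; congr (_ * expi _ * _); ring.
Qed.

(** Translation contributes a unimodular factor. Dilation by b - a contributes [(b - a) ^+ 2]
    through the amplitude and the inverse of b - a through the change of variable in u. *)
Lemma n2_ift_ivl a b : a <= b -> n2 leb1 (ift (ivl a b)) = kappa * (b - a).
Proof.
rewrite le_eqVlt => /predU1P[->|ab].
  rewrite subrr mulr0 (_ : ift _ = fun=> 0) ?n2_0//.
  by apply/funext => u; apply: ift0 => x; rewrite ivl_gt.
have l0 : 0 < b - a by rewrite subr_gt0.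
have E : n2 leb1 (ift (ivl a b)) = (b - a) ^+ 2 * n2 leb1 (fun u => ift (ivl 0 1) ((b - a) * u + 0)).
  rewrite -csq_cR -n2Z; last exact: isL2_aff (lt0r_neq0 l0) isL2_ift_unit.
  congr fine; apply: eq_integral => u _.
  rewrite -[in LHS](subrKC a b) ift_ivl_scale// addr0 !csqM csq_expi mulr1 //.
rewrite E /kappa (n2_aff 0 (lt0r_neq0 l0) isL2_ift_unit) gtr0_norm//; ring.
Qed.

Lemma ift_real G u : (forall x, conjc (G x) = G x) -> cinteg leb1 G ->
  ift G (- u) = conjc (ift G u).
Proof.
move=> Gr mG; rewrite /ift -cint_conj; last exact: cinteg_ift.
congr cint; apply/funext => x; rewrite conjcM Gr conjc_expi; congr (_ * expi _); ring.
Qed.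

Lemma cip_ift_real G H : (forall x, conjc (G x) = G x) -> (forall x, conjc (H x) = H x) ->
  cinteg leb1 G -> cinteg leb1 H -> isL2 leb1 (ift G) -> isL2 leb1 (ift H) ->
  Im (cip leb1 (ift G) (ift H)) = 0.
Proof.
move=> Gr Hr mG mH LG LH.
have m1 : (-1 : R) != 0 by rewrite oppr_eq0 oner_eq0.
have mm := cinteg_cip LG LH.
have : cip leb1 (ift G) (ift H) = conjc (cip leb1 (ift G) (ift H)).
  rewrite /cip -cint_conj// (cint_aff 0 m1 mm) normrN1 cR1 mul1r.
  congr cint; apply/funext => x.
  by rewrite mulN1r addr0 !ift_real// conjcM.
move=> /(congr1 (@complex.Im R)); rewrite Im_conj => h; lra.
Qed.

(* The signed indicator of the interval between 0 and t, so that for s <= t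
   chi t - chi s is the indicator of ]s, t]. *)
Definition chi t x : R[i] := ivl 0 t x - ivl t 0 x.

Lemma chiE t x : chi t x = cR ((x <= t)%R%:R - (x <= 0)%R%:R).
Proof.
rewrite /chi !ivlE -cRN -cRD !ltNge; congr cR.
by case: (x <= 0); case: (x <= t) => /=; rewrite ?subrr ?subr0 ?sub0r.
Qed.

Lemma chi_sub s t x : s <= t -> chi t x - chi s x = ivl s t x.
Proof.
move=> st; rewrite !chiE ivlE -cRN -cRD ltNge; congr cR.
have : (x <= s) ==> (x <= t) by apply/implyP => /le_trans; apply.
by case: (x <= t); case: (x <= s) => //= _; lra.
Qed.

Lemma conj_chi t x : conjc (chi t x) = chi t x.
Proof. by rewrite chiE conjc_cR. Qed.

Lemma isL2_chi t : isL2 leb1 (chi t).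
Proof. by apply: isL2B; exact: isL2_ivl. Qed.

Lemma cinteg_chi t : cinteg leb1 (chi t).
Proof. by apply: cintegB; exact: cinteg_ivl. Qed.

Lemma ift_chi t u : ift (chi t) u = ift (ivl 0 t) u - ift (ivl t 0) u.
Proof.
have := iftD (-1) u (cinteg_ivl 0 t) (cinteg_ivl t 0); rewrite mulN1r => <-.
by congr ift; apply/funext => x; rewrite mulN1r.
Qed.

Lemma isL2_ift_chi t : isL2 leb1 (ift (chi t)).
Proof.
have := isL2B (isL2_ift_ivl 0 t) (isL2_ift_ivl t 0); congr isL2.
by apply/funext => u; rewrite ift_chi.
Qed.

Lemma ift_chi_sub s t u : s <= t -> ift (chi t) u - ift (chi s) u = ift (ivl s t) u.
Proof.
move=> st; have := iftD (-1) u (cinteg_chi t) (cinteg_chi s); rewrite mulN1r => <-.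
by congr ift; apply/funext => x; rewrite mulN1r chi_sub.
Qed.

(** Up to sign the difference is the indicator of one interval. Norms of differences are what
    polarization consumes. *)
Lemma n2_ift_chi_sub s t : n2 leb1 (fun u => ift (chi t) u - ift (chi s) u) =
  kappa * n2 leb1 (fun x => chi t x - chi s x).
Proof.
wlog st : s t / s <= t.
  move=> H; have [|ts] := leP s t; first exact: H.
  have F (f g : R -> R[i]) : n2 leb1 (fun x => f x - g x) = n2 leb1 (fun x => g x - f x).
    by congr fine; apply: eq_integral => x _; rewrite -csqN opprB.
  by rewrite F (F (chi t)) H// ltW.
have -> : (fun u => ift (chi t) u - ift (chi s) u) = ift (ivl s t).
  by apply/funext => u; rewrite ift_chi_sub.
have -> : (fun x => chi t x - chi s x) = ivl s t.
  by apply/funext => x; rewrite chi_sub.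
by rewrite n2_ift_ivl// n2_ivl.
Qed.

Lemma n2_ift_chi t : n2 leb1 (ift (chi t)) = kappa * n2 leb1 (chi t).
Proof.
have := n2_ift_chi_sub 0 t.
have c0 x : chi 0 x = 0 by rewrite chiE subrr.
have -> : (fun u => ift (chi t) u - ift (chi 0) u) = ift (chi t).
  by apply/funext => u; rewrite (ift0 u c0) subr0.
by have -> : (fun u => chi t u - chi 0 u) = chi t by apply/funext => u; rewrite c0 subr0.
Qed.

Lemma cip_ift_chi s t : cip leb1 (ift (chi s)) (ift (chi t)) =
  cR kappa * cip leb1 (chi s) (chi t).
Proof.
have [a1 a2] := (isL2_ift_chi s, isL2_ift_chi t).
have [b1 b2] := (isL2_chi s, isL2_chi t).
have := cip_ift_real (conj_chi s) (conj_chi t) (cinteg_chi s) (cinteg_chi t) a1 a2.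
have : cip leb1 (chi s) (chi t) = conjc (cip leb1 (chi s) (chi t)).
  rewrite /cip -cint_conj; last exact: cinteg_cip.
  by congr cint; apply/funext => x; rewrite conjcM !conj_chi.
move=> /(congr1 (@complex.Im R)); rewrite Im_conj.
have := n2_ift_chi_sub t s; rewrite (n2B a1 a2) (n2B b1 b2) !n2_ift_chi.
move: (cip _ _ _) (cip _ _ _) (n2 _ _) (n2 _ _) => X Y a b h hY hX.
by apply: ceq; rewrite !ReImE; nra.
Qed.

End InverseFourier.

(** * Plancherel for functions of bounded support, and density of the range *)

Section Plancherel.
Context {R : realType}.
Implicit Types (f g G H : R -> R[i]) (a b s t u x M : R).

Lemma subspace_ivl (V : (R -> R[i]) -> Prop) f : closed_subspace leb1 V ->
  (forall a b, a <= b -> V (ivl a b)) -> isL2 leb1 f -> V f.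
Proof.
move=> cV Vivl.
have V1 B : R.-ocitv.-measurable B -> V (fun x => cR (\1_B x)).
  move=> [[a b] _ <-] /=; have [ab|ba] := leP a b; first exact: Vivl.
  have := subspace0 cV; congr V; apply/funext => x.
  by rewrite -[LHS](ivl_gt x (ltW ba)).
move=> mf; apply: (subspace_full cV (G := @ocitv R) (A := fun n => `]- n%:R, n%:R]%classic) _ _ _ _ _ _ _ _ mf) => //.
- exact: ocitvI.
- by move=> n; exact: leb1_ivl.
- move=> n x /=; rewrite !in_itv /= -[n.+1]addn1 natrD => /andP[h1 h2].
  by apply/andP; split; lra.
- move=> x; exists (Num.trunc `|x|).+1 => /=; rewrite in_itv /=.
  have := truncnS_gt `|x|; rewrite ltr_norml => /andP[-> /ltW ->] //.
- by move=> n; apply: V1; exact: is_ocitv.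
- by move=> B n oB; apply: V1; apply: ocitvI => //; exact: is_ocitv.
Qed.

Lemma clspan_chi f : isL2 leb1 f -> clspan leb1 chi f.
Proof.
move=> mf; have cs := clspan_subspace (@isL2_chi R).
refine (subspace_ivl cs _ mf) => a b ab.
have := subspace_lin cs (-1) (clspan_gen (@isL2_chi R) b) (clspan_gen (@isL2_chi R) a).
by congr clspan; apply/funext => x; rewrite mulN1r chi_sub.
Qed.

(** In the form of an equation, bounded support can be used by rewriting G into its cut and back. *)
Definition supported M G := forall x, G x = ivl (- M) M x * G x.

Lemma supported_cinteg M G : supported M G -> isL2 leb1 G -> cinteg leb1 G.
Proof.
move=> sG mG; have := cinteg_mul (isL2_ivl (- M) M) mG.
by congr cinteg; apply/funext => x; rewrite -sG.
Qed.

Lemma isL2_cut M G : isL2 leb1 G -> isL2 leb1 (fun x => ivl (- M) M x * G x).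
Proof.
by move=> mG; apply: (isL2Mbdd _ mG (csq_ivl _ _)); exact: isL2_meas (isL2_ivl _ _).
Qed.

(** Cutting clamps the endpoint t to [-M, M], so the cut generators belong to the same family, for
    which Plancherel is known. *)
Let cut_chi M t : 0 <= M ->
  (fun x => ivl (- M) M x * chi t x) = chi (Num.max (- M) (Num.min t M)).
Proof.
move=> M0; apply/funext => x; rewrite ivlE !chiE -cRM le_max le_min; congr cR.
rewrite ltNge.
have : (x <= - M) ==> (x <= 0) by apply/implyP; lra.
have : (x <= 0) ==> (x <= M) by apply/implyP; lra.
by case: (x <= - M); case: (x <= M); case: (x <= 0); case: (x <= t) => //= _ _; lra.
Qed.

(** Cauchy-Schwarz against the character restricted to ]-M, M], whose squared norm is at most
    [2 * M]. *)
Lemma csq_ift_cut_le M G u : 0 <= M -> isL2 leb1 G ->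
  csq (ift (fun x => ivl (- M) M x * G x) u) <= (2 * M) * n2 leb1 G.
Proof.
move=> M0 mG.
have me : isL2 leb1 (fun x => expi (2 * pi * - u * x) * ivl (- M) M x).
  apply: (isL2Mbdd (cmeas_char (- u)) (isL2_ivl _ _) (C := 1)) => x.
  by rewrite csq_expi.
have := cip_CauchySchwarz mG me.
have -> : cip leb1 G (fun x => expi (2 * pi * - u * x) * ivl (- M) M x) =
   ift (fun x => ivl (- M) M x * G x) u.
  congr cint; apply/funext => x; rewrite conjcM conj_ivl conjc_expi.
  by have -> : - (2 * pi * - u * x) = 2 * pi * u * x; ring.
move=> /le_trans; apply; rewrite mulrC ler_wpM2r ?n2_ge0//.
have := le_n2 me (isL2_ivl (- M) M) ler01.
rewrite n2_ivl; last lra.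
move=> H; apply: (le_trans (H _)); last lra.
by move=> x; rewrite csqM csq_expi.
Qed.

(* Cutting to ]-M, M] makes G integrable and [ift] pointwise continuous for the
   L^2 norm, as the extension lemmas require. *)
Lemma ift_plancherel_cut M G H : 0 <= M -> isL2 leb1 G -> isL2 leb1 H ->
  let L F := ift (fun x => ivl (- M) M x * F x) in
  isL2 leb1 (L G) /\
  cip leb1 (L G) (L H) =
  cR kappa * cip leb1 (fun x => ivl (- M) M x * G x) (fun x => ivl (- M) M x * H x).
Proof.
move=> M0 mG mH L.
pose phi t x := ivl (- M) M x * chi t x.
have phi2 t : isL2 leb1 (phi t) by exact/isL2_cut/isL2_chi.
have cut2 F x : ivl (- M) M x * (ivl (- M) M x * F x) = ivl (- M) M x * F x.
  by rewrite mulrA ivlM.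
have Lphi t : L (phi t) = ift (chi (Num.max (- M) (Num.min t M))).
  by rewrite -cut_chi// /L; congr ift; apply/funext => x; rewrite cut2.
have Lcut F : L (fun x => ivl (- M) M x * F x) = L F.
  by rewrite /L; congr ift; apply/funext => x; rewrite cut2.
have cs := clspan_subspace phi2.
have sp F : isL2 leb1 F -> clspan leb1 phi (fun x => ivl (- M) M x * F x).
  move=> mF.
  suff [] : isL2 leb1 F /\ clspan leb1 phi (fun x => ivl (- M) M x * F x) by [].
  (* The F whose cut lies in the span form a closed subspace, because cutting does not increase the
     norm. *)
  apply: (@subspace_ivl (fun F => isL2 leb1 F /\ clspan leb1 phi (fun x => ivl (- M) M x * F x))) => //.
    split.
    - by move=> ? [].
    - split; first exact: isL2_0.
      by have := subspace0 cs; congr clspan; apply/funext => x; rewrite mulr0.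
    - move=> c F1 F2 [m1 c1] [m2 c2]; split; first by apply: isL2D => //; exact: isL2Z.
      by have := subspace_lin cs c c1 c2; congr clspan; apply/funext => x; ring.
    - move=> F1 m1 h; split => //; apply: (subspace_closed cs); first exact: isL2_cut.
      move=> e e0; have [F2 [m2 c2] d] := h e e0; exists (fun x => ivl (- M) M x * F2 x) => //.
      apply: le_lt_trans d.
      have := le_n2 (isL2B (isL2_cut M m1) (isL2_cut M m2)) (isL2B m1 m2) ler01.
      rewrite mul1r; apply => x; rewrite mul1r -mulrBr csqM.
      by rewrite ler_piMl ?csq_ge0// csq_ivl.
  move=> a b ab; split; first exact: isL2_ivl.
  have := subspace_lin cs (-1) (clspan_gen phi2 b) (clspan_gen phi2 a).
  by congr clspan; apply/funext => x; rewrite -(chi_sub x ab) /phi; ring.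
have Llin c F1 F2 p : isL2 leb1 F1 -> isL2 leb1 F2 ->
    L (fun x => F1 x + c * F2 x) p = L F1 p + c * L F2 p.
  move=> m1 m2; have i1 := cinteg_mul (isL2_ivl (- M) M) m1.
  have i2 := cinteg_mul (isL2_ivl (- M) M) m2.
  by rewrite /L -iftD//; congr ift; apply/funext => x; ring.
have Lcont p : exists C, forall F, isL2 leb1 F -> csq (L F p) <= C * n2 leb1 F.
  by exists (2 * M) => F mF; exact: csq_ift_cut_le.
have Lmeas F : isL2 leb1 F -> cmeas1 (L F).
  by move=> mF; apply: cmeas_ift; exact: isL2_meas (isL2_cut M mF).
have Lphi2 t : isL2 leb1 (L (phi t)) by rewrite Lphi; exact: isL2_ift_chi.
have Liso s t : cip leb1 (L (phi s)) (L (phi t)) = cR kappa * cip leb1 (phi s) (phi t).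
  by rewrite !Lphi cip_ift_chi /phi !cut_chi.
have k0 : 0 <= kappa := ltW (kappa_gt0 (R := R)).
split.
  by have := extension_isL2 (T' := measurableTypeR R) phi2 k0 Llin Lcont Lmeas Lphi2 Liso (sp _ mG); rewrite Lcut.
have := extension_isometry (T' := measurableTypeR R) phi2 k0 Llin Lcont Lmeas Lphi2 Liso (sp _ mG) (sp _ mH).
by rewrite !Lcut.
Qed.

Lemma ift_plancherel M G H : 0 <= M -> supported M G -> supported M H ->
  isL2 leb1 G -> isL2 leb1 H ->
  isL2 leb1 (ift G) /\ cip leb1 (ift G) (ift H) = cR kappa * cip leb1 G H.
Proof.
move=> M0 sG sH mG mH; have := ift_plancherel_cut M0 mG mH => /=.
by move: sG sH => /funext <- /funext <-.
Qed.

Lemma measurable_phase :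
  measurable_fun (setT : set (measurableTypeR R * measurableTypeR R)%type)
    (fun z => 2 * pi * z.1 * z.2 : R).
Proof. by apply: measurable_funM => //; exact: measurable_funM. Qed.

(** Fubini, the kernel being unimodular. Conjugation of the kernel is what produces the reflection
    of the argument. *)
Lemma ift_adjoint F G : cinteg leb1 F -> cinteg leb1 G ->
  cint leb1 setT (fun x => F x * conjc (ift G x)) =
  cint leb1 setT (fun x => ift F (- x) * conjc (G x)).
Proof.
move=> mF mG.
have mk : cmeas2 (fun z : R * R => expi (- (2 * pi * z.1 * z.2))).
  by apply: cmeas_expi; apply: (measurable_funN measurable_phase).
have I : cinteg leb2 (fun z => expi (- (2 * pi * z.1 * z.2)) * tens F (fun x => conjc (G x)) z).
  apply: (cintegM_bdd (cinteg_tens mF (cinteg_conj mG)) mk (C := 1)) => z.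
  by rewrite csq_expi.
transitivity (cint leb2 setT (fun z => expi (- (2 * pi * z.1 * z.2)) * tens F (fun x => conjc (G x)) z)).
  rewrite (cint12 I); congr cint; apply/funext => x.
  have i2 := cinteg_conj (cinteg_ift x mG).
  rewrite -cint_conj; last exact: cinteg_ift.
  rewrite -cintZ//; congr cint; apply/funext => y.
  by rewrite /tens /= conjcM conjc_expi; ring.
rewrite (cint21 I); congr cint; apply/funext => y.
rewrite -cintZr; last exact: cinteg_ift.
congr cint; apply/funext => x; rewrite /tens /=.
by have -> : 2 * pi * - y * x = - (2 * pi * x * y); ring.
Qed.

Lemma cinteg_lincomb_chi (s : seq (R[i] * R)) :
  cinteg leb1 (lincomb (T := measurableTypeR R) chi s).
Proof.
elim: s => [|[c t] r IH].
  rewrite lincomb_nil; have := cintegZ 0 (cinteg_chi (0 : R)).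
  by congr cinteg; apply/funext => x; rewrite mul0r.
by rewrite lincomb_cons; apply: cintegD => //; apply: cintegZ; exact: cinteg_chi.
Qed.

Lemma ift_lincomb (s : seq (R[i] * R)) u :
  ift (lincomb (T := measurableTypeR R) chi s) u =
  lincomb (T := measurableTypeR R) (fun t => ift (chi t)) s u.
Proof.
elim: s => [|[c t] s IH]; first by rewrite !lincomb_nil; exact: ift0.
by rewrite !lincomb_cons iftD ?IH//; [exact: cinteg_lincomb_chi|exact: cinteg_chi].
Qed.

(* With J = ]a, b] and b_J(x) = ift 1_J (-x), adjointness and Plancherel give
   n2 (1_J - ift S) = kappa * n2 (kappa^-1 b_J - S) for every step function S, so
   density of the step functions in the domain yields density of the range. *)
Lemma clspan_ift_chi f : isL2 leb1 f -> clspan leb1 (fun t => ift (chi t)) f.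
Proof.
move=> mf; have cs := clspan_subspace (@isL2_ift_chi R).
refine (subspace_ivl cs _ mf) => a b ab; split; first exact: isL2_ivl.
move=> e e0.
have k0 := kappa_gt0 (R := R).
have m1 : (-1 : R) != 0 by rewrite oppr_eq0 oner_eq0.
pose bJ x := ift (ivl a b) (- x).
have mb : isL2 leb1 bJ.
  have := isL2_aff 0 m1 (isL2_ift_ivl a b); congr isL2.
  by apply/funext => x; rewrite mulN1r addr0.
have nb : n2 leb1 bJ = kappa * (b - a).
  have := n2_aff 0 m1 (isL2_ift_ivl a b); rewrite n2_ift_ivl// normrN1 mul1r => ->.
  by congr n2; apply/funext => x; rewrite mulN1r addr0.
have [s hs] := (clspan_chi (isL2Z (cR kappa^-1) mb)).2 (e / kappa) (divr_gt0 e0 k0).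
exists s.
move: hs; set S := lincomb (T := measurableTypeR R) chi s.
have mS : isL2 leb1 S := isL2_lincomb (@isL2_chi R) s.
have mLS : isL2 leb1 (lincomb (T := measurableTypeR R) (fun t => ift (chi t)) s) := isL2_lincomb (@isL2_ift_chi R) s.
have nS : n2 leb1 (lincomb (T := measurableTypeR R) (fun t => ift (chi t)) s) = kappa * n2 leb1 S.
  exact: (n2_lincomb_isometry s (@isL2_chi R) (@isL2_ift_chi R) (@cip_ift_chi R)).
have cS : cip leb1 (ivl a b) (lincomb (T := measurableTypeR R) (fun t => ift (chi t)) s) = cip leb1 bJ S.
  have iS : cinteg leb1 S.
    exact: cinteg_lincomb_chi.
  rewrite /cip /bJ -(ift_adjoint (cinteg_ivl a b) iS); congr cint.
  by apply/funext => x; rewrite ift_lincomb.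
rewrite (n2B (isL2Z _ mb) mS) (n2B (isL2_ivl a b) mLS) nS cS n2Z// cipZl// nb n2_ivl//.
rewrite csq_cR ReM Re_cR Im_cR mul0r subr0 ltr_pdivlMr//.
congr (_ < _); field; exact: lt0r_neq0.
Qed.

End Plancherel.

Section AeTools.
Context {R : realType}.

Lemma measurable_inv : measurable_fun setT (fun x : R => x^-1).
Proof.
have -> : [set: R] = [set x | x != 0] `|` [set 0].
  by apply/seteqP; split => x //= _; case: (eqVneq x 0) => h; [right|left].
have o : open [set x : R | x != 0] by exact: open_neq.
apply/measurable_funU; [exact: open_measurable|exact: measurable_set1|split].
  by apply: open_continuous_measurable_fun => // x; rewrite inE /= => x0; exact: inv_continuous.
exact: measurable_fun_set1.
Qed.

Lemma cint_ae (d : measure_display) (T : measurableType d) (m : {measure set T -> \bar R})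
    (f g : T -> R[i]) : cmeas f -> cmeas g -> {ae m, forall x, f x = g x} ->
  cint m setT f = cint m setT g.
Proof.
move=> [fr fi] [gr gi] fg.
have key (p : R[i] -> R) : measurable_fun setT (p \o f) -> measurable_fun setT (p \o g) ->
    Rintegral m setT (p \o f) = Rintegral m setT (p \o g).
  move=> mf mg; congr fine; apply: ae_eq_integral => //; do ?exact/measurable_EFinP.
  by apply: filterS fg => x /= -> _.
by apply: ceq; [exact: key|exact: key].
Qed.

Lemma ae_isL2_section2 (d1 d2 : measure_display) (T1 : measurableType d1) (T2 : measurableType d2)
    (m1 : {sigma_finite_measure set T1 -> \bar R}) (m2 : {sigma_finite_measure set T2 -> \bar R})
    (F : T1 * T2 -> R[i]) : isL2 (m1 \x m2)%E F ->
  {ae m2, forall y, isL2 m1 (fun x => F (x, y))}.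
Proof.
move=> [mF iF]; apply: filterS (ae_integrable2 iF) => x ix; split => //.
exact: cmeas_section2.
Qed.

Lemma ae_cinteg_section2 (d1 d2 : measure_display) (T1 : measurableType d1) (T2 : measurableType d2)
    (m1 : {sigma_finite_measure set T1 -> \bar R}) (m2 : {sigma_finite_measure set T2 -> \bar R})
    (F : T1 * T2 -> R[i]) : cinteg (m1 \x m2)%E F ->
  {ae m2, forall y, cinteg m1 (fun x => F (x, y))}.
Proof.
move=> [ir ii]; apply: filterS2 (ae_integrable2 ir) (ae_integrable2 ii) => x h1 h2.
by split.
Qed.

Lemma leb1_ae_neq0 : {ae (@leb1 R), forall x : measurableTypeR R, (x : R) != 0}.
Proof.
exists [set 0]; split; [exact: measurable_set1|exact: lebesgue_measure_set1|].
by move=> x /= /negP; rewrite negbK => /eqP.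
Qed.

End AeTools.

Section Change2.
Context {R : realType}.
Implicit Types F : R * R -> R[i].

Lemma measurable_aff2 (a b : R) : measurable_fun (setT : set (measurableTypeR R * measurableTypeR R)%type)
   ((fun z => (a * z.1 + b, z.2)) : (measurableTypeR R * measurableTypeR R)%type -> (measurableTypeR R * measurableTypeR R)%type).
Proof.
apply: measurable_fun_pair => //; apply: measurable_funD => //; exact: measurable_funM.
Qed.

Lemma cmeas_aff2 (a b : R) F : cmeas2 F -> cmeas2 (fun z => F (a * z.1 + b, z.2)).
Proof. by move=> mF; exact: (cmeas_comp mF (measurable_aff2 a b)). Qed.

Lemma N2_aff2 (a b : R) F : a != 0 -> cmeas2 F ->
  (N2 leb2 F = (`|a|%R)%:E * N2 leb2 (fun z => F (a * z.1 + b, z.2)%R))%E.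
Proof.
move=> a0 mF.
rewrite (N2_21 leb1 leb1 mF) (N2_21 leb1 leb1 (cmeas_aff2 a b mF)).
rewrite -ge0_integralZl//; last 2 first.
- exact: (measurable_N2_21 leb1 (cmeas_aff2 a b mF)).
- by move=> y _; exact: N2_ge0.
apply: eq_integral => y _ /=.
by rewrite (N2_aff b a0)//; exact: (cmeas_section2 y mF).
Qed.

Lemma isL2_aff2 (a b : R) F : a != 0 -> isL2 leb2 F -> isL2 leb2 (fun z => F (a * z.1 + b, z.2)).
Proof.
move=> a0 /isL2P[mf foo]; apply/isL2P; split; first exact: cmeas_aff2.
move: foo; rewrite (N2_aff2 b a0 mf); have := N2_ge0 leb2 (fun z => F (a * z.1 + b, z.2)).
case: (N2 _ _) => [r||]//; rewrite ?ltry// gt0_muley// lte_fin normr_gt0//.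
Qed.

Lemma cint_aff2 (a b : R) F : a != 0 -> cinteg leb2 F -> cinteg leb2 (fun z => F (a * z.1 + b, z.2)) ->
  cint leb2 setT F = cR `|a| * cint leb2 setT (fun z => F (a * z.1 + b, z.2)).
Proof.
move=> a0 cF cFa; rewrite (cint21 cF) (cint21 cFa).
rewrite -cintZ; last exact: (cinteg21 cFa).
apply: cint_ae.
- exact: (cinteg_meas (cinteg21 cF)).
- apply: cmeasM; first exact: cmeas_cst.
  exact: (cinteg_meas (cinteg21 cFa)).
- by apply: filterS (ae_cinteg_section2 cF) => y cy; rewrite (cint_aff b a0 cy).
Qed.

End Change2.

(** * The wavelet transform on the Fourier side *)

Section Leb2SigmaFinite.
Context {R : realType}.
Notation RR := (measurableTypeR R).

Lemma leb2_sigma_finite : sigma_finite (setT : set (RR * RR)%type) (@leb2 R).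
Proof.
pose A (n : nat) : set R := `]- n%:R, n%:R]%classic.
have Afin n : (@leb1 R (A n) < +oo)%E by exact: leb1_ivl.
have mA n : measurable (A n : set RR) by exact: measurable_itv.
exists (fun n => A n `*` A n).
  apply/seteqP; split => // -[x y] _; exists (Num.trunc (Num.max `|x| `|y|)).+1 => //.
  have := truncnS_gt (Num.max `|x| `|y|); rewrite gt_max !ltr_norml.
  move=> /andP[/andP[x1 x2] /andP[y1 y2]]; split => /=; rewrite /A /= in_itv /=.
    by rewrite x1 ltW.
  by rewrite y1 ltW.
move=> n; split; first exact: measurableX.
have -> : (@leb2 R (A n `*` A n) = @leb1 R (A n) * @leb1 R (A n))%E.
  exact: product_measure1E.
by rewrite lte_mul_pinfty// ge0_fin_numE.
Qed.

(* On product types the library infers for [leb1 \x leb1] a structure meant for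
   products of probabilities, so the sigma-finite one is packed by hand. *)
Definition leb2s : {sigma_finite_measure set (RR * RR)%type -> \bar R} :=
  HB.pack (@product_measure1 _ _ RR RR R (@leb1 R) (@leb1 R)) (Measure_isSigmaFinite.Build _ _ _ (@leb1 R \x @leb1 R)%E leb2_sigma_finite).

End Leb2SigmaFinite.

Section Wavelet.
Context {R : realType}.
Implicit Types (f g psi K : R * R -> R[i]) (G h k : R -> R[i]) (u s t x : R).

Lemma cmeas_psi_us psi u s : cmeas2 psi -> cmeas2 (psi_us psi u s).
Proof.
move=> mp; apply: cmeasM; first exact: cmeas_cst.
have := cmeas_aff2 (s^-1) (- u / s) mp; congr cmeas; apply/funext => z.
congr (psi (_, _)); ring.
Qed.

(** The factor [s^(-1/2)] compensates the Jacobian of the dilation, so an L^2 error on psi has the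
    same size for all u and s > 0. *)
Lemma N2_psi_us psi u s : 0 < s -> cmeas2 psi -> N2 leb2 (psi_us psi u s) = N2 leb2 psi.
Proof.
move=> s0 mp; have si0 : s^-1 != 0 by rewrite invr_eq0 gt_eqF.
have ma := cmeas_aff2 (s^-1) (- u / s) mp.
rewrite (N2_aff2 (- u / s) si0 mp) gtr0_norm ?invr_gt0//.
rewrite /N2 -ge0_integralZl//; last 3 first.
- by apply/measurable_EFinP; exact: measurable_csq.
- by move=> z _; rewrite lee_fin csq_ge0.
- by rewrite lee_fin invr_ge0 ltW.
apply: eq_integral => z _; rewrite -EFinM /psi_us csqM csq_cR exprVn sqr_sqrtr ?ltW//.
congr (_ * csq (psi (_, _)))%:E; ring.
Qed.

Lemma isL2_psi_us psi u s : 0 < s -> isL2 leb2 psi -> isL2 leb2 (psi_us psi u s).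
Proof.
move=> s0 /isL2P[mp po]; apply/isL2P; split; first exact: cmeas_psi_us.
by rewrite N2_psi_us.
Qed.

Lemma n2_psi_us psi u s : 0 < s -> isL2 leb2 psi -> n2 leb2 (psi_us psi u s) = n2 leb2 psi.
Proof. by move=> s0 [mp _]; rewrite /n2 N2_psi_us. Qed.

(** The integrand is jointly measurable in (u, s) and the space variables. Parameters s <= 0 are
    included, with the default values of [Num.sqrt] and of the inverse; [WT] later annihilates
    them. *)
Lemma cmeas_wavelet psi f : cmeas2 psi -> cmeas2 f ->
  cmeas2 (fun p => cip leb2 f (psi_us psi p.1 p.2)).
Proof.
move=> mp mf.
pose RR := measurableTypeR R.
suff H : cmeas (T := ((RR * RR) * (RR * RR))%type)
    (fun w : (R * R) * (R * R) => f w.2 * conjc (psi_us psi w.1.1 w.1.2 w.2)).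
  exact: (cmeas_cint12 leb2s H).
apply: cmeasM; first exact: (cmeas_comp mf measurable_snd).
apply: cmeas_conj; apply: cmeasM.
  apply: cmeas_cR; apply: (measurableT_comp measurable_inv).
  apply: measurableT_comp; first by apply: continuous_measurable_fun; exact: sqrt_continuous.
  exact: (measurableT_comp measurable_snd measurable_fst).
have m11 : measurable_fun (setT : set ((RR * RR) * (RR * RR))%type) (fun w => w.1.1).
  exact: (measurableT_comp measurable_fst measurable_fst).
have m12 : measurable_fun (setT : set ((RR * RR) * (RR * RR))%type) (fun w => w.1.2).
  exact: (measurableT_comp measurable_snd measurable_fst).
have m21 : measurable_fun (setT : set ((RR * RR) * (RR * RR))%type) (fun w => w.2.1).
  exact: (measurableT_comp measurable_fst measurable_snd).
have m22 : measurable_fun (setT : set ((RR * RR) * (RR * RR))%type) (fun w => w.2.2).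
  exact: (measurableT_comp measurable_snd measurable_snd).
apply: (cmeas_comp mp); apply: measurable_fun_pair => //.
apply: measurable_funM; first exact: measurable_funB.
exact: (measurableT_comp measurable_inv m12).
Qed.

(** Both maps of the theorem are read off from this one function on the whole line, the sign
    choosing the half-line. *)
Definition Tf K h : R -> R[i] := fun x => cint leb1 setT (fun y => conjc (K (x, y)) * h y).

Lemma TmapE K sgn h s : Tmap K sgn h s = Tf K h (sgn * s).
Proof. by []. Qed.

Lemma cmeas_Tf K h : cmeas2 K -> cmeas1 h -> cmeas1 (Tf K h).
Proof.
move=> mK mh.
apply: (cmeas_cint12 leb1 (F := fun z : R * R => conjc (K z) * h z.2)).
by apply: cmeasM; [exact: cmeas_conj|exact: (cmeas_comp mh measurable_snd)].
Qed.

(** For almost every x the difference is the inner product of h with a section of K - K'; apply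
    Cauchy-Schwarz in y and integrate in x. It expresses continuity in K and, with K' = 0, square
    integrability. *)
Lemma Tf_diff_le K K' h : isL2 leb2 K -> isL2 leb2 K' -> isL2 leb1 h ->
  (N2 leb1 (fun x => Tf K h x - Tf K' h x)%R <=
   (n2 leb1 h)%:E * N2 leb2 (fun z => K z - K' z)%R)%E.
Proof.
move=> mK mK' mh; have mD := isL2B mK mK'.
rewrite (N2_12 leb1 leb1 (isL2_meas mD)) -ge0_integralZl//; last 3 first.
- exact: (measurable_N2_12 leb1 (isL2_meas mD)).
- by move=> x _; exact: N2_ge0.
- by rewrite lee_fin n2_ge0.
apply: ae_ge0_le_integral => //.
- by move=> x _; rewrite lee_fin csq_ge0.
- apply/measurable_EFinP; apply: measurable_csq; apply: cmeasB; apply: cmeas_Tf;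
  by [exact: isL2_meas mK|exact: isL2_meas mK'|exact: isL2_meas mh].
- by move=> x _; rewrite mule_ge0 ?N2_ge0// lee_fin n2_ge0.
- by apply: measurable_funeM; exact: (measurable_N2_12 leb1 (isL2_meas mD)).
apply: filterS2 (ae_isL2_section1 mK) (ae_isL2_section1 mK') => x h1 h2 _.
have h3 := isL2B h1 h2.
rewrite -n2E// -EFinM lee_fin.
have -> : Tf K h x - Tf K' h x = cip leb1 h (fun y => K (x, y) - K' (x, y)).
  rewrite /Tf -cintB; last 2 first.
  - by apply: cinteg_mul => //; exact: isL2_conj.
  - by apply: cinteg_mul => //; exact: isL2_conj.
  by congr cint; apply/funext => y; rewrite conjcB; ring.
exact: cip_CauchySchwarz.
Qed.

Lemma isL2_Tf K h : isL2 leb2 K -> isL2 leb1 h -> isL2 leb1 (Tf K h).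
Proof.
move=> mK mh; apply/isL2P; split.
  by apply: cmeas_Tf; [exact: isL2_meas mK|exact: isL2_meas mh].
have := Tf_diff_le mK (isL2_0 _) mh.
have -> : (fun x => Tf K h x - Tf (fun=> 0) h x) = Tf K h.
  apply/funext => x; rewrite [X in _ - X](_ : _ = 0) ?subr0//.
  rewrite /Tf -[RHS](cint0 leb1); congr cint; apply/funext => y.
  by apply: ceq; rewrite !ReImE; ring.
have -> : (fun z => K z - 0) = K by apply/funext => z; rewrite subr0.
by move=> /le_lt_trans; apply; rewrite -n2E// -EFinM ltry.
Qed.

End Wavelet.

(** * The wavelet coefficient as an inverse Fourier transform *)

Section Truncation.
Context {R : realType}.
Notation RR := (measurableTypeR R).
Implicit Types (f g psi K : R * R -> R[i]) (G h k : R -> R[i]) (u s t x N M C : R).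

Definition trunc psi N : R * R -> R[i] := fun z => cR (\1_(`[- N, N]%classic : set R) z.1) * psi z.

Lemma measurable_itvN N : measurable (`[- N, N]%classic : set RR).
Proof. exact: measurable_itv. Qed.

Lemma cmeas_trunc psi N : cmeas2 psi -> cmeas2 (trunc psi N).
Proof.
move=> mp; apply: cmeasM => //.
exact: (cmeas_comp (cmeas_indic (measurable_itvN N)) measurable_fst).
Qed.

Lemma csq_indic_le (T : Type) (A : set T) (x : T) : csq (cR (\1_A x : R)) <= 1.
Proof. by rewrite csq_cR indicE; case: (_ \in _); rewrite ?expr1n ?expr0n. Qed.

Lemma isL2_trunc psi N : isL2 leb2 psi -> isL2 leb2 (trunc psi N).
Proof.
move=> mp; apply: (isL2_le _ mp ler01); first exact/cmeas_trunc/(isL2_meas mp).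
by move=> z; rewrite csqM ler_wpM2r ?csq_ge0// csq_indic_le.
Qed.

Lemma cvg_trunc psi (e : R) : isL2 leb2 psi -> 0 < e ->
  \forall n \near \oo, n2 leb2 (fun z => psi z - trunc psi n%:R z) < e.
Proof.
move=> mp e0.
have := @n2_dominated R _ (RR * RR)%type leb2 (fun n z => psi z - trunc psi n%:R z) psi mp.
have h1 n : cmeas2 (fun z => psi z - trunc psi n%:R z).
  by apply: cmeasB; [exact: isL2_meas mp|exact/cmeas_trunc/(isL2_meas mp)].
move=> /(_ h1) {}h1.
have h2 (n : nat) (z : R * R) : csq (psi z - trunc psi n%:R z) <= csq (psi z).
  rewrite /trunc indicE; case: (_ \in _); rewrite ?mul1r ?subrr ?csq0 ?csq_ge0//.
  by rewrite cR0 mul0r subr0.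
have h3 (z : R * R) : csq (psi z - trunc psi n%:R z) @[n --> \oo] --> (0 : R).
  apply: cvg_near_cst.
  exists (Num.trunc `|z.1|).+1 => // n /= hn.
  rewrite /trunc indicE mem_set ?mul1r ?subrr ?csq0// /= in_itv /=.
  have := truncnS_gt `|z.1|; have : (Num.trunc `|z.1|).+1%:R <= n%:R :> R by rewrite ler_nat.
  by move=> h4 h5; rewrite -ler_norml ltW// (lt_le_trans h5).
have /cvgrPdist_lt/(_ e e0) := h1 h2 h3.
by apply: filterS => n /=; rewrite sub0r normrN ger0_norm ?n2_ge0.
Qed.

Lemma pft_truncE psi N z : pft_trunc psi N z =
  cint leb1 setT (fun x => trunc psi N (x, z.2) * expi (- (2 * pi * x * z.1))).
Proof.
by rewrite /pft_trunc cint_mkcond; congr cint; apply/funext => x; rewrite mulrA.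
Qed.

Lemma cmeas_pft_trunc psi N : cmeas2 psi -> cmeas2 (pft_trunc psi N).
Proof.
move=> mp.
have -> : pft_trunc psi N = fun z => cint leb1 setT (fun x => trunc psi N (x, z.2) * expi (- (2 * pi * x * z.1))).
  by apply/funext => z; exact: pft_truncE.
suff H : cmeas (T := ((RR * RR) * RR)%type)
    (fun w : (R * R) * R => trunc psi N (w.2, w.1.2) * expi (- (2 * pi * w.2 * w.1.1))).
  exact: (cmeas_cint12 leb1 H).
have m11 : measurable_fun (setT : set ((RR * RR) * RR)%type) (fun w => w.1.1).
  exact: (measurableT_comp measurable_fst measurable_fst).
have m12 : measurable_fun (setT : set ((RR * RR) * RR)%type) (fun w => w.1.2).
  exact: (measurableT_comp measurable_snd measurable_fst).
apply: cmeasM.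
  apply: (cmeas_comp (cmeas_trunc N mp)); exact: measurable_fun_pair.
apply: cmeas_expi; apply: (measurable_funN (f := fun w : (RR * RR) * RR => 2 * pi * w.2 * w.1.1)).
by apply: measurable_funM => //; exact: measurable_funM.
Qed.

Lemma isL2_indicN N : isL2 leb1 (fun x => cR (\1_(`[- N, N]%classic : set R) x)).
Proof.
pose A : set R := `[- N, N]%classic.
have h : (leb1 A < +oo)%E.
  by rewrite /A /leb1 lebesgue_measure_itv /=; case: ifP => _; rewrite ?ltry.
by apply: isL2_indic h; exact: measurable_itvN.
Qed.

Lemma isL2_tens_trunc h N : isL2 leb1 h ->
  isL2 leb2 (tens (fun x => cR (\1_(`[- N, N]%classic : set R) x)) h).
Proof.
by move=> mh; apply: isL2_tens => //; exact: isL2_indicN.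
Qed.

Lemma cinteg_trunc psi h N : isL2 leb2 psi -> isL2 leb1 h ->
  cinteg leb2 (fun z => conjc (trunc psi N z) * h z.2).
Proof.
move=> mp mh; have := cinteg_mul (isL2_conj mp) (isL2_tens_trunc N mh).
congr cinteg; apply/funext => z; rewrite /tens /trunc conjcM conjc_cR; ring.
Qed.

Lemma cmeas_char2 u : cmeas2 (fun z : R * R => expi (2 * pi * u * z.1)).
Proof. by apply: cmeas_expi; exact: measurable_funM. Qed.

(** Fubini. For almost every y the truncated section is square integrable with bounded support,
    hence integrable, and the inner integral may be conjugated and multiplied by h(y). *)
Lemma Tf_pft_trunc psi h N x : isL2 leb2 psi -> isL2 leb1 h ->
  Tf (pft_trunc psi N) h x =
  cint leb2 setT (fun z => expi (2 * pi * x * z.1) * (conjc (trunc psi N z) * h z.2)).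
Proof.
move=> mp mh; have cP := cinteg_trunc N mp mh.
have I : cinteg leb2 (fun z => expi (2 * pi * x * z.1) * (conjc (trunc psi N z) * h z.2)).
  by apply: (cintegM_bdd cP (cmeas_char2 x) (C := 1)) => z; rewrite csq_expi.
rewrite (cint21 I); apply: cint_ae.
- have mK := cmeas_pft_trunc N (isL2_meas mp).
  by apply: cmeasM; [apply: cmeas_conj; exact: (cmeas_section1 x mK)|exact: isL2_meas mh].
- exact: (cinteg_meas (cinteg21 I)).
apply: filterS (ae_isL2_section2 (isL2_trunc N mp)) => y my.
have cy : cinteg leb1 (fun x => trunc psi N (x, y)).
  have := cinteg_mul (isL2_indicN N) my; congr cinteg; apply/funext => v.
  rewrite /trunc /= mulrA -cRM indicE; case: (_ \in _); rewrite ?mulr1 ?mulr0//.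
have ce : cinteg leb1 (fun v => trunc psi N (v, y) * expi (- (2 * pi * v * x))).
  have := cinteg_ift (- x) cy; congr cinteg; apply/funext => v; congr (_ * expi _); ring.
rewrite pft_truncE -cint_conj// -cintZr; last exact: cinteg_conj.
congr cint; apply/funext => v /=; rewrite conjcM conjc_expi opprK.
have -> : 2 * pi * v * x = 2 * pi * x * v by ring.
by ring.
Qed.

(* With psi truncated in the first variable every integral is absolutely
   convergent and the identity is an application of Fubini. *)
Lemma wavelet_trunc psi G h u s N M : isL2 leb2 psi -> isL2 leb1 h -> 0 < s -> 0 <= M ->
  supported M G -> isL2 leb1 G ->
  cip leb2 (tens (ift G) h) (psi_us (trunc psi N) u s) =
  ift (fun x => cR (Num.sqrt s) * G x * Tf (pft_trunc psi N) h (s * x)) u.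
Proof.
move=> mp mh s0 M0 sG mG.
have mA : isL2 leb1 (ift G) by have [] := ift_plancherel M0 sG sG mG mG.
pose P z := conjc (trunc psi N z) * h z.2.
have cP : cinteg leb2 P := cinteg_trunc N mp mh.
have cG := supported_cinteg sG mG.
(* The coefficient after the substitution x_1 = u + s z_1, with [ift G] written out. Integrating in
   x first recovers [ift G (u + s z_1)]; integrating in z first produces [Tf] at s x. *)
pose I (w : R * (R * R)) := expi (2 * pi * (u + s * w.2.1) * w.1) *
  tens (fun x => cR (Num.sqrt s) * G x) P w.
have cI : cinteg (@leb1 R \x leb2s)%E I.
  apply: (cintegM_bdd (cinteg_tens (m2 := leb2s) (cintegZ _ cG) cP) (C := 1)).
    apply: cmeas_expi; apply: measurable_funM => //; apply: measurable_funM => //.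
    apply: measurable_funD => //; apply: measurable_funM => //.
    exact: (measurableT_comp measurable_fst measurable_snd).
  by move=> w; rewrite csq_expi.
have -> : ift (fun x => cR (Num.sqrt s) * G x * Tf (pft_trunc psi N) h (s * x)) u =
    cint leb1 setT (fun x => cint leb2s setT (fun z => I (x, z))).
  congr cint; apply/funext => x; rewrite Tf_pft_trunc//.
  rewrite mulrAC -cintZ; last first.
    by apply: (cintegM_bdd cP (cmeas_char2 (s * x)) (C := 1)) => z; rewrite csq_expi.
  congr cint; apply/funext => z; rewrite /I /tens /P /=.
  rewrite mulrA mulrAC [RHS]mulrC -[X in _ = _ * X]/(expi (2 * pi * (u + s * z.1) * x)).
  have -> : 2 * pi * (u + s * z.1) * x = 2 * pi * u * x + 2 * pi * (s * x) * z.1 by ring.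
  rewrite expiD; ring.
rewrite -(cint12 cI) (cint21 cI).
have mF1 := isL2_tens mA mh.
have mF2 := isL2_psi_us u s0 (isL2_trunc N mp).
have s1 : s != 0 by rewrite gt_eqF.
rewrite /cip (cint_aff2 (b := u) s1); last 2 first.
- exact: cinteg_cip.
- exact: (cinteg_cip (isL2_aff2 u s1 mF1) (isL2_aff2 u s1 mF2)).
rewrite -cintZ; last exact: (cinteg_cip (isL2_aff2 u s1 mF1) (isL2_aff2 u s1 mF2)).
congr cint; apply/funext => z.
have -> : cint leb1 setT (fun x => I (x, z)) = cR (Num.sqrt s) * P z * ift G (u + s * z.1).
  rewrite -cintZ; last exact: cinteg_ift.
  by congr cint; apply/funext => x; rewrite /I /tens /=; ring.
rewrite /tens /psi_us /P /= conjcM conjc_cR addrK (mulrC s) mulfK//.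
have -> : cR `|s| * (ift G (z.1 * s + u) * h z.2 *
   (cR (Num.sqrt s)^-1 * conjc (trunc psi N (z.1, z.2)))) =
   (cR `|s| * cR (Num.sqrt s)^-1) * (ift G (z.1 * s + u) * h z.2 *
    conjc (trunc psi N (z.1, z.2))) by ring.
(* The Jacobian s times the normalisation [s^(-1/2)]. *)
have -> : cR `|s| * cR (Num.sqrt s)^-1 = cR (Num.sqrt s).
  rewrite -cRM gtr0_norm// -{1}(@sqr_sqrtr _ s) ?ltW// expr2 mulfK//.
  by rewrite gt_eqF// sqrtr_gt0.
rewrite -surjective_pairing (addrC u); ring.
Qed.

Lemma isL2_wavelet_symbol K G h s C : isL2 leb2 K -> isL2 leb1 h -> isL2 leb1 G ->
  (forall x, csq (G x) <= C) -> 0 < s ->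
  isL2 leb1 (fun x => cR (Num.sqrt s) * G x * Tf K h (s * x)).
Proof.
move=> mK mh mG GC s0.
have s1 : s != 0 by rewrite gt_eqF.
apply: (@isL2Mbdd _ _ _ leb1 (fun x => Tf K h (s * x)) _ (s * C)).
- by apply: cmeasM; [exact: cmeas_cst|exact: isL2_meas mG].
- by have := isL2_aff 0 s1 (isL2_Tf mK mh); congr isL2; apply/funext => x; rewrite addr0.
- by move=> x; rewrite csqM csq_cR (sqr_sqrtr (ltW s0)) ler_wpM2l ?(ltW s0).
Qed.

(** Both sides are compared with the coefficient of a truncated psi. The left one moves little by
    Cauchy-Schwarz and the invariance of the norm of [psi_us]; the right one by [Tf_diff_le], since
    on ]-M, M] the values of [ift] are controlled by the L^2 norm. *)
Lemma wavelet_ift psi K G h u s M C : isL2 leb2 psi -> is_partial_FT psi K ->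
  isL2 leb1 h -> 0 < s -> 0 <= M -> supported M G -> isL2 leb1 G ->
  (forall x, csq (G x) <= C) ->
  cip leb2 (tens (ift G) h) (psi_us psi u s) =
  ift (fun x => cR (Num.sqrt s) * G x * Tf K h (s * x)) u.
Proof.
move=> mp [mK cK] mh s0 M0 sG mG GC.
have mA : isL2 leb1 (ift G) by have [] := ift_plancherel M0 sG sG mG mG.
have mF := isL2_tens mA mh.
have C0 : 0 <= C := le_trans (csq_ge0 (G 0)) (GC 0).
have s1 : s != 0 by rewrite gt_eqF.
set X := cip _ _ _; set Y := ift _ _.
apply/eqP; rewrite -subr_eq0; apply/eqP/csq_eq0/eqP; rewrite eq_le csq_ge0 andbT.
apply/ler_addgt0Pr => e e0; rewrite add0r.
(* [c1] and [c2] are the constants of the two comparison errors, doubled by [csqB_le]; the summand 1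
   in [dl] keeps its denominator positive. *)
pose c1 := 2 * n2 leb2 (tens (ift G) h); pose c2 := 4 * M * C * n2 leb1 h.
have c10 : 0 <= c1 by rewrite mulr_ge0// n2_ge0.
have c20 : 0 <= c2 by rewrite !mulr_ge0// n2_ge0.
pose dl := e / (c1 + c2 + 1).
have cp : 0 < c1 + c2 + 1 by rewrite ltr_wpDl// addr_ge0.
have dl0 : 0 < dl by rewrite divr_gt0.
have h1 := cvg_trunc mp dl0.
have h2 : \forall n \near \oo, (N2 leb2 (fun z => K z - pft_trunc psi n%:R z)%R < dl%:E)%E.
  move/fine_cvgP : cK => [fK /cvgrPdist_lt/(_ dl dl0) cK].
  apply: filterS2 fK cK => n /= fn; rewrite sub0r normrN ger0_norm; last first.
    by apply: fine_ge0; exact: (N2_ge0 leb2 (fun z => K z - pft_trunc psi n%:R z)).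
  by rewrite -lte_fin fineK.
have [n [hn1 hn2]] : exists n : nat, n2 leb2 (fun z => psi z - trunc psi n%:R z) < dl /\
   (N2 leb2 (fun z => K z - pft_trunc psi n%:R z)%R < dl%:E)%E.
  have [n _ H] := filterI h1 h2.
  by exists n; exact: H n (leqnn n).
pose Kn := pft_trunc psi n%:R.
have mD : isL2 leb2 (fun z => K z - Kn z).
  apply/isL2P; split; last by apply: (lt_trans hn2); rewrite ltry.
  by apply: cmeasB; [exact: isL2_meas mK|exact/cmeas_pft_trunc/(isL2_meas mp)].
(* Read off from the convergence to K, as K - (K - Kn). *)
have mKn : isL2 leb2 Kn.
  have := isL2B mK mD; congr isL2; apply/funext => z; ring.
have hn3 : n2 leb2 (fun z => K z - Kn z) < dl by rewrite -lte_fin n2E.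
pose Xn := cip leb2 (tens (ift G) h) (psi_us (trunc psi n%:R) u s).
have bX : csq (X - Xn) <= n2 leb2 (tens (ift G) h) * dl.
  have mT := isL2_trunc n%:R mp.
  rewrite /X /Xn -cipBr//; do ?exact: isL2_psi_us.
  have md := isL2B mp mT.
  have -> : (fun z => psi_us psi u s z - psi_us (trunc psi n%:R) u s z) =
     psi_us (fun z => psi z - trunc psi n%:R z) u s.
    by apply/funext => z; rewrite /psi_us mulrBr.
  apply: (le_trans (cip_CauchySchwarz mF (isL2_psi_us u s0 md))).
  by rewrite n2_psi_us// ler_wpM2l ?n2_ge0// ltW.
have bY : csq (Y - Xn) <= 2 * M * C * n2 leb1 h * dl.
  rewrite /Xn (wavelet_trunc u n%:R mp mh s0 M0 sG mG) -/Kn.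
  have mB := isL2_wavelet_symbol mK mh mG GC s0.
  have mBn := isL2_wavelet_symbol mKn mh mG GC s0.
  have md := isL2B mB mBn.
  have sB (L : R * R -> R[i]) : supported M (fun x => cR (Num.sqrt s) * G x * Tf L h (s * x)).
    by move=> x; rewrite {1}sG; ring.
  have -> : Y - ift (fun x => cR (Num.sqrt s) * G x * Tf Kn h (s * x)) u =
     ift (fun x => ivl (- M) M x * (cR (Num.sqrt s) * G x * Tf K h (s * x) -
        cR (Num.sqrt s) * G x * Tf Kn h (s * x))) u.
    rewrite /Y -mulN1r -iftD; last 2 first.
    - exact: (supported_cinteg (sB K) mB).
    - exact: (supported_cinteg (sB Kn) mBn).
    by congr ift; apply/funext => x; rewrite mulrBr -(sB K x) -(sB Kn x) mulN1r.
  apply: (le_trans (csq_ift_cut_le u M0 md)).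
  have mTd := isL2B (isL2_Tf mK mh) (isL2_Tf mKn mh).
  have E : n2 leb1 (fun x => cR (Num.sqrt s) * G x * Tf K h (s * x) -
        cR (Num.sqrt s) * G x * Tf Kn h (s * x)) <=
      C * n2 leb1 (fun x => Tf K h x - Tf Kn h x).
    (* The dilation by s contributes [s^-1], which cancels the square of the amplitude
       [Num.sqrt s]. *)
    have mda : isL2 leb1 (fun x => Tf K h (s * x + 0) - Tf Kn h (s * x + 0)) := isL2_aff 0 s1 mTd.
    rewrite (n2_aff 0 s1 mTd) gtr0_norm// mulrA (mulrC C).
    apply: le_n2 => //; first by rewrite mulr_ge0// ltW.
    move=> x; rewrite addr0 -mulrBr csqM csqM csq_cR (sqr_sqrtr (ltW s0)).
    by rewrite ler_wpM2r ?csq_ge0// ler_wpM2l ?(ltW s0).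
  have E2 : n2 leb1 (fun x => Tf K h x - Tf Kn h x) <= n2 leb1 h * dl.
    rewrite -lee_fin n2E//; apply: (le_trans (Tf_diff_le mK mKn mh)).
    by rewrite -n2E// -EFinM lee_fin ler_wpM2l ?n2_ge0// ltW.
  have M2 : 0 <= 2 * M by rewrite mulr_ge0.
  apply: (le_trans (ler_wpM2l M2 E)).
  have := ler_wpM2l (mulr_ge0 M2 C0) E2; by rewrite !mulrA.
have -> : X - Y = (X - Xn) - (Y - Xn) by ring.
apply: (le_trans (csqB_le _ _)).
apply: (@le_trans _ _ ((c1 + c2) * dl)).
  rewrite [leRHS]mulrDl; apply: lerD; first by rewrite /c1 -mulrA; apply: ler_wpM2l.
  have -> : c2 * dl = 2 * (2 * M * C * n2 leb1 h * dl) by rewrite /c2; ring.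
  exact: ler_wpM2l.
rewrite /dl mulrA ler_pdivrMr// mulrC; apply: ler_wpM2l; first exact: ltW.
by rewrite lerDl.
Qed.

End Truncation.

(** * Fibrewise Plancherel and reformulation as isometries for Lebesgue measure *)

Section Fibers.
Context {R : realType}.
Notation RR := (measurableTypeR R).
Implicit Types (f g psi K : R * R -> R[i]) (G h k : R -> R[i]) (u s t x M C sg : R).

(* 1/s on the parameter half-line and 0 elsewhere: it moves the density and the
   domain of [param_set] into the integrand. *)
Definition rposV s : R := \1_(@Rpos R) s * s^-1.

Lemma mem_Rpos s : (s \in @Rpos R) = (0 < s).
Proof. by rewrite mem_setE in_itv /= andbT. Qed.

Lemma rposV_gt0 s : 0 < s -> rposV s = s^-1.
Proof. by move=> s0; rewrite /rposV indicE mem_Rpos s0 mul1r. Qed.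

Lemma rposV_le0 s : s <= 0 -> rposV s = 0.
Proof. by move=> s0; rewrite /rposV indicE mem_Rpos ltNge s0 mul0r. Qed.

Lemma mem_param_set p : (p \in @param_set R) = (0 < p.2).
Proof. by rewrite -mem_Rpos; apply/idP/idP; rewrite !inE; [case|split]. Qed.

Lemma measurable_Rpos : measurable (@Rpos R : set RR).
Proof. exact: measurable_itv. Qed.

Lemma measurable_rposV : measurable_fun (setT : set RR) rposV.
Proof.
apply: measurable_funM; last exact: measurable_inv.
by apply: measurable_indic; exact: measurable_Rpos.
Qed.

Lemma measurable_sqrt : measurable_fun (setT : set RR) (@Num.sqrt R).
Proof. by apply: continuous_measurable_fun; exact: sqrt_continuous. Qed.

(** The density [s^-2] is split evenly, one factor [s^-1] on each side of the inner product, and s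
    <= 0 is sent to 0. The system is then reproducing exactly when [WT] is an isometry for Lebesgue
    measure on the plane. *)
Definition WT psi f : R * R -> R[i] :=
  fun p => cR (rposV p.2) * cip leb2 f (psi_us psi p.1 p.2).

(* [Theta] is [WT psi (tens (ift G) h)] Fourier-transformed in u, and [Omega] is
   the map of the theorem with the square root of the density 1/s absorbed. *)
Definition Theta K G h : R * R -> R[i] :=
  fun z => cR (rposV z.2 * Num.sqrt z.2) * G z.1 * Tf K h (z.2 * z.1).

Definition Omega K sg h : R -> R[i] :=
  fun s => cR (rposV s * Num.sqrt s) * Tf K h (sg * s).

Lemma cmeas_WT psi f : cmeas2 psi -> cmeas2 f -> cmeas2 (WT psi f).
Proof.
move=> mp mf; apply: cmeasM; last exact: cmeas_wavelet.
by apply: cmeas_cR; exact: (measurableT_comp measurable_rposV measurable_snd).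
Qed.

Lemma cmeas_Theta K G h : cmeas2 K -> cmeas1 G -> cmeas1 h -> cmeas2 (Theta K G h).
Proof.
move=> mK mG mh; apply: cmeasM; first apply: cmeasM.
- apply: cmeas_cR; apply: measurable_funM.
    exact: (measurableT_comp measurable_rposV measurable_snd).
  exact: (measurableT_comp measurable_sqrt measurable_snd).
- exact: (cmeas_comp mG measurable_fst).
- apply: (cmeas_comp (cmeas_Tf mK mh)); exact: measurable_funM.
Qed.

Lemma cmeas_Omega K sg h : cmeas2 K -> cmeas1 h -> cmeas1 (Omega K sg h).
Proof.
move=> mK mh; apply: cmeasM.
  by apply: cmeas_cR; apply: measurable_funM; [exact: measurable_rposV|exact: measurable_sqrt].
by apply: (cmeas_comp (cmeas_Tf mK mh)); exact: measurable_funM.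
Qed.

Lemma sqr_rposV_sqrt s : (rposV s * Num.sqrt s) ^+ 2 = rposV s.
Proof.
have [s0|s0] := ltP 0 s; last by rewrite rposV_le0// mul0r expr0n.
rewrite rposV_gt0// exprMn sqr_sqrtr ?ltW// expr2 -mulrA mulVf ?mulr1//.
by rewrite gt_eqF.
Qed.

(* Scale invariance of ds/s. *)
Lemma Theta_Omega K G h x s : x != 0 -> Theta K G h (x, s) =
  (G x * cR (Num.sqrt `|x|)) * Omega K (Num.sg x) h (`|x| * s + 0).
Proof.
move=> x0; rewrite /Theta /Omega /= addr0.
have -> : Num.sg x * (`|x| * s) = s * x by rewrite mulrA -numEsg mulrC.
have a0 : 0 < `|x| by rewrite normr_gt0.
have -> : rposV s * Num.sqrt s = Num.sqrt `|x| * (rposV (`|x| * s) * Num.sqrt (`|x| * s)).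
  have [s0|s0] := ltP 0 s; last by rewrite !rposV_le0 ?mul0r ?mulr0// pmulr_rle0.
  rewrite !rposV_gt0 ?mulr_gt0// sqrtrM ?ltW// invfM.
  have -> : Num.sqrt `|x| * (`|x|^-1 / s * (Num.sqrt `|x| * Num.sqrt s)) =
     Num.sqrt `|x| ^+ 2 * `|x|^-1 * (s^-1 * Num.sqrt s) by ring.
  by rewrite sqr_sqrtr ?ltW// divff ?mul1r// gt_eqF.
rewrite [in LHS]cRM; ring.
Qed.

Lemma N2_Theta_section K G h x : cmeas2 K -> cmeas1 h -> x != 0 ->
  (N2 leb1 (fun s => Theta K G h (x, s)) =
  (csq (G x))%:E * N2 leb1 (Omega K (Num.sg x) h))%E.
Proof.
move=> mK mh x0; have a0 : 0 < `|x| by rewrite normr_gt0.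
have mO := cmeas_Omega (Num.sg x) mK mh.
rewrite (N2_aff 0 (lt0r_neq0 a0) mO) normr_id muleA -EFinM /N2 -ge0_integralZl//; last 3 first.
- by apply/measurable_EFinP; apply: measurable_csq; exact: (cmeas_aff _ _ mO).
- by move=> s _; rewrite lee_fin csq_ge0.
- by rewrite lee_fin mulr_ge0 ?csq_ge0.
apply: eq_integral => s _.
by rewrite Theta_Omega// csqM csqM csq_cR sqr_sqrtr// EFinM.
Qed.

Lemma cip_Theta_section K G1 G2 h k x : x != 0 ->
  isL2 leb1 (Omega K (Num.sg x) h) -> isL2 leb1 (Omega K (Num.sg x) k) ->
  cip leb1 (fun s => Theta K G1 h (x, s)) (fun s => Theta K G2 k (x, s)) =
  (G1 x * conjc (G2 x)) * cip leb1 (Omega K (Num.sg x) h) (Omega K (Num.sg x) k).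
Proof.
move=> x0 m1 m2; have a0 : 0 < `|x| by rewrite normr_gt0.
have a1 := lt0r_neq0 a0.
rewrite {2}/cip (cint_aff 0 a1 (cinteg_cip m1 m2)) normr_id mulrA.
rewrite -cintZ; last exact: (cinteg_aff 0 a1 (cinteg_cip m1 m2)).
congr cint; apply/funext => s.
rewrite !Theta_Omega// !conjcM conjc_cR.
have -> : cR `|x| = cR (Num.sqrt `|x|) * cR (Num.sqrt `|x|).
  by rewrite -cRM -expr2 sqr_sqrtr.
by ring.
Qed.

(** The value q may be infinite, so that finiteness of the norm of [Omega] can be deduced from this
    equation. The condition [G x != 0] lets the support of G select one sign of x. *)
Lemma N2_Theta K G h (q : \bar R) : cmeas2 K -> cmeas1 G -> cmeas1 h -> (0 <= q)%E ->
  (forall x, x != 0 -> G x != 0 -> N2 leb1 (Omega K (Num.sg x) h) = q) ->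
  (N2 leb2 (Theta K G h) = N2 leb1 G * q)%E.
Proof.
move=> mK mG mh q0 H.
rewrite (N2_12 leb1 leb1 (cmeas_Theta mK mG mh)) /N2 -ge0_integralZr//; last 2 first.
- by apply/measurable_EFinP; exact: measurable_csq.
- by move=> x _; rewrite lee_fin csq_ge0.
apply: ge0_ae_eq_integral => //.
- exact: (measurable_N2_12 leb1 (cmeas_Theta mK mG mh)).
- by apply: emeasurable_funM => //; apply/measurable_EFinP; exact: measurable_csq.
- by move=> x _; exact: N2_ge0.
- by move=> x _; rewrite mule_ge0// lee_fin csq_ge0.
apply: filterS leb1_ae_neq0 => x x0 _.
have := N2_Theta_section G mK mh x0; rewrite /N2 => ->.
have [->|Gx] := eqVneq (G x) 0; first by rewrite csq0 !mul0e.
by rewrite -(H x x0 Gx).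
Qed.

Lemma cip_Theta K G1 G2 h k (c : R[i]) : isL2 leb2 (Theta K G1 h) -> isL2 leb2 (Theta K G2 k) ->
  isL2 leb1 G1 -> isL2 leb1 G2 ->
  (forall x, x != 0 -> G1 x != 0 -> [/\ isL2 leb1 (Omega K (Num.sg x) h),
    isL2 leb1 (Omega K (Num.sg x) k) &
    cip leb1 (Omega K (Num.sg x) h) (Omega K (Num.sg x) k) = c]) ->
  cip leb2 (Theta K G1 h) (Theta K G2 k) = cip leb1 G1 G2 * c.
Proof.
move=> m1 m2 mG1 mG2 H; have ci := cinteg_cip m1 m2.
rewrite {1}/cip (cint12 ci) {1}/cip -cintZr; last exact: cinteg_cip.
apply: cint_ae.
- exact: (cinteg_meas (cinteg12 ci)).
- apply: cmeasM; last exact: cmeas_cst.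
  exact: (cinteg_meas (cinteg_cip mG1 mG2)).
apply: filterS leb1_ae_neq0 => x x0.
have [G0|Gx] := eqVneq (G1 x) 0.
  rewrite G0 !mul0r -[RHS](cint0 leb1); congr cint; apply/funext => s.
  by rewrite /Theta /= G0; ring.
have [q1 q2 q3] := H x x0 Gx.
by have := cip_Theta_section G1 G2 x0 q1 q2; rewrite q3 => <-.
Qed.

Section Symbol.
Variables (psi K : R * R -> R[i]).
Hypotheses (mp : isL2 leb2 psi) (FT : is_partial_FT psi K).

Let mK : isL2 leb2 K. Proof. by case: FT. Qed.

(** At fixed s the two functions are a transform pair up to a common scalar, so Plancherel in u
    applies fibre by fibre. For s <= 0 the scalar is 0. *)
Lemma WT_section G h s M C : isL2 leb1 h -> 0 <= M -> supported M G -> isL2 leb1 G ->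
  (forall x, csq (G x) <= C) ->
  let B x := cR (Num.sqrt s) * G x * Tf K h (s * x) in
  [/\ (fun u => WT psi (tens (ift G) h) (u, s)) = (fun u => cR (rposV s) * ift B u),
      (fun x => Theta K G h (x, s)) = (fun x => cR (rposV s) * B x) &
      0 < s -> supported M B /\ isL2 leb1 B].
Proof.
move=> mh M0 sG mG GC B; split.
- apply/funext => u; rewrite /WT /=; have [s0|s0] := ltP 0 s; last first.
    by rewrite rposV_le0// cR0 !mul0r.
  by rewrite (wavelet_ift u mp FT mh s0 M0 sG mG GC).
- by apply/funext => x; rewrite /Theta /B /= cRM; ring.
- move=> s0; split; last exact: isL2_wavelet_symbol mK mh mG GC s0.
  by move=> x; rewrite /B {1}sG; ring.
Qed.

Lemma cip_WT_section G1 G2 h k s M C : isL2 leb1 h -> isL2 leb1 k -> 0 <= M ->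
  supported M G1 -> supported M G2 -> isL2 leb1 G1 -> isL2 leb1 G2 ->
  (forall x, csq (G1 x) <= C) -> (forall x, csq (G2 x) <= C) ->
  [/\ isL2 leb1 (fun u => WT psi (tens (ift G1) h) (u, s)),
      isL2 leb1 (fun x => Theta K G1 h (x, s)) &
  cip leb1 (fun u => WT psi (tens (ift G1) h) (u, s)) (fun u => WT psi (tens (ift G2) k) (u, s)) =
  cR kappa * cip leb1 (fun x => Theta K G1 h (x, s)) (fun x => Theta K G2 k (x, s))].
Proof.
move=> mh mk M0 sG1 sG2 mG1 mG2 GC1 GC2.
have [-> -> H1] := WT_section s mh M0 sG1 mG1 GC1.
have [-> -> H2] := WT_section s mk M0 sG2 mG2 GC2.
have [s0|s0] := ltP 0 s; last first.
  have z (X : R -> R[i]) : (fun u => cR (rposV s) * X u) = fun=> 0.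
    by apply/funext => u; rewrite rposV_le0// cR0 mul0r.
  have z2 (X : R -> R[i]) : isL2 leb1 (fun u => cR (rposV s) * X u).
    by rewrite z; exact: isL2_0.
  have zc (X Y : R -> R[i]) : cip leb1 (fun u => cR (rposV s) * X u) Y = 0.
    by rewrite z /cip -[RHS](cint0 leb1); congr cint; apply/funext => u; rewrite mul0r.
  split; [exact: z2|exact: z2|].
  by rewrite (zc (ift _)) (zc (fun x => _ * _ * _)) mulr0.
have [sB1 mB1] := H1 s0; have [sB2 mB2] := H2 s0.
have [i1 E] := ift_plancherel M0 sB1 sB2 mB1 mB2.
have [i2 _] := ift_plancherel M0 sB2 sB1 mB2 mB1.
split; [exact: (isL2Z _ i1)|exact: (isL2Z _ mB1)|].
rewrite (cipZl _ i1 (isL2Z _ i2)) (cipZr _ i2 i1) E.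
rewrite (cipZl _ mB1 (isL2Z _ mB2)) (cipZr _ mB2 mB1); ring.
Qed.

Lemma N2_WT G h M C : isL2 leb1 h -> 0 <= M -> supported M G -> isL2 leb1 G ->
  (forall x, csq (G x) <= C) ->
  (N2 leb2 (WT psi (tens (ift G) h)) = kappa%:E * N2 leb2 (Theta K G h))%E.
Proof.
move=> mh M0 sG mG GC.
have mA : isL2 leb1 (ift G) by have [] := ift_plancherel M0 sG sG mG mG.
have mT := cmeas_Theta (isL2_meas mK) (isL2_meas mG) (isL2_meas mh).
have mL := cmeas_WT (isL2_meas mp) (isL2_meas (isL2_tens mA mh)).
rewrite (N2_21 leb1 leb1 mL) (N2_21 leb1 leb1 mT) -ge0_integralZl//; last 3 first.
- exact: (measurable_N2_21 leb1 mT).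
- by move=> s _; exact: N2_ge0.
- by rewrite lee_fin ltW// kappa_gt0.
apply: eq_integral => s _.
have [i1 i2 E] := cip_WT_section s mh mh M0 sG sG mG mG GC GC.
rewrite -(n2E i1) -(n2E i2) -EFinM; congr EFin.
by move: E; rewrite !cipff -cRM => /cR_inj.
Qed.

Lemma cip_WT G1 G2 h k M C : isL2 leb1 h -> isL2 leb1 k -> 0 <= M ->
  supported M G1 -> supported M G2 -> isL2 leb1 G1 -> isL2 leb1 G2 ->
  (forall x, csq (G1 x) <= C) -> (forall x, csq (G2 x) <= C) ->
  isL2 leb2 (WT psi (tens (ift G1) h)) -> isL2 leb2 (WT psi (tens (ift G2) k)) ->
  isL2 leb2 (Theta K G1 h) -> isL2 leb2 (Theta K G2 k) ->
  cip leb2 (WT psi (tens (ift G1) h)) (WT psi (tens (ift G2) k)) =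
  cR kappa * cip leb2 (Theta K G1 h) (Theta K G2 k).
Proof.
move=> mh mk M0 sG1 sG2 mG1 mG2 GC1 GC2 L1 L2 T1 T2.
rewrite /cip (cint21 (cinteg_cip L1 L2)) (cint21 (cinteg_cip T1 T2)).
rewrite -cintZ; last exact: (cinteg21 (cinteg_cip T1 T2)).
congr cint; apply/funext => s.
by have [_ _] := cip_WT_section s mh mk M0 sG1 sG2 mG1 mG2 GC1 GC2.
Qed.

End Symbol.

Lemma preserves_ipP K sg : isL2 leb2 K -> preserves_ip K sg <->
  (forall h k, isL2 leb1 h -> isL2 leb1 k -> isL2 leb1 (Omega K sg h) /\
     cip leb1 (Omega K sg h) (Omega K sg k) = cip leb1 h k).
Proof.
move=> mK.
have E h : (fun s => (csq (Tmap K sg h s) / s)%:E) \_ (@Rpos R) =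
    (fun s => (csq (Omega K sg h s))%:E).
  apply/funext => s; rewrite patchE mem_Rpos /Omega csqM csq_cR sqr_rposV_sqrt.
  case: ltP => s0; first by rewrite rposV_gt0// mulrC.
  by rewrite rposV_le0// mul0r.
have E2 h k : cint leb1 (@Rpos R) (fun s => Tmap K sg h s * conjc (Tmap K sg k s) * cR s^-1) =
    cip leb1 (Omega K sg h) (Omega K sg k).
  rewrite cint_mkcond; congr cint; apply/funext => s.
  rewrite /Omega conjcM conjc_cR.
  have -> : cR (rposV s * Num.sqrt s) * Tf K h (sg * s) *
     (cR (rposV s * Num.sqrt s) * conjc (Tf K k (sg * s))) =
     (cR (rposV s * Num.sqrt s) * cR (rposV s * Num.sqrt s)) *
     (Tf K h (sg * s) * conjc (Tf K k (sg * s))) by ring.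
  rewrite -cRM -expr2 sqr_rposV_sqrt /rposV cRM -!TmapE; ring.
split=> [H h k mh mk|H h k mh mk].
  have [[_ hi] hc] := H h k mh mk; split; last by rewrite -E2 hc.
  split; first by apply: cmeas_Omega; [exact: isL2_meas mK|exact: isL2_meas mh].
  by rewrite -E; apply/(integrable_mkcond _ measurable_Rpos).
have [[mO hO] hc] := H h k mh mk.
split; last by rewrite E2.
split.
  have mT : cmeas1 (Tmap K sg h).
    have := cmeas_Tf (isL2_meas mK) (isL2_meas mh) => mT.
    by apply: (cmeas_comp mT); exact: measurable_funM.
  by have [tr ti] := mT; split; exact: measurable_funTS.
by apply/(integrable_mkcond _ measurable_Rpos); rewrite E.
Qed.

Lemma reproducingP psi : isL2 leb2 psi -> reproducing psi <->
  (forall f g, isL2 leb2 f -> isL2 leb2 g -> isL2 leb2 (WT psi f) /\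
     cip leb2 (WT psi f) (WT psi g) = cip leb2 f g).
Proof.
move=> mp.
have mP : measurable (@param_set R : set (RR * RR)%type).
  by apply: measurableX; [exact: measurableT|exact: measurable_Rpos].
have E f g p : isL2 leb2 g -> cR (\1_(@param_set R) p) *
   (cip leb2 f (psi_us psi p.1 p.2) * cip leb2 (psi_us psi p.1 p.2) g * cR (p.2 ^+ 2)^-1) =
   WT psi f p * conjc (WT psi g p).
  move=> mg; have [s0|s0] := ltP 0 p.2; last first.
    by rewrite /WT rposV_le0// cR0 !mul0r indicE mem_param_set ltNge s0 cR0 mul0r.
  rewrite indicE mem_param_set s0.
  rewrite cR1 mul1r /WT conjcM conjc_cR -cipC//; last exact: isL2_psi_us.
  rewrite rposV_gt0// -exprVn expr2 cRM.
  ring.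
split=> [H f g mf mg|H f g mf mg F].
  (* On the diagonal pair (f, f), integrability of the product is square integrability of
     [WT psi f]. *)
  have [_ hfg] := H f g mf mg; have [hff _] := H f f mf mf; split.
    split; first exact: cmeas_WT (isL2_meas mp) (isL2_meas mf).
    have [+ _] := (cintegrable_mkcond leb2 _ mP).1 hff.
    congr (_.-integrable _ _); apply/funext => p.
    by rewrite E// mulC_conj.
  rewrite -hfg cint_mkcond; congr cint; apply/funext => p.
  by rewrite E.
have [i1 hc] := H f g mf mg; have [i2 _] := H g g mg mg.
have EF : (fun p => cR (\1_(@param_set R) p) * F p) = fun p => WT psi f p * conjc (WT psi g p).
  by apply/funext => p; rewrite /F E.
split; first by apply/(cintegrable_mkcond leb2 _ mP); rewrite EF; exact: cinteg_cip.
by rewrite cint_mkcond EF; exact: hc.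
Qed.

End Fibers.

(** * Density of the generators and the equivalence *)

Section Density.
Context {R : realType}.
Notation RR := (measurableTypeR R).
Implicit Types (V : (R * R -> R[i]) -> Prop) (G h k : R -> R[i]).

Let tensB f1 f2 h : (fun z => tens f1 h z - tens f2 h z) = tens (fun x => f1 x - f2 x) h :> (R * R -> R[i]).
Proof. by apply/funext => z; rewrite /tens mulrBl. Qed.

Let tensBr f h1 h2 : (fun z => tens f h1 z - tens f h2 z) = tens f (fun x => h1 x - h2 x) :> (R * R -> R[i]).
Proof. by apply/funext => z; rewrite /tens mulrBr. Qed.

Lemma subspace_tensl V h : closed_subspace leb2 V -> isL2 leb1 h ->
  closed_subspace leb1 (fun f => isL2 leb1 f /\ V (tens f h)).
Proof.
move=> cV mh; split.
- by move=> f [].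
- split; first exact: isL2_0.
  by have := subspace0 cV; congr V; apply/funext => z; rewrite /tens mul0r.
- move=> c f1 f2 [m1 V1] [m2 V2]; split; first by apply: isL2D => //; exact: isL2Z.
  have := subspace_lin cV c V1 V2; congr V; apply/funext => z; rewrite /tens; ring.
- move=> f mf H; split => //; apply: (subspace_closed cV); first exact: isL2_tens.
  move=> e e0; have p0 : 0 < n2 leb1 h + 1 by rewrite ltr_wpDl// n2_ge0.
  have [g [mg Vg] fg] := H (e / (n2 leb1 h + 1)) (divr_gt0 e0 p0).
  exists (tens g h) => //; rewrite tensB (n2_tens (isL2B mf mg) mh).
  move: fg; rewrite ltr_pdivlMr//; apply: le_lt_trans.
  by rewrite ler_wpM2l ?n2_ge0// lerDl.
Qed.

Lemma subspace_tensr V f : closed_subspace leb2 V -> isL2 leb1 f ->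
  closed_subspace leb1 (fun h => isL2 leb1 h /\ V (tens f h)).
Proof.
move=> cV mf; split.
- by move=> h [].
- split; first exact: isL2_0.
  by have := subspace0 cV; congr V; apply/funext => z; rewrite /tens mulr0.
- move=> c f1 f2 [m1 V1] [m2 V2]; split; first by apply: isL2D => //; exact: isL2Z.
  have := subspace_lin cV c V1 V2; congr V; apply/funext => z; rewrite /tens; ring.
- move=> h mh H; split => //; apply: (subspace_closed cV); first exact: isL2_tens.
  move=> e e0; have p0 : 0 < n2 leb1 f + 1 by rewrite ltr_wpDl// n2_ge0.
  have [g [mg Vg] fg] := H (e / (n2 leb1 f + 1)) (divr_gt0 e0 p0).
  exists (tens f g) => //; rewrite tensBr (n2_tens mf (isL2B mh mg)).
  move: fg; rewrite ltr_pdivlMr// mulrC; apply: le_lt_trans.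
  by rewrite ler_wpM2r ?n2_ge0// lerDl.
Qed.

(** Indicators of rectangles are tensor products of indicators, and rectangles form a pi-system
    generating the product sigma-algebra. *)
Lemma subspace_tens V F : closed_subspace leb2 V ->
  (forall f h, isL2 leb1 f -> isL2 leb1 h -> V (tens f h)) -> isL2 leb2 F -> V F.
Proof.
move=> cV Vt mF.
pose A (n : nat) : set RR := `]- n%:R, n%:R]%classic.
have mA n : measurable (A n) by exact: measurable_itv.
have Afin n : (@leb1 R (A n) < +oo)%E by exact: leb1_ivl.
have i2 B n : measurable B -> isL2 leb1 (fun x => cR (\1_(B `&` A n) x)).
  move=> mB; apply: isL2_indic; first exact: measurableI.
  by apply: le_lt_trans (Afin n); apply: le_measure; rewrite ?inE//; exact: measurableI.
have V1 B C n : measurable B -> measurable C ->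
    V (fun z => cR (\1_((B `*` C) `&` (A n `*` A n)) z)).
  move=> mB mC; have := Vt _ _ (i2 B n mB) (i2 C n mC); congr V; apply/funext => z.
  rewrite /tens -cRM -setXI; congr cR; rewrite !indicE in_setX.
  by case: (z.1 \in _); case: (z.2 \in _); rewrite ?mulr1 ?mulr0.
apply: (subspace_full cV (G := [set B `*` C | B in measurable & C in measurable])
  (A := fun n => A n `*` A n) _ _ _ _ _ _ _ _ mF).
- exact: measurable_prod_measurableType.
- move=> _ _ [B1 mB1 [C1 mC1 <-]] [B2 mB2 [C2 mC2 <-]].
  exists (B1 `&` B2); first exact: measurableI.
  exists (C1 `&` C2); first exact: measurableI.
  by rewrite setXI.
- by move=> n; apply: measurableX.
- move=> n; suff : (@leb2 R (A n `*` A n) < +oo)%E by [].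
  have -> : (@leb2 R (A n `*` A n) = @leb1 R (A n) * @leb1 R (A n))%E.
    exact: product_measure1E.
  by rewrite lte_mul_pinfty// ge0_fin_numE.
- move=> n z [/=]; rewrite /A /= !in_itv /= -[n.+1]addn1 natrD.
  by move=> /andP[a b] /andP[c e]; split; apply/andP; split; lra.
- move=> [x y]; exists (Num.trunc (Num.max `|x| `|y|)).+1.
  have := truncnS_gt (Num.max `|x| `|y|); rewrite gt_max !ltr_norml.
  move=> /andP[/andP[x1 x2] /andP[y1 y2]]; split => /=; rewrite /A /= in_itv /=.
    by rewrite x1 ltW.
  by rewrite y1 ltW.
- move=> n; have := V1 setT setT n measurableT measurableT.
  by rewrite setXTT setTI.
- by move=> _ n [B mB [C mC <-]]; exact: V1.
Qed.

(** The symbol [chi i.1] is bounded with bounded support, as the formula for the coefficients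
    demands, and each factor runs through a family with dense span. *)
Definition wavelet_gen (i : R * R) : R * R -> R[i] := tens (ift (chi i.1)) (chi i.2).

Lemma isL2_wavelet_gen i : isL2 leb2 (wavelet_gen i).
Proof. by apply: isL2_tens; [exact: isL2_ift_chi|exact: isL2_chi]. Qed.

(** One factor at a time: density of the range of [ift] for the first, with the second still a step
    function, then density of step functions for the second. *)
Lemma clspan_wavelet_gen F : isL2 leb2 F -> clspan leb2 wavelet_gen F.
Proof.
have cV := clspan_subspace isL2_wavelet_gen.
apply: (subspace_tens cV) => f h mf mh.
have step1 r : clspan leb2 wavelet_gen (tens f (chi r)).
  suff [] : isL2 leb1 f /\ clspan leb2 wavelet_gen (tens f (chi r)) by [].
  apply: (clspan_min (subspace_tensl cV (isL2_chi r)) _ (clspan_ift_chi mf)) => t.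
  by split; [exact: isL2_ift_chi|exact: (clspan_gen isL2_wavelet_gen (t, r))].
suff [] : isL2 leb1 h /\ clspan leb2 wavelet_gen (tens f h) by [].
apply: (clspan_min (subspace_tensr cV mf) _ (clspan_chi mh)) => r.
by split; [exact: isL2_chi|exact: step1].
Qed.

End Density.

(** * The two implications *)

Section Main.
Context {R : realType}.
Notation RR := (measurableTypeR R).
Variables (psi K : R * R -> R[i]).
Hypotheses (mp : isL2 leb2 psi) (FT : is_partial_FT psi K).
Implicit Types (G h k : R -> R[i]).

Let mK : isL2 leb2 K. Proof. by case: FT. Qed.
Let cK : cmeas2 K. Proof. exact: isL2_meas mK. Qed.

Lemma supported_ivl (M a b : R) : - M <= a -> b <= M -> supported M (ivl a b).
Proof.
move=> Ma bM x; rewrite !ivlE -cRM; congr cR.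
case: (boolP (a < x <= b)) => [/andP[ax xb]|_]; last by rewrite mulr0.
by rewrite (le_lt_trans Ma ax) (le_trans xb bM) mulr1.
Qed.

Lemma supported_chi (M t : R) : 0 <= M -> `|t| <= M -> supported M (chi t).
Proof.
move=> M0; rewrite ler_norml => /andP[Mt tM] x; rewrite /chi mulrBr.
by rewrite -!supported_ivl//; lra.
Qed.

Lemma csq_chi (t x : R) : csq (chi t x) <= 1.
Proof.
rewrite chiE csq_cR; case: (x <= t); case: (x <= 0) => /=;
  rewrite ?subrr ?subr0 ?sub0r ?sqrrN ?expr1n ?expr0n//=.
Qed.

(** Test on [tens (ift G) h] with G the indicator of a unit interval on one side of the origin, so
    that only one sign enters. The constant [kappa] arises on both sides, from Plancherel in u and
    from the norm of [ift G]. *)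
Lemma reproducing_preserves (sg a b : R) : reproducing psi -> a <= b -> b - a = 1 -> -1 <= a -> b <= 1 ->
  (forall x, x != 0 -> a < x <= b -> Num.sg x = sg) -> preserves_ip K sg.
Proof.
move=> /(reproducingP mp) rep ab ab1 a1 b1 Hsg; apply/(preserves_ipP sg mK).
pose G := ivl a b; have mG : isL2 leb1 G := isL2_ivl a b.
have sG : supported 1 G by exact: supported_ivl.
have bG x : csq (G x) <= 1 by exact: csq_ivl.
have mA : isL2 leb1 (ift G) by have [] := ift_plancherel ler01 sG sG mG mG.
have nG : n2 leb1 G = 1 by rewrite n2_ivl.
have k0 := kappa_gt0 (R := R).
have G0 x : G x != 0 -> a < x <= b.
  by rewrite /G ivlE; case: (a < x <= b) => //; rewrite eqxx.
have L h : isL2 leb1 h -> isL2 leb2 (Theta K G h) /\ isL2 leb1 (Omega K sg h).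
  move=> mh; have [mL _] := rep _ _ (isL2_tens mA mh) (isL2_tens mA mh).
  have /isL2P[_] := mL; rewrite (N2_WT mp FT mh ler01 sG mG bG).
  have mT := cmeas_Theta cK (isL2_meas mG) (isL2_meas mh).
  have E : N2 leb2 (Theta K G h) = N2 leb1 (Omega K sg h).
    rewrite (@N2_Theta _ _ _ _ (N2 leb1 (Omega K sg h)) cK (isL2_meas mG) (isL2_meas mh)).
    - by rewrite -(n2E mG) nG mul1e.
    - exact: N2_ge0.
    - by move=> x x0 /G0 /(Hsg x x0) ->.
  (* Since [kappa] is positive, an infinite norm of [Theta] would make that of the wavelet transform
     infinite. *)
  move=> hT; have fT : (N2 leb2 (Theta K G h) < +oo)%E.
    move: hT (N2_ge0 leb2 (Theta K G h)); case: (N2 leb2 (Theta K G h)) => [r _ _|+ _|//].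
      by rewrite ltry.
    by rewrite gt0_muley ?lte_fin.
  split; apply/isL2P; split => //; last by rewrite -E.
  exact: (cmeas_Omega sg cK (isL2_meas mh)).
move=> h k mh mk; have [T1 O1] := L h mh; have [T2 O2] := L k mk; split => //.
have [L1 C12] := rep _ _ (isL2_tens mA mh) (isL2_tens mA mk).
have [L2 _] := rep _ _ (isL2_tens mA mk) (isL2_tens mA mk).
move: C12; rewrite (cip_WT mp FT mh mk ler01 sG sG mG mG bG bG L1 L2 T1 T2).
rewrite (cip_tens mA mh mA mk) (ift_plancherel ler01 sG sG mG mG).2.
rewrite (@cip_Theta _ _ _ _ _ _ (cip leb1 (Omega K sg h) (Omega K sg k)) T1 T2 mG mG); last first.
  by move=> x x0 /G0 /(Hsg x x0) ->.
rewrite cipff nG cR1 !mul1r mulr1 => /(congr1 (fun z => cR kappa^-1 * z)).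
by rewrite !mulrA -cRM mulVf ?gt_eqF// cR1 !mul1r.
Qed.

(** On the generators both signs are needed, because [chi i.1] may lie on either side of the origin.
    The rest is the extension theorem with k = 1, each value of [WT] being an inner product and
    hence continuous in f. *)
Lemma preserves_reproducing : preserves_ip K 1 -> preserves_ip K (-1) -> reproducing psi.
Proof.
move=> /(preserves_ipP 1 mK) P1 /(preserves_ipP (-1) mK) P2; apply/(reproducingP mp).
have P (x : R) h k : x != 0 -> isL2 leb1 h -> isL2 leb1 k ->
    isL2 leb1 (Omega K (Num.sg x) h) /\
    cip leb1 (Omega K (Num.sg x) h) (Omega K (Num.sg x) k) = cip leb1 h k.
  by move=> x0 mh mk; case: (ltgtP x 0) x0 => // x0 _;
    [rewrite ltr0_sg//; exact: P2|rewrite gtr0_sg//; exact: P1].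
have mgen := @isL2_wavelet_gen R.
have T2 (i : R * R) : isL2 leb2 (Theta K (chi i.1) (chi i.2)).
  have m1 := isL2_chi i.1; have m2 := isL2_chi i.2.
  apply/isL2P; split; first exact: cmeas_Theta cK (isL2_meas m1) (isL2_meas m2).
  rewrite (@N2_Theta _ _ _ _ (N2 leb1 (chi i.2)) cK (isL2_meas m1) (isL2_meas m2)).
  - by rewrite -!n2E// -EFinM ltry.
  - exact: N2_ge0.
  - move=> x x0 _; have [q1 q2] := P x _ _ x0 m2 m2.
    by rewrite -(n2E q1) -(n2E m2); move: q2; rewrite !cipff => /cR_inj ->.
have Lgen i : isL2 leb2 (WT psi (wavelet_gen i)).
  have m1 := isL2_chi i.1; have m2 := isL2_chi i.2.
  have sG : supported `|i.1| (chi i.1) by exact: supported_chi.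
  apply/isL2P; split; first exact: cmeas_WT (isL2_meas mp) (isL2_meas (mgen i)).
  by rewrite (N2_WT mp FT m2 (normr_ge0 _) sG m1 (csq_chi _)) -(n2E (T2 i)) -EFinM ltry.
have Liso i j : cip leb2 (WT psi (wavelet_gen i)) (WT psi (wavelet_gen j)) = cR 1 * cip leb2 (wavelet_gen i) (wavelet_gen j).
  (* Plancherel asks for a common support of the two symbols. *)
  pose M := Num.max `|i.1| `|j.1|.
  have M0 : 0 <= M by rewrite le_max normr_ge0.
  have s1 : supported M (chi i.1) by apply: supported_chi => //; rewrite le_max lexx.
  have s2 : supported M (chi j.1) by apply: supported_chi => //; rewrite le_max lexx orbT.
  have [m1 m2] := (isL2_chi i.1, isL2_chi i.2).
  have [m3 m4] := (isL2_chi j.1, isL2_chi j.2).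
  rewrite (cip_WT mp FT m2 m4 M0 s1 s2 m1 m3 (csq_chi _) (csq_chi _) (Lgen i) (Lgen j) (T2 i) (T2 j)).
  rewrite (@cip_Theta _ _ _ _ _ _ (cip leb1 (chi i.2) (chi j.2)) (T2 i) (T2 j) m1 m3); last first.
    move=> x x0 _; have [p1 p2] := P x _ _ x0 m2 m4; have [p3 _] := P x _ _ x0 m4 m4.
    by split.
  (* Plancherel read backwards absorbs [kappa] into the inner product of the two [ift (chi _)]. *)
  rewrite cR1 mul1r mulrA -(ift_plancherel M0 s1 s2 m1 m3).2.
  by rewrite -(cip_tens (isL2_ift_chi i.1) m2 (isL2_ift_chi j.1) m4).
have Llin c f g p : isL2 leb2 f -> isL2 leb2 g ->
    WT psi (fun z => f z + c * g z) p = WT psi f p + c * WT psi g p.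
  move=> mf mg; have [s0|s0] := ltP 0 p.2; last first.
    by rewrite /WT rposV_le0// cR0 !mul0r mulr0 addr0.
  have mpu := isL2_psi_us p.1 s0 mp.
  by rewrite /WT (cipDl mf (isL2Z c mg) mpu) (cipZl c mg mpu); ring.
have Lcont p : exists C, forall f, isL2 leb2 f -> csq (WT psi f p) <= C * n2 leb2 f.
  have [s0|s0] := ltP 0 p.2; last first.
    by exists 0 => f _; rewrite /WT rposV_le0// cR0 mul0r csq0 mul0r.
  have mpu := isL2_psi_us p.1 s0 mp.
  exists (csq (cR (rposV p.2)) * n2 leb2 (psi_us psi p.1 p.2)) => f mf.
  rewrite /WT csqM -mulrA ler_wpM2l ?csq_ge0// mulrC.
  exact: cip_CauchySchwarz.
have Lmeas f : isL2 leb2 f -> cmeas2 (WT psi f).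
  by move=> mf; apply: cmeas_WT; [exact: isL2_meas mp|exact: isL2_meas mf].
move=> f g mf mg; have [sf sg] := (clspan_wavelet_gen mf, clspan_wavelet_gen mg); split.
  exact: (extension_isL2 (T' := (RR * RR)%type) mgen ler01 Llin Lcont Lmeas Lgen Liso sf).
have := extension_isometry (T' := (RR * RR)%type) mgen ler01 Llin Lcont Lmeas Lgen Liso sf sg.
by rewrite cR1 mul1r.
Qed.

End Main.

Theorem theorem1p1 (R : realType) (psi Psihat : R * R -> R[i]) :
  isL2 leb2 psi -> is_partial_FT psi Psihat ->
  (reproducing psi <-> (preserves_ip Psihat 1 /\ preserves_ip Psihat (-1))).
Proof.
move=> mp FT; split=> [rep|[P1 P2]]; last exact: (preserves_reproducing mp FT P1 P2).
split.
- apply: (reproducing_preserves mp FT (a := 0) (b := 1) rep); do ?lra.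
  by move=> x _ /andP[x0 _]; rewrite gtr0_sg.
(* The interval ]-1, 0] contains 0, whose sign is not -1; the condition [x != 0] excludes this
   point. *)
- apply: (reproducing_preserves mp FT (a := -1) (b := 0) rep); do ?lra.
  move=> x x0 /andP[_]; rewrite le_eqVlt (negbTE x0) /= => xn.
  by rewrite ltr0_sg.
Qed.
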